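(* Let $w$ be a positive superharmonic function on the open unit disk $\mathbb{D}$, and let $\mathcal{D}_w$ be the associated weighted Dirichlet space. Then $\mathcal{D}_w$ contains a surjective function, that is, a function $f\in\mathcal{D}_w$ with $f(\mathbb{D})=\mathbb{C}$, if and only if $\inf_{z\in\mathbb{D}}w(z)=0$.
   Context: $\mathbb{D}=\{z\in\mathbb{C}:|z|<1\}$, and $\mathrm{Hol}(\mathbb{D})$ is the set of holomorphic functions $\mathbb{D}\to\mathbb{C}$. Superharmonic functions are understood in the usual sense: $w:\mathbb{D}\to(-\infty,\infty]$ is lower semicontinuous, satisfies the super-mean-value inequality, and is not identically $+\infty$; positive means $w(z)>0$ for all $z\in\mathbb{D}$. For such $w$ and $f\in\mathrm{Hol}(\mathbb{D})$, set $\mathcal{D}_w(f):=\frac{1}{\pi}\int_{\mathbb{D}}|f'(z)|^2w(z)\,dA(z)$, where $dA$ is area (planar Lebesgue) measure, and let $\mathcal{D}_w:=\{f\in\mathrm{Hol}(\mathbb{D}):\mathcal{D}_w(f)<\infty\}$. *)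

(* Defs.v *)
From HB Require Import structures.
From mathcomp Require Import all_boot all_order all_algebra.
From mathcomp Require Import complex.
From mathcomp Require Import all_classical all_reals all_analysis.

Set Implicit Arguments.
Unset Strict Implicit.
Unset Printing Implicit Defensive.

Import Order.TTheory GRing.Theory Num.Theory numFieldNormedType.Exports.

Local Open Scope classical_set_scope.
Local Open Scope ring_scope.
Local Open Scope complex_scope.

(* Naming R[i] at the structure numClosedFieldType is what makes it inherit the
   topology and the normed-module structure over itself.  Its norm `|z| is
   itself a complex number, and x < y in it means that y - x is a positive
   real; the real-valued modulus is complex.Re `|z|. *)
Definition cplx (R : realType) : numClosedFieldType := R[i].

Definition plane_to_cplx (R : realType) (p : R * R) : cplx R := p.1 +i* p.2.

Definition unit_disk (R : realType) : set (cplx R) := [set z | `|z| < 1].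

(* derivable f z 1 over the field cplx R says that (f (z + h) - f z) / h has a
   limit as the complex number h tends to 0; derive1 f z is that limit. *)
Definition holomorphic_on (R : realType) (D : set (cplx R))
    (f : cplx R -> cplx R) : Prop :=
  forall z, D z -> derivable f z 1.

Definition circle_mean (R : realType) (w : cplx R -> \bar R)
    (z : cplx R) (r : R) : \bar R :=
  (((2 * pi)^-1)%:E *
   \int[lebesgue_measure]_(t in `[0%R, (2 * pi)%R])
     w (z + plane_to_cplx (r * cos t, r * sin t))%R)%E.

(* Only the values of w on D matter.  For nonempty D the last conjunct is
   "w is not identically +oo on D"; it is meant for D open and connected. *)
Definition superharmonic_on (R : realType) (D : set (cplx R))
    (w : cplx R -> \bar R) : Prop :=
  [/\ forall z, D z -> w z != -oo%E,
      @lower_semicontinuous (subspace D) R w,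
      forall (z : cplx R) (r : R), 0 < r ->
        [set u : cplx R | `|u - z| <= r%:C] `<=` D ->
        (circle_mean w z r <= w z)%E
    & exists2 z, D z & w z != +oo%E].

Definition area_measure (R : realType) :=
  (@lebesgue_measure R \x @lebesgue_measure R)%E.

Definition weighted_dirichlet_integral (R : realType)
    (w : cplx R -> \bar R) (f : cplx R -> cplx R) : \bar R :=
  ((pi^-1)%:E *
   \int[@area_measure R]_(p in @plane_to_cplx R @^-1` @unit_disk R)
     (((complex.Re `|derive1 f (plane_to_cplx p)|) ^+ 2)%R%:E *
      w (plane_to_cplx p)))%E.

(* Elements are functions on all of C, constrained only on the disk. *)
Definition weighted_dirichlet_space (R : realType) (w : cplx R -> \bar R) :
    set (cplx R -> cplx R) :=
  [set f | holomorphic_on (@unit_disk R) f /\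
           (weighted_dirichlet_integral w f < +oo)%E].

(* Main.v *)
Require Import Defs.
From HB Require Import structures.
From mathcomp Require Import all_boot all_order all_algebra.
From mathcomp Require Import complex.
From mathcomp Require Import all_classical all_reals all_analysis.
From mathcomp Require Import measurable_realfun ring lra.
Import Order.TTheory GRing.Theory Num.Theory numFieldNormedType.Exports.
Local Open Scope classical_set_scope.
Local Open Scope ring_scope.
Local Open Scope complex_scope.
Set Implicit Arguments.
Unset Strict Implicit.
Unset Printing Implicit Defensive.

(* If w >= c > 0 then the area of f(D), counted with multiplicity, is at most
   the integral of |f'|^2 <= |f'|^2 w / c, hence finite, and f(D) is not the
   plane.  To keep this elementary, D is cut into the sets where f has local
   slope between 2^j and 2^(j+1), and each of them is mapped into a set whose
   area is at most a constant times 4^j times its own.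

   If inf w = 0, lower semicontinuity forces w to be small only near the circle,
   so there are points z_k tending to it very fast with w(z_k) as small as
   desired.  With kappa = 1 - |a|^2 and g_a(z) = kappa / (1 - conj(a) z), put
   f = sum_k A_k g(g - 1), with g = g_(z_k) and rapidly growing A_k.  Near z_k
   the k-th term takes every value of size A_k / 100 already for g close to 1,
   where the other terms are nearly constant in g, so f is onto.  The terms lie
   in D_w because a positive superharmonic weight W satisfies
     integral of W(z) / (|z - a|^2 + d^2)^2 <= C W(a) / d^2,  d = (1 - |a|) / 16.
   This is proved without Riesz measures: averaging over circles of radius r is
   self-adjoint, W dominates its averages, and the potential
   (1 - |z|^2) / (|z - a|^2 + d^2) is subharmonic away from a with Laplacian
   comparable to d times the kernel; the defect near a is controlled by the circle means
   of W around a itself. *)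

(** * Area and Lipschitz images *)

Section open_sets.
Context {R : realType}.
Notation plane := (measurableTypeR R * measurableTypeR R)%type.
Notation area := (@lebesgue_measure R \x @lebesgue_measure R)%E.

(** The two factors of a spike have separate jobs. The map g_a is Moebius, equals 1 at a and sends
    the disk onto the disk of center 1 and radius |a|, so g - 1 covers a fixed neighbourhood of 0;
    the factor g is of order kappa away from a and makes A g(g - 1) negligible there once A kappa is
    small. As |1 - conj(a) z|^2 = |z - a|^2 + kappa (1 - |z|^2) and kappa is comparable to d, the
    kernel estimate bounds the weighted integral of a spike by a constant times A^2 w(a): this
    dictates how small w(z_k) must be. The potential is modelled on the Poisson kernel, which is
    harmonic for |a| = 1 and d = 0; pulling a inside by 16 d produces the positive Laplacian. The
    duality argument subtracts the integral of potential times weight from both sides, so that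
    integral must be finite and the circles must stay in the disk. Hence the weight is truncated at
    n and the potential cut at a level e, and both are removed at the end by monotone convergence.
    Areas are needed only up to a constant factor, so one covering lemma for Lipschitz images serves
    both the range of f and polar coordinates. *)

Definition grid_cell (n : nat) (p : plane) : int * int :=
  (Num.floor (p.1 * n.+1%:R), Num.floor (p.2 * n.+1%:R)).

(** Squares are numbered by [nat] so that sigma-subadditivity applies directly; a number that codes
    no pair of integers gets the empty set. *)
Definition grid_square (n k : nat) : set plane :=
  if pickle_inv k is Some c then [set p | grid_cell n p = c] else set0.

Lemma floor_preimage_itv (n : nat) (i : int) :
  [set x : R | Num.floor (x * n.+1%:R) = i] =
  `[i%:~R / n.+1%:R, (i + 1)%:~R / n.+1%:R[%classic.
Proof.
apply/seteqP; split => x /=; rewrite in_itv /=.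
  by move=> <-; rewrite ler_pdivrMr// ltr_pdivlMr// floor_itv.
rewrite ler_pdivrMr// ltr_pdivlMr// => H.
exact: floor_def.
Qed.

Lemma grid_squareE n k : grid_square n k =
  if pickle_inv k is Some c then
    [set x : measurableTypeR R | Num.floor (x * n.+1%:R) = c.1] `*`
    [set x : measurableTypeR R | Num.floor (x * n.+1%:R) = c.2]
  else set0.
Proof.
rewrite /grid_square; case: pickle_inv => // c.
by apply/seteqP; split => -[x y] /= => [<-|[/= h1 h2]];
  [by split|rewrite /grid_cell h1 h2; case: c {h1 h2}].
Qed.

Lemma measurable_grid_square n k : measurable (grid_square n k).
Proof.
rewrite grid_squareE; case: pickle_inv => // c.
by apply: measurableX; rewrite floor_preimage_itv; exact: measurable_itv.
Qed.

Lemma area_grid_square n k : grid_square n k !=set0 ->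
  area (grid_square n k) = ((n.+1%:R^-1) ^+ 2)%:E.
Proof.
move=> [p]; rewrite grid_squareE; case: pickle_inv => // c _.
rewrite [LHS]product_measure1E; [|by rewrite floor_preimage_itv; exact: measurable_itv..].
have itvE (i : int) : lebesgue_measure
    ([set x : measurableTypeR R | Num.floor (x * n.+1%:R) = i] : set (measurableTypeR R))
    = (n.+1%:R^-1)%:E :> \bar R.
  rewrite floor_preimage_itv lebesgue_measure_itv /= lte_fin.
  rewrite ltr_pM2r ?invr_gt0// ltr_int ltrDl ltr01 -EFinB; congr EFin.
  by rewrite -mulrBl -intrB addrAC subrr add0r mul1r.
by rewrite expr2 EFinM; congr (_ * _)%E; exact: itvE.
Qed.

Lemma trivIset_grid_square n : trivIset setT (grid_square n).
Proof.
move=> k l _ _ [p []]; rewrite /grid_square.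
have := @pickle_invK (int * int)%type k; have := @pickle_invK (int * int)%type l.
by case: pickle_inv => // d <-; case: pickle_inv => // c <- /= -> ->.
Qed.

Lemma grid_square_cover n p : exists k, grid_square n k p.
Proof. by exists (pickle (grid_cell n p)); rewrite /grid_square pickleK_inv. Qed.

Lemma floor_eq_dist (n : nat) (x y : R) :
  Num.floor (x * n.+1%:R) = Num.floor (y * n.+1%:R) -> `|x - y| <= n.+1%:R^-1.
Proof.
move=> xy; rewrite -(@ler_pM2r _ n.+1%:R)// mulVf// -[X in _ * X]ger0_norm//.
rewrite -normrM mulrBl ler_norml.
have := floor_itv (x * n.+1%:R); have := floor_itv (y * n.+1%:R).
by rewrite xy !intrD; move=> /andP[? ?] /andP[? ?]; apply/andP; split; lra.
Qed.

Lemma grid_square_dist n k p q : grid_square n k p -> grid_square n k q ->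
  `|p.1 - q.1| <= n.+1%:R^-1 /\ `|p.2 - q.2| <= n.+1%:R^-1.
Proof.
rewrite /grid_square; case: pickle_inv => // c /= <- [] /esym h1 /esym h2.
by split; exact: floor_eq_dist.
Qed.

Lemma open_box (U : set plane) p : open (U : set (R * R)) -> U p ->
  exists2 e : R, 0 < e & forall q, `|p.1 - q.1| < e -> `|p.2 - q.2| < e -> U q.
Proof.
move=> oU Up; have := open_nbhs_nbhs (conj oU Up).
move=> /nbhs_ballP[e /= e0 eU]; exists e => // q h1 h2.
by apply: eU; split.
Qed.

Lemma grid_square_sub_open (U : set plane) p : open (U : set (R * R)) -> U p ->
  \forall n \near \oo, forall k, grid_square n k p -> grid_square n k `<=` U.
Proof.
move=> oU Up; have [e e0 eU] := open_box oU Up.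
near=> n => k np q nq; have [h1 h2] := grid_square_dist np nq.
have ne : n.+1%:R^-1 < e by near: n; exact: near_infty_natSinv_lt (PosNum e0).
by apply: eU; apply: le_lt_trans ne.
Unshelve. all: by end_near. Qed.

(** The product sigma-algebra is generated by rectangles, so an open set has to be written as a
    countable union: the grid squares of all meshes that lie inside [U] fill it. *)
Lemma measurable_open_plane (U : set plane) :
  open (U : set (R * R)) -> measurable U.
Proof.
move=> oU.
rewrite (_ : U = \bigcup_n \bigcup_k
   (if `[< grid_square n k `<=` U >] then grid_square n k else set0)).
  apply: bigcup_measurable => n _; apply: bigcup_measurable => k _.
  by case: ifP => // _; exact: measurable_grid_square.
apply/seteqP; split => [p Up|p [n _ [k _]]]; last first.
  by case: ifPn => // /asboolP; exact.
have [N _ /(_ N (leqnn N))] := grid_square_sub_open oU Up.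
have [k kp] := grid_square_cover N p.
by move=> /(_ k kp) sub; exists N => //; exists k => //; rewrite asboolT.
Qed.

(** A trade: the squares indexed by [I] are disjoint and lie in [U], and each is exchanged for a set
    of at most [L] times its area. *)
Lemma area_le_squares n (I : set nat) (U : set plane)
    (B : nat -> set plane) (L : R) : measurable U ->
  (forall k, I k -> [/\ grid_square n k `<=` U & grid_square n k !=set0]) ->
  (forall k, I k -> measurable (B k) /\
     (area (B k) <= (L * (n.+1%:R^-1) ^+ 2)%:E)%E) -> 0 <= L ->
  (area (\bigcup_(k in I) B k) <= L%:E * area U)%E.
Proof.
move=> mU IU IB L0.
pose F k := if `[< I k >] then B k else set0.
pose G k := if `[< I k >] then grid_square n k else set0.
have mF k : measurable (F k).
  by rewrite /F; case: ifPn => // /asboolP /IB[].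
have mG k : measurable (G k).
  by rewrite /G; case: ifPn => // _; exact: measurable_grid_square.
have -> : \bigcup_(k in I) B k = \bigcup_k F k.
  apply/seteqP; split => p [k]; rewrite /F.
    by move=> Ik Bp; exists k => //; rewrite asboolT.
  by move=> _; case: ifPn => // /asboolP Ik Bp; exists k.
apply: (@le_trans _ _ (\sum_(0 <= k <oo) area (F k))%E).
  by apply: measure_sigma_subadditive => //; exact: bigcup_measurable.
apply: (@le_trans _ _ (\sum_(0 <= k <oo) L%:E * area (G k))%E).
  apply: lee_nneseries => // k _.
  rewrite /F /G; case: ifPn => [/asboolP Ik|_]; last by rewrite !measure0 mule0.
  by rewrite (area_grid_square (IU _ Ik).2) -EFinM (IB _ Ik).2.
rewrite nneseriesZl//; apply: lee_wpmul2l => //.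
rewrite -measure_semi_bigcup//; last 2 first.
- move=> k l _ _ [p []]; rewrite /G; do 2 case: ifPn => // _.
  by move=> kp lp; apply: (@trivIset_grid_square n) => //; exists p.
- exact: bigcup_measurable.
apply: le_measure; rewrite ?inE//; first exact: bigcup_measurable.
by move=> p [k _]; rewrite /G; case: ifPn => // /asboolP /IU[+ _]; exact.
Qed.

End open_sets.

(** * Regularity of finite measures on the plane *)

Section regular_sets.
Context {R : realType}.
Notation plane := (measurableTypeR R * measurableTypeR R)%type.

Section regularity.
Variable nu : {measure set plane -> \bar R}.
Hypothesis nu_fin : (nu setT < +oo)%E.

(** With open and closed sets, rather than open and compact ones, [U] and [F] simply swap roles
    under complement. *)
Definition sandwiched (E : set plane) : Prop := forall e : R, 0 < e ->
  exists U F : set plane, [/\ open (U : set (R * R)), closed (F : set (R * R)),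
    F `<=` E, E `<=` U & (nu (U `\` F) < e%:E)%E].

Lemma measurable_closed_plane (F : set plane) :
  closed (F : set (R * R)) -> measurable F.
Proof.
move=> cF; rewrite -(setCK F); apply: measurableC.
by apply: measurable_open_plane; exact: closed_openC.
Qed.

Lemma nu_lty A : measurable A -> (nu A < +oo)%E.
Proof.
by move=> mA; apply: le_lt_trans nu_fin; apply: le_measure; rewrite ?inE.
Qed.

(** Continuity from above at the empty set, which needs [nu] finite. *)
Lemma nu_vanish (F : (set plane)^nat) (e : R) : 0 < e ->
  (forall n, measurable (F n)) -> {homo F : n m / (n <= m)%N >-> (m <= n)%O} ->
  \bigcap_n F n = set0 -> exists n, (nu (F n) < e%:E)%E.
Proof.
move=> e0 mF ndF F0.
have h : (nu \o F) x @[x --> \oo] --> nu (\bigcap_n F n).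
  apply: nonincreasing_cvg_mu => //; first exact: nu_lty.
  exact: bigcap_measurable.
rewrite F0 measure0 in h.
have /h [N _ /(_ N (leqnn N)) /= ?] : nbhs (0 : \bar R)%E [set x | (x < e%:E)%E].
  exact: nbhs_open_ereal_lt.
by exists N.
Qed.

Lemma sandwiched0 : sandwiched set0.
Proof.
move=> e e0; exists set0, set0.
by split; [exact: open0|exact: closed0|by []|by []|rewrite setD0 measure0].
Qed.

Lemma sandwichedC E : sandwiched E -> sandwiched (~` E).
Proof.
move=> sE e /sE[U [F [oU cF FE EU h]]]; exists (~` F), (~` U).
split; [exact: closed_openC|exact: open_closedC|exact: subsetC|exact: subsetC|].
by rewrite setDE setCK setIC.
Qed.

(** All the open sets may be united, with errors (e/2) / 2^(n+1). An infinite union of closed sets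
    need not be closed, so only finitely many are kept and [nu_vanish] pays the tail with the other
    e/2. *)
Lemma sandwiched_bigcup (E : (set plane)^nat) : (forall n, sandwiched (E n)) ->
  sandwiched (\bigcup_n E n).
Proof.
move=> sE e e0.
have e20 : 0 < e / 2 by rewrite divr_gt0.
have /choice[UF UFP] n : exists UF : set plane * set plane,
    [/\ open (UF.1 : set (R * R)), closed (UF.2 : set (R * R)),
    UF.2 `<=` E n, E n `<=` UF.1 & (nu (UF.1 `\` UF.2) < ((e / 2) / (2 ^ n.+1)%:R)%:E)%E].
  have [|U [F UFE]] := sE n ((e / 2) / (2 ^ n.+1)%:R).
    by rewrite divr_gt0// ltr0n expn_gt0.
  by exists (U, F).
pose U := \bigcup_n (UF n).1.
pose F n := \big[setU/set0]_(i < n) (UF i).2.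
have mU n : measurable (UF n).1.
  by apply: measurable_open_plane; have [] := UFP n.
have mF n : measurable (UF n).2.
  by apply: measurable_closed_plane; have [] := UFP n.
have mUU : measurable U by exact: bigcup_measurable.
have mFF n : measurable (F n) by exact: bigsetU_measurable.
have mFFF : measurable (\bigcup_n (UF n).2) by exact: bigcup_measurable.
have [||||n nuG] := @nu_vanish (fun n => (\bigcup_n (UF n).2) `\` F n) (e / 2) => //.
- by move=> n; exact: measurableD.
- move=> m n mn; rewrite subsetEset; apply: setDS.
  by apply: (@subset_bigsetU _ (fun i => (UF i).2)).
- apply/seteqP; split => // p h; have [[i _ iF] _] := h 0%N I.
  have [_ +] := h i.+1 I; apply.
  by rewrite /F big_ord_recr /=; right.
exists U, (F n); split.
- by apply: bigcup_open => i _; have [] := UFP i.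
- by apply: closed_bigsetU => i _; have [] := UFP i.
- rewrite /F -(bigcup_mkord n (fun i => (UF i).2)) => p [i _ iF]; exists i => //.
  by have [_ _ + _ _] := UFP i; exact.
- move=> p [i _ iE]; exists i => //.
  by have [_ _ _ + _] := UFP i; exact.
have -> : e%:E = (e / 2)%:E + (e / 2)%:E :> \bar R by rewrite -EFinD -splitr.
apply: (@le_lt_trans _ _ (nu (\bigcup_n ((UF n).1 `\` (UF n).2)) +
                          nu (\bigcup_n (UF n).2 `\` F n))%E).
  apply: (@le_trans _ _ (nu ((\bigcup_n ((UF n).1 `\` (UF n).2)) `|`
                           (\bigcup_n (UF n).2 `\` F n)))).
    apply: le_measure; rewrite ?inE//.
    - exact: measurableD.
    - apply: measurableU; last exact: measurableD.
      by apply: bigcup_measurable => i _; exact: measurableD.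
    move=> p [[i _ iU] nF].
    have [iF|niF] := pselect ((\bigcup_n (UF n).2) p); first by right.
    by left; exists i => //; split => // h; apply: niF; exists i.
  apply: measureU2; last exact: measurableD.
  by apply: bigcup_measurable => i _; exact: measurableD.
apply: lee_ltD => //.
- by rewrite ge0_fin_numE// nu_lty//; apply: bigcup_measurable => i _; exact: measurableD.
apply: le_trans (epsilon_trick0 xpredT (ltW e20)).
apply: (@le_trans _ _ (\sum_(0 <= i <oo) nu ((UF i).1 `\` (UF i).2))%E).
  apply: measure_sigma_subadditive => //; first by move=> n0; exact: measurableD.
  by apply: bigcup_measurable => i _; exact: measurableD.
by apply: lee_nneseries => // i _; have [_ _ _ _ /ltW] := UFP i.
Qed.

Lemma sandwiched_preimage (f : plane -> measurableTypeR R) :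
  continuous (f : R * R -> R) ->
  forall A, measurable A -> sandwiched (f @^-1` A).
Proof.
move=> cf A; rewrite [X in X A](RGenOInfty.measurableE R) => mA.
pose S := [set B : set (measurableTypeR R) | sandwiched (f @^-1` B)].
suff : <<s (@RGenOInfty.G R) >> `<=` S by exact.
apply: smallest_sub.
- split => /=.
  + rewrite /S /= preimage_set0; exact: sandwiched0.
  + by move=> B SB; rewrite setTD /S /= preimage_setC; exact: sandwichedC.
  + by move=> F SF; rewrite /S /= preimage_bigcup; exact: sandwiched_bigcup.
(* The preimage of an open half-line is open and is exhausted from inside by the closed sets
   [C (x + n.+1%:R^-1)]. *)
move=> _ [x ->] e e0.
pose C (r : R) := f @^-1` `[r, +oo[%classic.
have oU : open (f @^-1` `]x, +oo[%classic : set (R * R)).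
  by apply: open_comp => //; exact: interval_open.
have cC r : closed (C r : set (R * R)).
  by apply: closed_comp => //; exact: interval_closed.
have [||||n hn] := @nu_vanish (fun n => (f @^-1` `]x, +oo[%classic) `\` C (x + n.+1%:R^-1)) e => //.
- move=> n; apply: measurableD; [exact: measurable_open_plane|exact: measurable_closed_plane].
- move=> m n mn; rewrite subsetEset; apply: setDS => p.
  rewrite /C /= !in_itv /= !andbT; apply: le_trans.
  by rewrite lerD2l lef_pV2 ?posrE// ler_nat.
- apply/seteqP; split => // p h.
  have [+ _] := h 0%N I; rewrite /= in_itv /= andbT => xp.
  have xp0 : 0 < f p - x by rewrite subr_gt0.
  have [N _ /(_ N (leqnn N)) NP] := near_infty_natSinv_lt (PosNum xp0).
  have [_] := h N I; apply; rewrite /C /= in_itv /= andbT.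
  by rewrite -lerBrDl ltW.
exists (f @^-1` `]x, +oo[%classic), (C (x + n.+1%:R^-1)); split => //.
move=> p; rewrite /C /= !in_itv /= !andbT; apply: lt_le_trans.
by rewrite ltrDl.
Qed.

(** Sandwiched sets form a sigma-algebra, and the preimages under the two continuous projections
    generate the product one. *)
Lemma sandwiched_measurable E : measurable E -> sandwiched E.
Proof.
apply: smallest_sub.
- split.
  + exact: sandwiched0.
  + by move=> B SB; rewrite setTD; exact: sandwichedC.
  + exact: sandwiched_bigcup.
move=> _ [] [A mA <-]; rewrite setTI; apply: sandwiched_preimage => //.
- by move=> p; exact: cvg_fst.
- by move=> p; exact: cvg_snd.
Qed.

End regularity.
End regular_sets.

(** * Area of Lipschitz images *)

Section lipschitz_images.
Context {R : realType}.
Notation plane := (measurableTypeR R * measurableTypeR R)%type.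
Notation area := (@lebesgue_measure R \x @lebesgue_measure R)%E.

Definition closed_square (c : plane) (s : R) : set plane :=
  (`[c.1 - s, c.1 + s]%classic : set (measurableTypeR R)) `*`
  (`[c.2 - s, c.2 + s]%classic : set (measurableTypeR R)).

Lemma measurable_closed_square c s : measurable (closed_square c s).
Proof. by apply: measurableX; exact: measurable_itv. Qed.

Lemma closed_squareP c s p :
  `|p.1 - c.1| <= s -> `|p.2 - c.2| <= s -> closed_square c s p.
Proof.
by move=> h1 h2; split; rewrite /= in_itv /= -ler_distl.
Qed.

Lemma area_closed_square c s : 0 <= s ->
  area (closed_square c s) = (4 * s ^+ 2)%:E.
Proof.
move=> s0; rewrite [LHS]product_measure1E; [|exact: measurable_itv..].
have itvE (x : R) : lebesgue_measure (`[x - s, x + s]%classic : set (measurableTypeR R))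
    = (2 * s)%:E :> \bar R.
  rewrite lebesgue_measure_itv /= lte_fin.
  case: ltP => h; first by rewrite -EFinB; congr EFin; lra.
  by congr EFin; lra.
have -> : 4 * s ^+ 2 = (2 * s) * (2 * s) by ring.
by rewrite EFinM; congr (_ * _)%E; exact: itvE.
Qed.

(** Distances are taken in the maximum norm, which fits squares, and only pairs closer than [eta]
    are constrained. *)
Definition lipschitz_at_scale (L eta : R) (E : set plane) (f : plane -> plane) :=
  forall p q s, E p -> E q -> s < eta ->
    `|p.1 - q.1| <= s -> `|p.2 - q.2| <= s ->
    `|(f p).1 - (f q).1| <= L * s /\ `|(f p).2 - (f q).2| <= L * s.

(** Fatou's lemma for sets: the tail intersections increase with [N]. *)
Lemma liminf_measure_le (O : (set plane)^nat) (M : \bar R) :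
  (forall n, measurable (O n)) -> (forall n, (area (O n) <= M)%E) ->
  (area (\bigcup_N \bigcap_(n in [set n | (N <= n)%N]) O n) <= M)%E.
Proof.
move=> mO OM; pose A N := \bigcap_(n in [set n | (N <= n)%N]) O n.
have mA N : measurable (A N).
  by apply: bigcap_measurable => //; exists N => /=.
have h : (area \o A) x @[x --> \oo] --> area (\bigcup_N A N).
  apply: nondecreasing_cvg_mu => //; first exact: bigcup_measurable.
  move=> m n mn; rewrite subsetEset => p h k /= nk; apply: h => /=.
  exact: leq_trans nk.
have <- := cvg_lim (@ereal_hausdorff R) h.
apply: lime_le; first by apply/cvg_ex; eexists; exact: h.
apply: nearW => n /=; apply: le_trans (OM n); apply: le_measure; rewrite ?inE//.
by move=> p; apply => /=.
Qed.

(** At mesh 1/(n+1), keep the squares inside [U] that meet [E]. The image of the part of [E] in such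
    a square lies in a square of half side L/(n+1) about the image of a chosen point, of area 4 L^2
    times that of the grid square. A point of [E] is caught only once the mesh is fine enough for
    it, so the cover is the lower limit of these unions. *)
Lemma lipschitz_image_open (E U : set plane) (f : plane -> plane) (L eta : R) :
  open (U : set (R * R)) -> E `<=` U -> 0 <= L -> 0 < eta ->
  lipschitz_at_scale L eta E f ->
  exists O : set plane, [/\ measurable O, f @` E `<=` O &
    (area O <= (4 * L ^+ 2)%:E * area U)%E].
Proof.
move=> oU EU L0 eta0 lipf.
pose I n := [set k | grid_square n k `<=` U /\ (grid_square n k `&` E) !=set0].
have /choice[c cP] (nk : nat * nat) : exists c, (I nk.1) nk.2 ->
    (grid_square nk.1 nk.2 `&` E) c.
  have [[_ [p h]]|h] := pselect ((I nk.1) nk.2); first by exists p.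
  by exists (0, 0) => /h.
pose B n k := closed_square (f (c (n, k))) (L * n.+1%:R^-1).
pose O n := \bigcup_(k in I n) B n k.
have mO n : measurable (O n).
  by apply: bigcup_measurable => k _; exact: measurable_closed_square.
exists (\bigcup_N \bigcap_(n in [set n | (N <= n)%N]) O n); split.
- apply: bigcup_measurable => N _.
  by apply: bigcap_measurable => //; exists N => /=.
- move=> _ [p Ep <-].
  have [N1 _ HN1] := grid_square_sub_open oU (EU _ Ep).
  have [N2 _ HN2] := near_infty_natSinv_lt (PosNum eta0).
  exists (maxn N1 N2) => // n /=; rewrite geq_max => /andP[n1 n2].
  have [k pk] := grid_square_cover n p.
  have Ik : I n k by split; [exact: HN1 pk|exists p].
  exists k => //; have [kc Ec] := cP (n, k) Ik.
  have [h1 h2] := grid_square_dist pk kc.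
  have [h3 h4] := lipf _ _ _ Ep Ec (HN2 _ n2) h1 h2.
  by apply: closed_squareP.
apply: liminf_measure_le => // n.
apply: (area_le_squares (n := n) (I := I n) (U := U) (measurable_open_plane oU)) => //.
- by move=> k [sub [p [kp _]]]; split => //; exists p.
- move=> k _; split; first exact: measurable_closed_square.
  by rewrite area_closed_square ?mulr_ge0// exprMn mulrA.
- by rewrite mulr_ge0// exprn_ge0.
Qed.

(** Regularity gives open sets around [E] with excess area below 1/(n+1), and intersecting the
    resulting covers removes the excess. The set [O] stands in for the image, which need not be
    Borel. *)
Lemma lipschitz_image (E : set plane) (f : plane -> plane) (K L eta : R) :
  measurable E -> (forall p, E p -> `|p.1| < K /\ `|p.2| < K) ->
  0 <= L -> 0 < eta -> lipschitz_at_scale L eta E f ->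
  exists O : set plane, [/\ measurable O, f @` E `<=` O &
    (area O <= (4 * L ^+ 2)%:E * area E)%E].
Proof.
move=> mE EK L0 eta0 lipf.
pose D : set plane := (`]-K, K[%classic : set (measurableTypeR R)) `*`
   (`]-K, K[%classic : set (measurableTypeR R)).
have mD : measurable D by apply: measurableX; exact: measurable_itv.
have oD : open (D : set (R * R)).
  rewrite (_ : D = (fst @^-1` `]-K, K[%classic) `&` (snd @^-1` `]-K, K[%classic)) //.
  apply: openI; apply: open_comp; try exact: interval_open.
    by move=> p _; exact: cvg_fst.
  by move=> p _; exact: cvg_snd.
have ED : E `<=` D.
  by move=> p /EK[]; rewrite !ltr_norml => h1 h2; split; rewrite /= in_itv.
have areaD : (area D < +oo)%E.
  apply: (@le_lt_trans _ _ (area (closed_square (0, 0) `|K|))); last first.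
    by rewrite area_closed_square// ltry.
  apply: le_measure; rewrite ?inE//; first exact: measurable_closed_square.
  have KK := ler_norm K.
  move=> p [] /=; rewrite !in_itv /= => /andP[? ?] /andP[? ?].
  by split; rewrite /= in_itv /=; apply/andP; split; lra.
(* The plane has infinite area, so regularity is applied to the restriction of [area] to a bounded
   box containing [E]. *)
pose nu := mrestr area mD.
have nufin : (nu setT < +oo)%E by rewrite /nu /mrestr setTI.
have areaE : (area E < +oo)%E.
  by apply: le_lt_trans areaD; apply: le_measure; rewrite ?inE.
have HO (n : nat) : exists O : set plane, [/\ measurable O, f @` E `<=` O &
    (area O <= (4 * L ^+ 2)%:E * (area E + (n.+1%:R^-1)%:E))%E].
  have [|U [F [oU cF FE EU UF]]] := @sandwiched_measurable R nu nufin E mE n.+1%:R^-1.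
    by [].
  have [|||||O [mO fO OU]] := @lipschitz_image_open E (U `&` D) f L eta => //.
  - exact: openI.
  - by move=> p Ep; split; [exact: EU|exact: ED].
  exists O; split => //; apply: (le_trans OU); apply: lee_wpmul2l.
    by rewrite lee_fin mulr_ge0// exprn_ge0.
  have mU := measurable_open_plane oU; have mF := measurable_closed_plane cF.
  have -> : U `&` D = (F `&` D) `|` ((U `\` F) `&` D).
    apply/seteqP; split => [p [Up Dp]|p [[/FE/EU Up Dp]|[[Up _] Dp]]]; [|by split..].
    by have [Fp|nFp] := pselect (F p); [left|right].
  apply: (@le_trans _ _ (area (F `&` D) + area ((U `\` F) `&` D))%E).
    apply: measureU2; apply: measurableI => //; exact: measurableD.
  apply: leeD; last exact: ltW.
  apply: le_measure; rewrite ?inE//; first exact: measurableI.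
  by move=> p [/FE].
have [V VP] := choice HO.
have mO : measurable (\bigcap_n V n).
  by apply: bigcap_measurable => // n _; have [] := VP n.
exists (\bigcap_n V n); split => //.
  by move=> p fp n _; have [_ + _] := VP n; exact.
have fE : area E \is a fin_num by rewrite ge0_fin_numE.
apply/lee_addgt0Pr => e e0.
have C0 : 0 <= 4 * L ^+ 2 by rewrite mulr_ge0// exprn_ge0.
have eC : 0 < e / (4 * L ^+ 2 + 1) by rewrite divr_gt0// ltr_wpDl.
have [N _ /(_ N (leqnn N)) NP] := near_infty_natSinv_lt (PosNum eC).
have [_ _ H] := VP N.
apply: (@le_trans _ _ (area (V N))).
  by apply: le_measure; rewrite ?inE//; [have [] := VP N|exact: bigcap_inf].
apply: (le_trans H).
case: (area E) fE => // a _; rewrite lee_fin mulrDr lerD2l.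
move: NP => /= /ltW NP.
apply: (@le_trans _ _ ((4 * L ^+ 2) * (e / (4 * L ^+ 2 + 1)))); first exact: ler_wpM2l.
rewrite mulrCA; apply: ler_piMr; first exact: ltW.
by rewrite ler_pdivrMr ?ltr_wpDl// mul1r lerDl.
Qed.

End lipschitz_images.

(** * The complex modulus *)

Section modulus.
Context {R : realType}.
Implicit Types (z u v : cplx R) (p : R * R).

Definition cabs z : R := complex.Re `|z|.

Definition cplx_of (x : R) : cplx R := x%:C.

Definition to_plane z : R * R := (complex.Re z, complex.Im z).

Lemma cabs_def z : cabs z = Num.sqrt (complex.Re z ^+ 2 + complex.Im z ^+ 2).
Proof. by rewrite /cabs normc_def. Qed.

Lemma normcE_cabs z : `|z| = cplx_of (cabs z).
Proof. by rewrite /cplx_of cabs_def normc_def. Qed.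

Lemma cplx_of_inj : injective cplx_of. Proof. by move=> x y []. Qed.

Lemma le_cplx_of x y : (cplx_of x <= cplx_of y) = (x <= y).
Proof. exact: lecR. Qed.

Lemma lt_cplx_of x y : (cplx_of x < cplx_of y) = (x < y).
Proof. exact: ltcR. Qed.

Lemma cplx_ofD x y : cplx_of (x + y) = cplx_of x + cplx_of y.
Proof. exact: (rmorphD (real_complex R)). Qed.

Lemma cplx_ofM x y : cplx_of (x * y) = cplx_of x * cplx_of y.
Proof. exact: (rmorphM (real_complex R)). Qed.

Lemma cplx_of0 : cplx_of 0 = 0. Proof. by []. Qed.
Lemma cplx_of1 : cplx_of 1 = 1. Proof. by []. Qed.

Lemma cplx_ofV x : cplx_of x^-1 = (cplx_of x)^-1.
Proof. exact: (fmorphV (real_complex R)). Qed.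

Lemma cabs_ge0 z : 0 <= cabs z. Proof. by rewrite cabs_def sqrtr_ge0. Qed.

Lemma sqr_cabs z : cabs z ^+ 2 = complex.Re z ^+ 2 + complex.Im z ^+ 2.
Proof. by rewrite cabs_def sqr_sqrtr// addr_ge0// sqr_ge0. Qed.

Lemma cabsM u v : cabs (u * v) = cabs u * cabs v.
Proof.
by apply: cplx_of_inj; rewrite cplx_ofM -!normcE_cabs normrM.
Qed.

Lemma cabsV u : cabs u^-1 = (cabs u)^-1.
Proof.
by apply: cplx_of_inj; rewrite cplx_ofV -!normcE_cabs normfV.
Qed.

Lemma cabsX u n : cabs (u ^+ n) = cabs u ^+ n.
Proof.
elim: n => [|n IH]; first by apply: cplx_of_inj; rewrite -!normcE_cabs normr1.
by rewrite !exprS cabsM IH.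
Qed.

Lemma cabs_triangle u v : cabs (u + v) <= cabs u + cabs v.
Proof.
by rewrite -le_cplx_of cplx_ofD -!normcE_cabs ler_normD.
Qed.

Lemma cabsN u : cabs (- u) = cabs u.
Proof. by rewrite /cabs normrN. Qed.

Lemma cabs_distC u v : cabs (u - v) = cabs (v - u).
Proof. by rewrite /cabs distrC. Qed.

Lemma cabs0 : cabs 0 = 0. Proof. by rewrite /cabs normr0. Qed.
Lemma cabs1 : cabs 1 = 1. Proof. by rewrite /cabs normr1. Qed.

Lemma cabs_of x : cabs (cplx_of x) = `|x|.
Proof. by rewrite cabs_def /= expr0n addr0 sqrtr_sqr. Qed.

Lemma cabs_eq0 z : (cabs z == 0) = (z == 0).
Proof.
by rewrite -(inj_eq cplx_of_inj) -normcE_cabs cplx_of0 normr_eq0.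
Qed.

Lemma cabs_gt0 z : (0 < cabs z) = (z != 0).
Proof. by rewrite lt_def cabs_eq0 cabs_ge0 andbT. Qed.

Lemma cabs_distD u v z : cabs (u - z) <= cabs (u - v) + cabs (v - z).
Proof.
by rewrite -[u - z](subrKA v); exact: cabs_triangle.
Qed.

Lemma cabs_sub u v : cabs u - cabs v <= cabs (u - v).
Proof. by rewrite lerBlDr -[X in cabs X <= _](subrK v) cabs_triangle. Qed.

Lemma ler_cabs_sub u v : cabs (u - v) <= cabs u + cabs v.
Proof. by rewrite -(cabsN v) cabs_triangle. Qed.

Lemma Re_le_cabs z : `|complex.Re z| <= cabs z.
Proof.
rewrite -(@ler_pXn2r _ 2)// ?nnegrE ?cabs_ge0//.
by rewrite real_normK ?num_real// sqr_cabs lerDl sqr_ge0.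
Qed.

Lemma Im_le_cabs z : `|complex.Im z| <= cabs z.
Proof.
rewrite -(@ler_pXn2r _ 2)// ?nnegrE ?cabs_ge0//.
by rewrite real_normK ?num_real// sqr_cabs lerDr sqr_ge0.
Qed.

Lemma cabs_le_ReIm z : cabs z <= `|complex.Re z| + `|complex.Im z|.
Proof.
rewrite -(@ler_pXn2r _ 2)// ?nnegrE ?cabs_ge0 ?addr_ge0//.
rewrite sqr_cabs sqrrD !real_normK ?num_real//.
by rewrite addrAC lerDl mulrn_wge0// mulr_ge0.
Qed.

Lemma plane_to_cplxK p : to_plane (plane_to_cplx p) = p.
Proof. by case: p. Qed.

Lemma to_planeK z : plane_to_cplx (to_plane z) = z.
Proof. by case: z. Qed.

Lemma plane_to_cplxB p q : plane_to_cplx (p - q) = plane_to_cplx p - plane_to_cplx q.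
Proof. by []. Qed.

Lemma sqr_cabs_plane p : cabs (plane_to_cplx p) ^+ 2 = p.1 ^+ 2 + p.2 ^+ 2.
Proof. by rewrite sqr_cabs. Qed.

Lemma unit_diskE z : unit_disk z = (cabs z < 1).
Proof. by rewrite /unit_disk /= normcE_cabs -cplx_of1 lt_cplx_of. Qed.

Lemma unit_disk_plane p : unit_disk (plane_to_cplx p) = (p.1 ^+ 2 + p.2 ^+ 2 < 1).
Proof.
by rewrite unit_diskE -sqr_cabs_plane expr_lt1// cabs_ge0.
Qed.

Lemma cplx_gt0P (e : cplx R) : 0 < e -> exists2 d : R, 0 < d & e = cplx_of d.
Proof.
move=> e0; exists (complex.Re e).
  by move: e0; rewrite ltcE /= => /andP[].
by case: e e0 => a b; rewrite ltcE /= => /andP[/eqP -> _].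
Qed.

Lemma cplx_nbhsP z (A : set (cplx R)) :
  nbhs z A <-> exists2 e : R, 0 < e & forall u, cabs (u - z) < e -> A u.
Proof.
split=> [/nbhs_ballP[e /= /cplx_gt0P[d d0 ->] H]|[e e0 H]].
  exists d => // u hu; apply: H; rewrite -ball_normE /ball_ /=.
  by rewrite normcE_cabs lt_cplx_of cabs_distC.
apply/nbhs_ballP; exists (cplx_of e) => /=; first by rewrite -cplx_of0 lt_cplx_of.
move=> u; rewrite -ball_normE /ball_ /= normcE_cabs lt_cplx_of cabs_distC.
exact: H.
Qed.

Lemma continuous_plane_to_cplx : continuous (@plane_to_cplx R).
Proof.
move=> p A /cplx_nbhsP[e e0 H]; apply/nbhs_ballP.
exists (e / 2) => /=; first by rewrite divr_gt0.
move=> q [h1 h2]; apply: H; apply: (le_lt_trans (cabs_le_ReIm _)).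
rewrite -plane_to_cplxB /= [e]splitr.
by rewrite -!ball_normE /= in h1 h2; apply: ltrD; rewrite distrC.
Qed.

End modulus.

(** * Superharmonic weights in the plane *)

Section weight.
Context {R : realType}.
Notation plane := (measurableTypeR R * measurableTypeR R)%type.
Variable w : cplx R -> \bar R.
Hypothesis w_superharmonic : superharmonic_on (@unit_disk R) w.
Hypothesis w_positive : forall z, unit_disk z -> (0 < w z)%E.

(** The value 0 outside keeps the superlevel sets at levels a >= 0 open in the plane, which is how
    lower semicontinuity yields measurability. *)
Definition disk_weight (p : plane) : \bar R :=
  if p.1 ^+ 2 + p.2 ^+ 2 < 1 then w (plane_to_cplx p) else 0%E.

Lemma disk_weight_ge0 p : (0 <= disk_weight p)%E.
Proof.
rewrite /disk_weight; case: ifPn => // h; apply/ltW/w_positive.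
by rewrite unit_disk_plane.
Qed.

Lemma open_disk_weight_gt (a : R) : 0 <= a ->
  open ([set p | (a%:E < disk_weight p)%E] : set (R * R)).
Proof.
move=> a0; rewrite openE => p /=; rewrite /disk_weight.
case: ifPn => h; last by rewrite lte_fin ltNge a0.
have Dp : unit_disk (plane_to_cplx p) by rewrite unit_disk_plane.
move=> aw; have [_ lsc _ _] := w_superharmonic.
have [V nV VP] := lsc _ _ aw.
have : nbhs (plane_to_cplx p) [set u | unit_disk u /\ (a%:E < w u)%E].
  move: nV; rewrite /nbhs /= -nbhs_subspace_in// => /cplx_nbhsP[e e0 eV].
  apply/cplx_nbhsP; exists (Order.min e (1 - cabs (plane_to_cplx p))).
    by rewrite lt_min e0 subr_gt0 -unit_diskE.
  move=> u; rewrite lt_min => /andP[ue u1].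
  have Du : unit_disk u.
    have := cabs_triangle (u - plane_to_cplx p) (plane_to_cplx p).
    by rewrite subrK unit_diskE; lra.
  by split => //; apply: VP; exact: eV.
move=> nw; have := @continuous_plane_to_cplx R p _ nw.
move=> nwp; change (nbhs p [set p0 : R * R | (a%:E < (if (p0.1 ^+ 2 + p0.2 ^+ 2 < 1)%R
  then w (plane_to_cplx p0) else 0))%E]).
refine (@filterS _ _ (nbhs_filter p) _ _ _ nwp) => q /= [Dq aq].
by move: Dq; rewrite unit_disk_plane => ->.
Qed.

Lemma measurable_disk_weight : measurable_fun [set: plane] disk_weight.
Proof.
apply: (measurability _ (ErealGenOInfty.measurableE R)).
move=> _ [_ [a ->]] <-; rewrite setTI preimage_itvoy.
have [a0|a0] := leP 0 a.
  by apply: measurable_open_plane; exact: open_disk_weight_gt.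
rewrite (_ : [set _ | _] = setT)//; apply/seteqP; split => // p _ /=.
by apply: lt_le_trans (disk_weight_ge0 p); rewrite lte_fin.
Qed.

Lemma disk_weight_circle (a : plane) (r : R) : 0 < r ->
  cabs (plane_to_cplx a) + r < 1 ->
  (\int[lebesgue_measure]_(t in `[0%R, (2 * pi)%R])
     disk_weight (a.1 + r * cos t, a.2 + r * sin t)%R
   <= (2 * pi)%:E * disk_weight a)%E.
Proof.
move=> r0 ar.
have a1 : a.1 ^+ 2 + a.2 ^+ 2 < 1.
  by rewrite -unit_disk_plane unit_diskE; lra.
have [_ _ mean _] := w_superharmonic.
have := mean (plane_to_cplx a) r r0.
have sub : [set u : cplx R | `|u - plane_to_cplx a| <= r%:C] `<=` @unit_disk R.
  move=> u /=; rewrite -[r%:C]/(cplx_of r) normcE_cabs le_cplx_of unit_diskE => ur.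
  have := cabs_triangle (u - plane_to_cplx a) (plane_to_cplx a).
  by rewrite subrK; lra.
move=> /(_ sub); rewrite /circle_mean {2}/disk_weight a1.
have pi0 : 0 < 2 * pi :> R by rewrite mulr_gt0// pi_gt0.
rewrite lee_pdivrMl//; congr (_ <= _)%E; apply: eq_integral => t _.
have : unit_disk (plane_to_cplx (a.1 + r * cos t, a.2 + r * sin t)).
  apply: sub => /=.
  rewrite -[r%:C]/(cplx_of r) normcE_cabs le_cplx_of -plane_to_cplxB.
  rewrite -(@ler_pXn2r _ 2)// ?nnegrE ?cabs_ge0 ?(ltW r0)//.
  rewrite sqr_cabs_plane /= ![_ + _ - _]addrAC !subrr !add0r.
  by rewrite !exprMn -mulrDr cos2Dsin2 mulr1.
by rewrite unit_disk_plane /disk_weight /= => ->.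
Qed.

End weight.

(** * Polar coordinates as an inequality *)

Section polar.
Context {R : realType}.
Notation plane := (measurableTypeR R * measurableTypeR R)%type.
Notation area := (@lebesgue_measure R \x @lebesgue_measure R)%E.

Lemma lipschitz1_MVT (f df : R -> R) : (forall x : R, is_derive x 1 f (df x)) ->
  (forall x, `|df x| <= 1) -> forall x y, `|f x - f y| <= `|x - y|.
Proof.
move=> fdf df1 x y; wlog xy : x y / y <= x.
  move=> H; have [/H//|/ltW /H] := leP y x.
  by rewrite distrC (distrC y).
have [|c _ ->] := @MVT_segment R f df y x xy (fun z _ => fdf z).
  apply: derivable_within_continuous => z _; exact: ex_derive.
by rewrite normrM ler_piMl.
Qed.

Lemma cos_lipschitz (x y : R) : `|cos x - cos y| <= `|x - y|.
Proof.
apply: (@lipschitz1_MVT cos (fun t => - sin t)) => t.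
by rewrite normrN ler_norml sin_geN1 sin_le1.
Qed.

Lemma sin_lipschitz (x y : R) : `|sin x - sin y| <= `|x - y|.
Proof.
apply: (@lipschitz1_MVT sin cos) => t.
by rewrite ler_norml cos_geN1 cos_le1.
Qed.

Lemma angle_exists (x y : R) : x ^+ 2 + y ^+ 2 = 1 ->
  exists t, [/\ 0 <= t <= 2 * pi, cos t = x & sin t = y].
Proof.
move=> xy1.
have x1 : -1 <= x <= 1.
  by rewrite -ler_norml -(@ler_pXn2r _ 2)// ?nnegrE// expr1n real_normK ?num_real//;
    rewrite -xy1 lerDl sqr_ge0.
have pi0 := @pi_gt0 R.
have yE : 1 - x ^+ 2 = y ^+ 2 by rewrite -xy1 addrAC subrr add0r.
have cosx : cos (acos x) = x by apply: acosK; rewrite in_itv.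
have sinx : sin (acos x) = `|y| by rewrite sin_acos// yE sqrtr_sqr.
have a0 := acos_ge0 x1; have api := acos_lepi x1.
have [y0|y0] := leP 0 y.
  exists (acos x); split => //; last by rewrite sinx ger0_norm.
  by rewrite a0/=; lra.
exists (2 * pi - acos x); split; first by apply/andP; split; lra.
  by rewrite cosB mulr_natl cos2pi sin2pi mul1r mul0r addr0.
by rewrite sinB mulr_natl cos2pi sin2pi mul1r mul0r sub0r sinx ltr0_norm// opprK.
Qed.

Definition polar_map (a : plane) (s : R) (q : plane) : plane :=
  (a.1 + s * q.1 * cos q.2, a.2 + s * q.1 * sin q.2).

Definition polar_domain : set plane :=
  (`[0, 1[%classic : set (measurableTypeR R)) `*`
  (`[0, 2 * pi]%classic : set (measurableTypeR R)).

Definition disk (a : plane) (s : R) : set plane :=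
  [set p | (p.1 - a.1) ^+ 2 + (p.2 - a.2) ^+ 2 < s ^+ 2].

Lemma measurable_polar_domain : measurable polar_domain.
Proof. by apply: measurableX; exact: measurable_itv. Qed.

Lemma measurable_polar_map a s : measurable_fun [set: plane] (polar_map a s).
Proof.
have mc : measurable_fun [set: measurableTypeR R] (@cos R).
  by apply: continuous_measurable_fun; exact: continuous_cos.
have ms : measurable_fun [set: measurableTypeR R] (@sin R).
  by apply: continuous_measurable_fun; exact: continuous_sin.
have m1 := @measurable_fst _ _ (measurableTypeR R) (measurableTypeR R).
have m2 := @measurable_snd _ _ (measurableTypeR R) (measurableTypeR R).
have msm : measurable_fun [set: plane] (fun q : plane => s * q.1 : measurableTypeR R).
  exact: measurable_funM (measurable_cst _) m1.
apply: measurable_fun_pair; apply: measurable_funD (measurable_cst _) _.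
  exact: measurable_funM msm (measurableT_comp mc m2).
exact: measurable_funM msm (measurableT_comp ms m2).
Qed.

Lemma measurable_sqr_dist (a : plane) : measurable_fun [set: plane]
  (fun p => (p.1 - a.1) ^+ 2 + (p.2 - a.2) ^+ 2 : measurableTypeR R).
Proof.
have m1 := @measurable_fst _ _ (measurableTypeR R) (measurableTypeR R).
have m2 := @measurable_snd _ _ (measurableTypeR R) (measurableTypeR R).
apply: measurable_funD; apply: (@measurable_funX _ plane).
  exact: measurable_funB m1 (measurable_cst _).
exact: measurable_funB m2 (measurable_cst _).
Qed.

Lemma measurable_disk a s : measurable (disk a s).
Proof.
rewrite (_ : disk a s = [set: plane] `&`
   (fun p : plane => (p.1 - a.1) ^+ 2 + (p.2 - a.2) ^+ 2) @^-1` `]-oo, s ^+ 2[%classic).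
  by apply: measurable_sqr_dist => //; exact: measurable_itv.
by apply/seteqP; split => p; rewrite /disk /= in_itv /=; [split|case].
Qed.

(** One [s] comes from moving the radius and one from moving the angle: the radial coordinate is
    below 1, and cos and sin are 1-Lipschitz and bounded by 1. *)
Lemma polar_map_lipschitz a s (E : set plane) : 0 <= s -> E `<=` polar_domain ->
  lipschitz_at_scale (2 * s) 1 E (polar_map a s).
Proof.
move=> s0 ED p q h /ED[/= + _] /ED[/= + _] _ hp hq.
rewrite !in_itv /= => /andP[p0 p1] /andP[q0 q1].
have key (f : R -> R) : (forall x y, `|f x - f y| <= `|x - y|) ->
    (forall x, `|f x| <= 1) ->
    `|s * p.1 * f p.2 - s * q.1 * f q.2| <= 2 * s * h.
  move=> flip f1.
  have -> : s * p.1 * f p.2 - s * q.1 * f q.2 =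
     s * ((p.1 - q.1) * f p.2 + q.1 * (f p.2 - f q.2)) by ring.
  rewrite normrM ger0_norm// (_ : 2 * s * h = s * (h + h)); last by ring.
  apply: ler_wpM2l => //; apply: (le_trans (ler_normD _ _)); apply: lerD; rewrite normrM.
    by apply: le_trans hp; exact: ler_piMr.
  by rewrite (ger0_norm q0); apply: le_trans (le_trans (flip _ _) hq); rewrite ler_piMl// ltW.
split; rewrite /polar_map /= opprD addrACA subrr add0r; apply: key.
- exact: cos_lipschitz.
- by move=> x; rewrite ler_norml cos_geN1 cos_le1.
- exact: sin_lipschitz.
- by move=> x; rewrite ler_norml sin_geN1 sin_le1.
Qed.

Lemma disk_polar a s p : 0 < s -> disk a s p ->
  exists2 q, polar_domain q & polar_map a s q = p.
Proof.
rewrite /disk /= => s0; set x := p.1 - a.1; set y := p.2 - a.2 => xys.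
pose m := Num.sqrt (x ^+ 2 + y ^+ 2).
have xy0 : 0 <= x ^+ 2 + y ^+ 2 by rewrite addr_ge0// sqr_ge0.
have m0 : 0 <= m by exact: sqrtr_ge0.
have m2 : m ^+ 2 = x ^+ 2 + y ^+ 2 by rewrite sqr_sqrtr.
have ms : m < s by rewrite -(@ltr_pXn2r _ 2)// ?nnegrE ?(ltW s0)// m2.
have [t [t2 ct st]] : exists t, [/\ 0 <= t <= 2 * pi, m * cos t = x & m * sin t = y].
  have [mz|mz] := eqVneq m 0.
    exists 0; move: m2; rewrite mz expr0n /= => /esym/eqP.
    rewrite paddr_eq0 ?sqr_ge0// !sqrf_eq0 => /andP[/eqP -> /eqP ->].
    by rewrite !mul0r lexx mulr_ge0// pi_ge0.
  have [|t [t1 ct st]] := @angle_exists (x / m) (y / m).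
    by rewrite !exprMn -mulrDl -m2 -exprMn divff// expr1n.
  by exists t; rewrite ct st !mulrA ![m * _]mulrC !mulfK.
exists (m / s, t).
  split; rewrite /= in_itv //=.
  by rewrite divr_ge0 ?(ltW s0)//= ltr_pdivrMr// mul1r.
rewrite /polar_map /= [s * _]mulrC divfK ?gt_eqF// ct st /x /y !(addrC _ (_ - _)) !subrK.
by case: (p).
Qed.

(** A one-sided substitute for the change of variables: the disk is covered by the image of a
    rectangle under a map of Lipschitz constant 2 s, and 16 s^2 = 4 (2 s)^2. The Jacobian is lost,
    at the price of a constant. *)
Lemma area_le_polar a s E : 0 < s -> measurable E -> E `<=` disk a s ->
  (area E <= (16 * s ^+ 2)%:E * area (polar_map a s @^-1` E `&` polar_domain))%E.
Proof.
move=> s0 mE ED; set S := _ `&` _.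
have mS : measurable S.
  apply: measurableI; last exact: measurable_polar_domain.
  by rewrite -[X in measurable X]setTI; exact: measurable_polar_map.
have SK p : S p -> `|p.1| < 2 * pi + 1 /\ `|p.2| < 2 * pi + 1.
  have pi0 := @pi_gt0 R.
  by move=> [_ []] /=; rewrite !in_itv /= => /andP[? ?] /andP[? ?];
    rewrite !ger0_norm//; split; lra.
have [|||O [mO SO OS]] := @lipschitz_image R S (polar_map a s) _ (2 * s) 1 mS SK.
- by rewrite mulr_ge0// ltW.
- by [].
- by apply: polar_map_lipschitz => [|p []//]; exact: ltW.
have -> : 16 * s ^+ 2 = 4 * (2 * s) ^+ 2 by ring.
apply: le_trans OS; apply: le_measure; rewrite ?inE// => p Ep.
have [q Dq qp] := disk_polar s0 (ED _ Ep).
by apply: SO; exists q => //; split => //=; rewrite qp.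
Qed.

Lemma integral_mrestr (mu : {measure set plane -> \bar R}) D (mD : measurable D)
    (f : plane -> \bar R) : measurable_fun [set: plane] f -> (forall p, (0 <= f p)%E) ->
  (\int[mrestr mu mD]_p f p = \int[mu]_(p in D) f p)%E.
Proof.
move=> mf f0.
have nD : mrestr mu mD (~` D) = 0%E by rewrite /mrestr setICl measure0.
rewrite (ge0_negligible_integral (measurableC mD) measurableT mf (fun p _ => f0 p) nD).
rewrite setTD setCK; apply: eq_measure_integral => A mA AD.
by rewrite /mrestr; congr (mu _); apply/seteqP; split => [p []//|p Ap]; split => //; exact: AD.
Qed.

(** The bound for sets says that area on the disk is dominated by a multiple of the pushforward of
    area on the polar rectangle, and domination of measures passes to integrals of nonnegative
    functions. *)
Lemma integral_disk_polar a s (f : plane -> \bar R) : 0 < s ->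
  measurable_fun [set: plane] f -> (forall p, (0 <= f p)%E) ->
  (\int[area]_(p in disk a s) f p <= (16 * s ^+ 2)%:E *
     \int[area]_(q in polar_domain) f (polar_map a s q))%E.
Proof.
move=> s0 mf f0.
have mP := measurable_polar_domain; have mD := measurable_disk a s.
have mM := measurable_polar_map a s.
have mpre A : measurable A -> measurable (polar_map a s @^-1` A).
  by move=> mA; rewrite -[X in measurable X]setTI; exact: measurable_polar_map.
have k0 : 0 <= 16 * s ^+ 2 by rewrite mulr_ge0// sqr_ge0.
pose nu : {measure set plane -> \bar R} :=
  measure_function_pushforward__canonical__measure_function_Measure (mrestr area mP) mM.
pose m2 : {measure set plane -> \bar R} := mscale (NngNum k0) nu.
rewrite -(integral_mrestr area mD)//.
apply: (@le_trans _ _ (\int[m2]_p f p)%E).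
  apply: ge0_le_measure_integral => // S mS; rewrite /m2 /mscale /mrestr /pushforward /=.
  apply: (@le_trans _ _ ((16 * s ^+ 2)%:E * area (polar_map a s @^-1` (S `&` disk a s) `&` polar_domain))%E).
    by apply: area_le_polar => //; [exact: measurableI].
  apply: lee_wpmul2l => //; apply: le_measure; rewrite ?inE.
  - by apply: measurableI => //; apply: mpre; exact: measurableI.
  - by apply: measurableI => //; exact: mpre.
  - by move=> p [[]].
have nuE : (\int[nu]_p f p = \int[area]_(q in polar_domain) f (polar_map a s q))%E.
  have mfM := measurableT_comp mf mM.
  rewrite -(integral_mrestr area mP mfM (fun q => f0 _)).
  exact: (ge0_integral_pushforward mM _ measurableT mf (fun p _ => f0 p)).
rewrite -nuE.
by rewrite (ge0_integral_mscale nu measurableT (NngNum k0) mf (fun p _ => f0 p)).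
Qed.

End polar.

(** * Disk integrals and translation invariance *)

Section sweeping.
Context {R : realType}.
Notation line := (measurableTypeR R).
Notation plane := (measurableTypeR R * measurableTypeR R)%type.
Notation area := (@lebesgue_measure R \x @lebesgue_measure R)%E.
Notation leb := (@lebesgue_measure R).

Lemma integral_prod_domain (f : plane -> \bar R) (A B : set line) :
  measurable A -> measurable B ->
  measurable_fun [set: plane] f -> (forall p, (0 <= f p)%E) ->
  (\int[area]_(p in A `*` B) f p = \int[leb]_(x in A) \int[leb]_(y in B) f (x, y))%E.
Proof.
move=> mA mB mf f0; have mAB := measurableX mA mB.
rewrite integral_mkcond (fubini_tonelli1 (m1 := leb) (m2 := leb)); first last.
- by move=> p; apply: erestrict_ge0.
- apply/(measurable_restrictT _ mAB); exact: measurable_funS mf.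
rewrite [RHS]integral_mkcond; apply: eq_integral => x _.
rewrite /fubini_F patchE; case: ifPn => xA.
  rewrite [RHS]integral_mkcond; apply: eq_integral => y _.
  rewrite !patchE; congr (if _ then _ else _).
  apply/idP/idP => [/set_mem[_ /mem_set//]|/set_mem yB].
  by apply/mem_set; split => //; exact: set_mem.
apply: integral0_eq => y _; rewrite patchE ifF//; apply/negbTE.
by apply/negP => /set_mem[/= /mem_set h _]; rewrite h in xA.
Qed.

(** The constant is 16 s^2 from polar coordinates times 2 pi from each circle, the radial variable
    running over an interval of length 1. *)
Lemma disk_integral_le (f : plane -> \bar R) (a : plane) (s : R) : 0 < s ->
  measurable_fun [set: plane] f -> (forall p, (0 <= f p)%E) ->
  (forall x, 0 <= x < 1 ->
    (\int[leb]_(t in `[0%R, (2 * pi)%R]) f (polar_map a s (x, t))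
      <= (2 * pi)%:E * f a)%E) ->
  (\int[area]_(p in disk a s) f p <= (32 * pi * s ^+ 2)%:E * f a)%E.
Proof.
move=> s0 mf f0 mean; apply: (le_trans (integral_disk_polar a s0 mf f0)).
have mM := measurable_polar_map a s.
have mfM := measurableT_comp mf mM.
rewrite integral_prod_domain//; [|exact: measurable_itv..].
have -> : 32 * pi * s ^+ 2 = (16 * s ^+ 2) * (2 * pi) :> R by ring.
rewrite (EFinM (16 * s ^+ 2)) -muleA; apply: lee_wpmul2l; first by rewrite lee_fin mulr_ge0// sqr_ge0.
set c := ((2 * pi)%:E * f a)%E.
have c0 : (0 <= c)%E by rewrite mule_ge0// lee_fin mulr_ge0// pi_ge0.
apply: (@le_trans _ _ (\int[leb]_(x in `[0%R, 1%R[) c)%E).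
  apply: ge0_le_integral => //.
  - by move=> x _; exact: integral_ge0.
  - rewrite (_ : (fun x => _) = fubini_F leb
      ((fun p => f (polar_map a s p)) \_ (setT `*` `[0%R, 2 * pi]%classic))).
      apply: measurable_funTS; apply: measurable_fun_fubini_tonelli_F.
        have mTI : measurable ([set: line] `*` (`[0%R, 2 * pi]%classic : set line)).
          by apply: measurableX => //; exact: measurable_itv.
        by apply/(measurable_restrictT _ mTI); exact: measurable_funTS mfM.
      by move=> p; apply: erestrict_ge0.
    apply/funext => x; rewrite /fubini_F [LHS]integral_mkcond; apply: eq_integral => t _.
    rewrite !patchE; congr (if _ then _ else _).
    by apply/idP/idP => [/set_mem yB|/set_mem[_ /mem_set//]]; apply/mem_set.
have mI01 : measurable (`[0%R, 1%R[%classic : set line) by exact: measurable_itv.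
rewrite (integral_cst leb mI01) [X in (c * X)%E]lebesgue_measure_itv /= lte_fin ltr01.
by rewrite sube0 mule1.
Qed.

Definition shift_plane (h p : plane) : plane := (p.1 + h.1, p.2 + h.2).

Lemma measurable_shift_plane h : measurable_fun [set: plane] (shift_plane h).
Proof.
have m1 := @measurable_fst _ _ line line.
have m2 := @measurable_snd _ _ line line.
apply: measurable_fun_pair.
  exact: measurable_funD m1 (measurable_cst _).
exact: measurable_funD m2 (measurable_cst _).
Qed.

Lemma measurable_shift_line (c : R) : measurable_fun [set: line] (fun x : line => x + c : line).
Proof. by apply: measurable_funD => //; exact: measurable_cst. Qed.

Lemma lebesgue_measure_shift (c : R) (A : set line) : measurable A ->
  leb A = leb ((fun x : line => x + c : line) @^-1` A).
Proof.
move=> mA; pose nu : {measure set line -> \bar R} :=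
  measure_function_pushforward__canonical__measure_function_Measure leb (measurable_shift_line c).
apply: (lebesgue_measure_unique (mu := nu)) mA => _ [[x y]] _ <-.
rewrite /nu /= /pushforward /=.
rewrite (_ : _ @^-1` _ = `]x - c, y - c]%classic); last first.
  by apply/seteqP; split => z /=; rewrite !in_itv /= ltrBlDr lerBrDr.
by rewrite !lebesgue_measure_itv /= !lte_fin ltrD2r -!EFinB; case: ifP => // _; congr EFin; ring.
Qed.

Lemma integral_shift_plane (f : plane -> \bar R) h :
  measurable_fun [set: plane] f -> (forall p, (0 <= f p)%E) ->
  (\int[area]_p f (shift_plane h p) = \int[area]_p f p)%E.
Proof.
move=> mf f0; have mS := measurable_shift_plane h.
pose nu : {measure set plane -> \bar R} :=
  measure_function_pushforward__canonical__measure_function_Measure area mS.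
transitivity (\int[nu]_p f p)%E.
  by rewrite (ge0_integral_pushforward mS area measurableT mf (fun p _ => f0 p)).
apply: eq_measure_integral => A mA _; apply/esym.
apply: (product_measure_unique (m' := nu)) mA => B C mB mC.
rewrite /nu /= /pushforward.
rewrite (_ : _ @^-1` _ = ((fun x : line => x + h.1 : line) @^-1` B) `*`
                         ((fun x : line => x + h.2 : line) @^-1` C))//.
rewrite [LHS]product_measure1E.
- by congr (_ * _)%E; apply/esym/lebesgue_measure_shift.
- by rewrite -[X in measurable X]setTI; exact: measurable_shift_line.
- by rewrite -[X in measurable X]setTI; exact: measurable_shift_line.
Qed.

End sweeping.

(** * Circle averages *)

Section balayage.
Context {R : realType}.
Notation line := (measurableTypeR R).
Notation plane := (measurableTypeR R * measurableTypeR R)%type.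
Notation area := (@lebesgue_measure R \x @lebesgue_measure R)%E.
Notation leb := (@lebesgue_measure R).

Lemma fubini_domain d1 d2 (T1 : measurableType d1) (T2 : measurableType d2)
    (m1 : {sigma_finite_measure set T1 -> \bar R})
    (m2 : {sigma_finite_measure set T2 -> \bar R})
    (B : set T2) (f : T1 * T2 -> \bar R) : measurable B ->
  measurable_fun [set: T1 * T2] f -> (forall p, (0 <= f p)%E) ->
  (\int[m1]_x \int[m2]_(y in B) f (x, y) = \int[m2]_(y in B) \int[m1]_x f (x, y))%E.
Proof.
move=> mB mf f0; have mTB : measurable ([set: T1] `*` B) by exact: measurableX.
pose g := f \_ ([set: T1] `*` B).
have mg : measurable_fun setT g.
  by apply/(measurable_restrictT _ mTB); exact: measurable_funTS mf.
have g0 p : (0 <= g p)%E by apply: erestrict_ge0.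
have gE x y : g (x, y) = ((fun y => f (x, y)) \_ B) y.
  rewrite /g !patchE; congr (if _ then _ else _).
  by apply/idP/idP => [/set_mem[_ /mem_set//]|/set_mem yB]; apply/mem_set.
transitivity (\int[m1]_x \int[m2]_y g (x, y))%E.
  apply: eq_integral => x _; rewrite integral_mkcond; apply: eq_integral => y _.
  by rewrite gE.
rewrite (fubini_tonelli g mg g0) [RHS]integral_mkcond; apply: eq_integral => y _.
rewrite [RHS]patchE; case: ifPn => yB.
  by apply: eq_integral => x _; rewrite gE patchE yB.
by apply: integral0_eq => x _; rewrite gE patchE (negbTE yB).
Qed.

Lemma measurable_integral_domain d1 d2 (T1 : measurableType d1) (T2 : measurableType d2)
    (m2 : {sigma_finite_measure set T2 -> \bar R})
    (f : T1 * T2 -> \bar R) (B : set T2) : measurable B ->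
  measurable_fun [set: T1 * T2] f -> (forall p, (0 <= f p)%E) ->
  measurable_fun [set: T1] (fun x => \int[m2]_(y in B) f (x, y))%E.
Proof.
move=> mB mf f0; have mTB : measurable ([set: T1] `*` B) by exact: measurableX.
rewrite (_ : (fun x => _) = fubini_F m2 (f \_ ([set: T1] `*` B))).
  apply: measurable_fun_fubini_tonelli_F; last by move=> p; apply: erestrict_ge0.
  by apply/(measurable_restrictT _ mTB); exact: measurable_funTS mf.
apply/funext => x; rewrite /fubini_F [LHS]integral_mkcond; apply: eq_integral => y _.
rewrite !patchE; congr (if _ then _ else _).
by apply/idP/idP => [/set_mem yB|/set_mem[_ /mem_set//]]; apply/mem_set.
Qed.

Lemma area_sigma_finite : sigma_finite [set: plane] area.
Proof.
exists (fun n => closed_square (0, 0) n%:R).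
  apply/seteqP; split => // p _.
  exists (Num.truncn `|p.1| + Num.truncn `|p.2|).+2 => //; apply: closed_squareP;
    rewrite /= subr0; apply/ltW;
    apply: (lt_le_trans (truncnS_gt _)); rewrite ler_nat.
    by rewrite !ltnS leqW// leq_addr.
  by rewrite !ltnS leqW// leq_addl.
move=> n; split; first exact: measurable_closed_square.
by rewrite area_closed_square// ltry.
Qed.

(* The library's sigma-finite instance for products is shadowed by the one for
   probability measures, so it has to be rebuilt. *)
Definition area_sf : {sigma_finite_measure set plane -> \bar R} :=
  HB.pack_for {sigma_finite_measure set plane -> \bar R} area
    (Measure_isSigmaFinite.Build _ _ _ area area_sigma_finite).

Definition circle_point (r : R) (z : plane) (t : line) : plane :=
  (z.1 + r * cos t, z.2 + r * sin t).

Lemma measurable_circle_point (r : R) :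
  measurable_fun [set: plane * line] (fun p : plane * line => circle_point r p.1 p.2).
Proof.
have mc : measurable_fun [set: line] (@cos R : line -> line).
  by apply: continuous_measurable_fun; exact: continuous_cos.
have ms : measurable_fun [set: line] (@sin R : line -> line).
  by apply: continuous_measurable_fun; exact: continuous_sin.
have m1 := @measurable_fst _ _ line line.
have m2 := @measurable_snd _ _ line line.
have n1 := @measurable_fst _ _ plane line.
have n2 := @measurable_snd _ _ plane line.
apply: measurable_fun_pair.
  exact: measurable_funD (measurableT_comp m1 n1)
    (measurable_funM (measurable_cst r) (measurableT_comp mc n2)).
exact: measurable_funD (measurableT_comp m2 n1)
    (measurable_funM (measurable_cst r) (measurableT_comp ms n2)).
Qed.

(* Averaging over circles is self-adjoint: testing the superharmonicity of W
   against V moves the average onto V, whose means gain k1 and lose k2. *)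
Section sweep.
Variables (W : plane -> \bar R) (V k1 k2 : plane -> line) (r : R).
Hypothesis mW : measurable_fun [set: plane] W.
Hypothesis W0 : forall p, (0 <= W p)%E.
Hypothesis mV : measurable_fun [set: plane] V.
Hypothesis V0 : forall p, 0 <= V p.
Hypothesis mk1 : measurable_fun [set: plane] k1.
Hypothesis k10 : forall p, 0 <= k1 p.
Hypothesis mk2 : measurable_fun [set: plane] k2.
Hypothesis k20 : forall p, 0 <= k2 p.
Let I : set line := `[0%R, (2 * pi)%R]%classic.
Hypothesis W_mean : forall z, 0 < V z ->
  (\int[leb]_(t in I) W (circle_point r z t) <= (2 * pi)%:E * W z)%E.
Hypothesis V_mean : forall z,
  ((2 * pi * (V z + k1 z))%:E <=
   \int[leb]_(t in I) (V (circle_point (- r) z t))%:E + (2 * pi * k2 z)%:E)%E.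
Hypothesis VW_fin : (\int[area]_z (W z * (V z)%:E) < +oo)%E.

Let mI : measurable I. Proof. exact: measurable_itv. Qed.

Let twopi : 0 < 2 * pi :> R. Proof. by rewrite mulr_gt0// pi_gt0. Qed.

Let mEFin (g : plane -> line) : measurable_fun [set: plane] g ->
  measurable_fun [set: plane] (fun z => (g z)%:E).
Proof. by move=> mg; apply/measurable_EFinP. Qed.

Let mWg (g : plane -> line) : measurable_fun [set: plane] g ->
  measurable_fun [set: plane] (fun z => W z * (g z)%:E)%E.
Proof. by move=> mg; apply: emeasurable_funM => //; exact: mEFin. Qed.

Let Wg0 (g : plane -> line) z : 0 <= g z -> (0 <= W z * (g z)%:E)%E.
Proof. by move=> g0; rewrite mule_ge0. Qed.

(** Tonelli moves the angle t outside. For fixed t, translating the plane by r e^(it) turns W(z) V(z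
    - r e^(it)) into W(z + r e^(it)) V(z); hence the radius [- r] on the side of [V]. *)
Lemma circle_dual :
  (\int[area]_z (W z * \int[leb]_(t in I) (V (circle_point (- r) z t))%:E) =
   \int[area]_z ((V z)%:E * \int[leb]_(t in I) W (circle_point r z t)))%E.
Proof.
have mVc := measurableT_comp (mEFin mV) (measurable_circle_point (- r)).
have mWc := measurableT_comp mW (measurable_circle_point r).
have n1 := @measurable_fst _ _ plane line.
transitivity (\int[area]_z (\int[leb]_(t in I) (W z * (V (circle_point (- r) z t))%:E)))%E.
  apply: eq_integral => z _; rewrite ge0_integralZl//.
  - by apply: measurable_funTS; exact: (measurable_fun_pair2 z mVc).
  - by move=> t _; rewrite lee_fin.
rewrite (@fubini_domain _ _ _ _ area_sf leb I
  (fun p : plane * line => W p.1 * (V (circle_point (- r) p.1 p.2))%:E)%E mI); first last.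
- by move=> p; rewrite mule_ge0// lee_fin.
- by apply: emeasurable_funM => //; exact: (measurableT_comp mW n1).
transitivity (\int[area]_z (\int[leb]_(t in I) ((V z)%:E * W (circle_point r z t))))%E; last first.
  apply: eq_integral => z _; rewrite ge0_integralZl//.
    by apply: measurable_funTS; exact: (measurable_fun_pair2 z mWc).
  by rewrite lee_fin.
have g0 p : (0 <= (V p.1)%:E * W (circle_point r p.1 p.2))%E by rewrite mule_ge0// lee_fin.
have mg : measurable_fun [set: plane * line]
    (fun p : plane * line => (V p.1)%:E * W (circle_point r p.1 p.2))%E.
  by apply: emeasurable_funM => //; exact: (measurableT_comp (mEFin mV) n1).
have -> := @fubini_domain _ _ _ _ area_sf leb I _ mI mg g0.
apply: eq_integral => t _ /=.
pose g z := (W z * (V (circle_point (- r) z t))%:E)%E.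
have mgt : measurable_fun [set: plane] g.
  by apply: emeasurable_funM => //; exact: (measurable_fun_pair1 t mVc).
have gt0 p : (0 <= g p)%E by rewrite mule_ge0// lee_fin.
rewrite -(integral_shift_plane (r * cos t, r * sin t) mgt gt0).
apply: eq_integral => z _ /=; rewrite muleC; congr (_ * _)%E.
rewrite /circle_point /shift_plane /= !mulNr -!addrA !subrr !addr0.
by case: (z).
Qed.

(** Integrating [V_mean] against [W], then using [circle_dual] and [W_mean], gives 2 pi (A + B) <= 2
    pi (A + C) with A the integral of W V; A is finite and cancels. *)
Lemma sweep : (\int[area]_z (W z * (k1 z)%:E) <= \int[area]_z (W z * (k2 z)%:E))%E.
Proof.
have mVc := measurableT_comp (mEFin mV) (measurable_circle_point (- r)).
have mWc := measurableT_comp mW (measurable_circle_point r).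
have mJ : measurable_fun [set: plane]
    (fun z => \int[leb]_(t in I) (V (circle_point (- r) z t))%:E)%E.
  by apply: (measurable_integral_domain leb mI mVc) => p; rewrite lee_fin.
have mK : measurable_fun [set: plane]
    (fun z => \int[leb]_(t in I) W (circle_point r z t))%E.
  by apply: (measurable_integral_domain leb mI mWc) => p; exact: W0.
have J0 z : (0 <= \int[leb]_(t in I) (V (circle_point (- r) z t))%:E)%E.
  by apply: integral_ge0 => t _; rewrite lee_fin.
have tp0 : (0 <= (2 * pi)%:E :> \bar R)%E by rewrite lee_fin ltW.
pose A := (\int[area]_z (W z * (V z)%:E))%E.
have Afin : (A < +oo)%E := VW_fin.
set B := integral _ _ _; set C := (X in (_ <= X)%E).
have A0 : (0 <= A)%E by apply: integral_ge0 => z _; exact: Wg0.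
have step : ((2 * pi)%:E * (A + B) <= (2 * pi)%:E * (A + C))%E.
  apply: (@le_trans _ _ (\int[area]_z (W z * (\int[leb]_(t in I) (V (circle_point (- r) z t))%:E
      + (2 * pi * k2 z)%:E)))%E).
    rewrite /A /B -ge0_integralD//; [|by move=> *; exact: Wg0|exact: mWg|by move=> *; exact: Wg0|exact: mWg].
    rewrite -ge0_integralZl//; [|by apply: emeasurable_funD; exact: mWg|
      by move=> z _; rewrite adde_ge0// Wg0].
    apply: ge0_le_integral => //.
    - by move=> z _; rewrite mule_ge0// adde_ge0// Wg0.
    - by apply: measurable_funeM; apply: emeasurable_funD; exact: mWg.
    - apply: emeasurable_funM => //; apply: emeasurable_funD => //.
      by apply: mEFin; apply: measurable_funM.
    move=> z _; rewrite -ge0_muleDr ?lee_fin// -EFinD muleCA -EFinM.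
    by apply: lee_wpmul2l.
  have c0 z : (0 <= (2 * pi * k2 z)%:E)%E by rewrite lee_fin mulr_ge0// ltW.
  rewrite (eq_integral (fun z => W z * \int[leb]_(t in I) (V (circle_point (- r) z t))%:E
    + W z * (2 * pi * k2 z)%:E)%E); last by move=> z _; rewrite ge0_muleDr.
  rewrite ge0_integralD//; last 4 first.
  - by move=> z _; rewrite mule_ge0.
  - exact: emeasurable_funM.
  - by move=> z _; rewrite mule_ge0.
  - by apply: mWg; apply: measurable_funM.
  rewrite ge0_muleDr//; last by apply: integral_ge0 => z _; exact: Wg0.
  apply: leeD.
    rewrite circle_dual /A -ge0_integralZl//; [|exact: mWg|by move=> *; exact: Wg0].
    apply: ge0_le_integral => //.
    - by move=> z _; rewrite mule_ge0// ?lee_fin//; exact: integral_ge0.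
    - by apply: emeasurable_funM => //; exact: mEFin.
    - by apply: measurable_funeM; exact: mWg.
    (* Where [V] vanishes both sides are 0, so [W_mean] is called only at points with [V]
       positive. *)
    move=> z _; have := V0 z; rewrite le_eqVlt => /predU1P[<-|Vz].
      by rewrite mul0e !mule0.
    rewrite (muleC (W z)) muleCA.
    by apply: lee_wpmul2l; [rewrite lee_fin|exact: W_mean].
  rewrite /C -ge0_integralZl//; [|exact: mWg|by move=> *; exact: Wg0].
  rewrite le_eqVlt; apply/orP; left; apply/eqP; apply: eq_integral => z _.
  by rewrite muleCA -EFinM.
have fA : A \is a fin_num by rewrite ge0_fin_numE.
by move: step; rewrite lee_pmul2l ?lte_fin// leeD2lE.
Qed.

End sweep.
End balayage.

(** * Circle integrals of trigonometric polynomials *)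

Section trig.
Context {R : realType}.
Notation line := (measurableTypeR R).
Notation leb := (@lebesgue_measure R).

Definition trig2 (A B C D E F : R) (t : R) : R :=
  A + B * cos t + C * sin t + D * cos t ^+ 2 + E * (sin t * cos t) + F * sin t ^+ 2.

Definition trig2_primitive (A B C D E F : R) (t : R) : R :=
  A * t + B * sin t - C * cos t + D * ((t + sin t * cos t) / 2)
  + E * (sin t ^+ 2 / 2) + F * ((t - sin t * cos t) / 2).

Lemma is_derive_trig2 (A B C D E F t : R) :
  is_derive t 1 (trig2_primitive A B C D E F) (trig2 A B C D E F t).
Proof.
rewrite /trig2_primitive; apply: is_derive_eq; rewrite /trig2 /GRing.scale /=.
have := cos2Dsin2 t; set c := cos t; set s := sin t => cs.
have -> : D * c ^+ 2 = D * ((1 + c ^+ 2 - s ^+ 2) / 2).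
  by congr (_ * _); lra.
have -> : F * s ^+ 2 = F * ((1 - c ^+ 2 + s ^+ 2) / 2).
  by congr (_ * _); lra.

by field.
Qed.

Lemma continuous_trig2 (A B C D E F : R) : continuous (trig2 A B C D E F).
Proof.
move=> t; apply/differentiable_continuous/derivable1_diffP.
by rewrite /trig2; exact: ex_derive.
Qed.

Lemma integral_trig2 (A B C D E F : R) :
  (\int[leb]_(t in `[0%R, (2 * pi)%R]) (trig2 A B C D E F t)%:E =
   (2 * pi * A + pi * (D + F))%:E)%E.
Proof.
have pi0 := @pi_gt0 R.
have twopi : 0 < 2 * pi :> R by rewrite mulr_gt0.
have dP t := is_derive_trig2 A B C D E F t.
have cP : continuous (trig2_primitive A B C D E F).
  by move=> t; apply/differentiable_continuous/derivable1_diffP; exact: ex_derive.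
rewrite (continuous_FTC2 (F := trig2_primitive A B C D E F) twopi).
- rewrite /trig2_primitive -EFinB; congr EFin.
  by rewrite !mulr_natl cos2pi sin2pi sin0 cos0; field.
- by apply: continuous_subspaceT; exact: continuous_trig2.
- by split; [move=> t _; exact: ex_derive|exact: cvg_at_right_filter (cP _)|
    exact: cvg_at_left_filter (cP _)].
- by move=> t _; rewrite derive1E; exact: derive_val.
Qed.

(** The minorant may be negative, while the comparison of integrals is made between nonnegative
    functions: both sides are raised by a constant [M] bounding all coefficients, whose contribution
    2 pi M is cancelled at the end. *)
Lemma integral_ge_trig2 (g : line -> R) (A B C D E F : R) :
  measurable_fun [set: line] g -> (forall t, 0 <= g t) ->
  (forall t, trig2 A B C D E F t <= g t) ->
  ((2 * pi * A + pi * (D + F))%:E <= \int[leb]_(t in `[0%R, (2 * pi)%R]) (g t)%:E)%E.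
Proof.
move=> mg g0 gT.
pose M := `|A| + `|B| + `|C| + `|D| + `|E| + `|F|.
have M0 : 0 <= M by rewrite !addr_ge0.
have mI : measurable (`[0%R, (2 * pi)%R]%classic : set line) by exact: measurable_itv.
have TM t : 0 <= trig2 (A + M) B C D E F t.
  have := @cos_le1 _ t; have := @cos_geN1 _ t; have := @sin_le1 _ t; have := @sin_geN1 _ t.
  rewrite /trig2; set c := cos t; set s := sin t => s1 s2 c1 c2.
  have key (x y : R) : -1 <= y <= 1 -> - `|x| <= x * y.
    move=> y1; rewrite lerNl -mulNr; apply: le_trans (ler_norm _) _.
    by rewrite normrM normrN ler_piMr// ler_norml.
  have kB := key B c; have kC := key C s; have kD := key D (c ^+ 2).
  have kE := key E (s * c); have kF := key F (s ^+ 2).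
  have hA := ler_norm (- A); rewrite normrN in hA.
  have [hc hs hcc hsc hss] : [/\ -1 <= c <= 1, -1 <= s <= 1, -1 <= c ^+ 2 <= 1,
     -1 <= s * c <= 1 & -1 <= s ^+ 2 <= 1].
    have cs : c ^+ 2 + s ^+ 2 = 1 by exact: cos2Dsin2.
    have c20 := sqr_ge0 c; have s20 := sqr_ge0 s.
    have h1 := sqr_ge0 (s - c); have h2 := sqr_ge0 (s + c).
    rewrite sqrrB in h1; rewrite sqrrD in h2.
    by clear -s1 s2 c1 c2 cs c20 s20 h1 h2; split; apply/andP; split; lra.
  move: (kB hc) (kC hs) (kD hcc) (kE hsc) (kF hss); rewrite /M; lra.
have h : (\int[leb]_(t in `[0%R, (2 * pi)%R]) (trig2 (A + M) B C D E F t)%:E <=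
          \int[leb]_(t in `[0%R, (2 * pi)%R]) ((g t)%:E + M%:E))%E.
  apply: ge0_le_integral => //.
  - by move=> t _; rewrite lee_fin.
  - apply/measurable_EFinP; apply: measurable_funTS.
    by apply: continuous_measurable_fun; exact: continuous_trig2.
  - by apply/measurable_EFinP; apply: measurable_funD => //; exact: measurable_funTS.
  - by move=> t _; rewrite -EFinD lee_fin; have := gT t; rewrite /trig2; lra.
have mgI : measurable_fun (`[0%R, (2 * pi)%R]%classic : set line) (fun t => (g t)%:E).
  by apply/measurable_EFinP; exact: measurable_funTS.
move: h; rewrite integral_trig2.
rewrite (ge0_integralD leb mI _ mgI _ (measurable_cst M%:E)); last 2 first.
- by move=> t _; rewrite lee_fin.
- by move=> t _; rewrite lee_fin.
rewrite (integral_cst leb mI) [X in (_ + _ * X)%E]lebesgue_measure_itv /= lte_fin.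
rewrite mulr_gt0// ?pi_gt0// sube0.
have -> : 2 * pi * (A + M) + pi * (D + F) = (2 * pi * A + pi * (D + F)) + M * (2 * pi) by ring.
by rewrite EFinD -EFinM leeD2rE.
Qed.
End trig.

(** * The potential of a point *)

Section potential.
Context {R : realType}.
Notation line := (measurableTypeR R).
Notation plane := (measurableTypeR R * measurableTypeR R)%type.
Notation leb := (@lebesgue_measure R).

(** Second order expansion in r of a quotient whose numerator and denominator move by first order
    terms l1, l2 and by r^2; the error r^3 / d^8 comes from denominators bounded below by d^2. *)
Lemma quotient_expansion (N Q d r l1 l2 : R) :
  0 < d <= 1 -> d ^+ 2 <= Q <= 9 -> 0 <= N <= 1 -> 0 < r <= 1 ->
  `|l1| <= 4 * r -> `|l2| <= 8 * r -> d ^+ 2 <= Q + l2 + r ^+ 2 ->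
  N / Q - (l1 * Q + N * l2) / Q ^+ 2 - r ^+ 2 * (Q + N) / Q ^+ 2
    + (l1 * Q + N * l2) * l2 / Q ^+ 3 - 71 ^+ 2 * (r ^+ 3 / d ^+ 8)
  <= (N - l1 - r ^+ 2) / (Q + l2 + r ^+ 2).
Proof.
move=> /andP[d0 d1] /andP[dQ Q9] /andP[N0 N1] /andP[r0 r1] hl1 hl2 dQv.
have d20 : 0 < d ^+ 2 by rewrite exprn_gt0.
have Q0 : 0 < Q by exact: lt_le_trans dQ.
pose v := l2 + r ^+ 2; pose s := (l1 + r ^+ 2) * Q + N * v.
have Qv : Q + l2 + r ^+ 2 = Q + v by rewrite addrA.
rewrite Qv in dQv *.
have Qv0 : 0 < Q + v by exact: lt_le_trans dQv.
(* With u = l1 + r^2 the quotient is N/Q - s/(Q (Q + v)), where s = u Q + N v, and 1/(Q + v) = 1/Q -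
   v/Q^2 + v^2/(Q^2 (Q + v)) exactly. The last two terms of the identity are of order r^3. *)
have -> : (N - l1 - r ^+ 2) / (Q + v) =
  N / Q - (l1 * Q + N * l2) / Q ^+ 2 - r ^+ 2 * (Q + N) / Q ^+ 2
  + (l1 * Q + N * l2) * l2 / Q ^+ 3
  + (s * r ^+ 2 + r ^+ 2 * (Q + N) * l2) / Q ^+ 3 - s * v ^+ 2 / (Q ^+ 3 * (Q + v)).
  by rewrite /s /v in Qv0 *; field; rewrite !gt_eqF.
rewrite -!addrA !lerD2l.
have r2r : r ^+ 2 <= r by rewrite expr2 ler_piMr// ltW.
have hu : `|l1 + r ^+ 2| <= 5 * r.
  apply: le_trans (ler_normD _ _) _; rewrite (ger0_norm (sqr_ge0 r)); lra.
have hv : `|v| <= 9 * r.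
  apply: le_trans (ler_normD _ _) _; rewrite (ger0_norm (sqr_ge0 r)); lra.
have hs : `|s| <= 54 * r.
  apply: le_trans (ler_normD _ _) _; rewrite !normrM (gtr0_norm Q0) (ger0_norm N0).
  have : `|l1 + r ^+ 2| * Q <= (5 * r) * 9 by apply: ler_pM => //; exact: ltW.
  have : N * `|v| <= 1 * (9 * r) by apply: ler_pM.
  lra.
(* The two remainders cost 134 + 4374 = 4508, below 71^2 = 5041. *)
have hX : `|(s * r ^+ 2 + r ^+ 2 * (Q + N) * l2) / Q ^+ 3| <= 134 * (r ^+ 3 / d ^+ 8).
  rewrite [X in _ <= X]mulrA.
  rewrite normrM normfV (gtr0_norm (exprn_gt0 3 Q0)).
  apply: ler_pM; rewrite ?invr_ge0 ?exprn_ge0 ?(ltW Q0)//.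
    apply: le_trans (ler_normD _ _) _.
    rewrite (normrM s) (normrM (r ^+ 2 * _)) (normrM (r ^+ 2)) (ger0_norm (sqr_ge0 r)).
    have QN : `|Q + N| <= 10 by rewrite ger0_norm; lra.
    have h1 : `|s| * r ^+ 2 <= (54 * r) * r ^+ 2 by apply: ler_wpM2r => //; exact: sqr_ge0.
    have h2 : r ^+ 2 * `|Q + N| * `|l2| <= (r ^+ 2 * 10) * (8 * r).
      apply: ler_pM => //; first by rewrite mulr_ge0 ?sqr_ge0.
      by apply: ler_wpM2l => //; exact: sqr_ge0.
    have -> : 134 * r ^+ 3 = (54 * r) * r ^+ 2 + (r ^+ 2 * 10) * (8 * r) by ring.
    exact: lerD.
  rewrite lef_pV2 ?posrE ?exprn_gt0//.
  apply: (@le_trans _ _ ((d ^+ 2) ^+ 3)); last by apply: lerXn2r; rewrite ?nnegrE// ltW.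
  by rewrite -exprM (_ : 8 = 2 * 3 + 2)%N// exprD ler_piMr ?exprn_ge0 ?(ltW d0)// exprn_ile1// ltW.
have hY : `|s * v ^+ 2 / (Q ^+ 3 * (Q + v))| <= 4374 * (r ^+ 3 / d ^+ 8).
  rewrite [X in _ <= X]mulrA.
  rewrite normrM normfV (@gtr0_norm _ (Q ^+ 3 * (Q + v))) ?mulr_gt0 ?exprn_gt0//.
  apply: ler_pM; rewrite ?invr_ge0 ?mulr_ge0 ?exprn_ge0 ?(ltW Q0) ?(ltW Qv0)//.
    rewrite normrM normrX (_ : 4374 * r ^+ 3 = (54 * r) * (9 * r) ^+ 2); last by ring.
    by apply: ler_pM; rewrite ?exprn_ge0//; apply: lerXn2r; rewrite ?nnegrE//; lra.
  rewrite lef_pV2 ?posrE ?mulr_gt0 ?exprn_gt0// (_ : 8 = 2 * 3 + 2)%N// exprD exprM.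
  by apply: ler_pM; rewrite ?exprn_ge0 ?(ltW d0)//; apply: lerXn2r; rewrite ?nnegrE ?(ltW Q0) ?exprn_ge0 ?(ltW d0).
set X := (_ / Q ^+ 3) in hX *; set Y := (_ / (_ * (Q + v))) in hY *.
move: hX hY; rewrite !ler_norml => /andP[+ _] /andP[_ +].
have : 0 <= r ^+ 3 / d ^+ 8 by rewrite divr_ge0// exprn_ge0// ltW.
by set k := r ^+ 3 / _; lra.
Qed.

Variables (a : plane) (d : R).

Definition numer (z : plane) : R := 1 - z.1 ^+ 2 - z.2 ^+ 2.

Definition denom (z : plane) : R := (z.1 - a.1) ^+ 2 + (z.2 - a.2) ^+ 2 + d ^+ 2.

(** For e > 0 the cut keeps the positivity set, within the disk, at a definite distance from the
    unit circle, where [numer] is 0. *)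
Definition potential (e : R) (z : plane) : R := Num.max (numer z / denom z - e) 0.

Lemma potential_ge0 e z : 0 <= potential e z.
Proof. by rewrite le_max lexx orbT. Qed.

Hypothesis d01 : 0 < d <= 1.
Hypothesis a1 : a.1 ^+ 2 + a.2 ^+ 2 <= 1.

Lemma denom_ge z : d ^+ 2 <= denom z.
Proof. by rewrite /denom lerDr addr_ge0// sqr_ge0. Qed.

Lemma denom_gt0 z : 0 < denom z.
Proof.
by apply: lt_le_trans (denom_ge z); rewrite exprn_gt0//; case/andP: d01.
Qed.

Lemma sqr_le1 (x y : R) : x ^+ 2 + y ^+ 2 <= 1 -> `|x| <= 1 /\ `|y| <= 1.
Proof.
by move=> xy; have x2 := sqr_ge0 x; have y2 := sqr_ge0 y; split;
  rewrite -(@ler_pXn2r _ 2)// ?nnegrE// expr1n real_normK ?num_real//; lra.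
Qed.

Lemma denom_le9 z : z.1 ^+ 2 + z.2 ^+ 2 <= 1 -> denom z <= 9.
Proof.
move=> /sqr_le1[]; have [] := sqr_le1 a1; have := d01.
rewrite /denom !ler_norml => /andP[? ?] /andP[? ?] /andP[? ?] /andP[? ?] /andP[? ?].
nra.
Qed.

Lemma measurable_numer : measurable_fun [set: plane] (numer : plane -> line).
Proof.
have m1 := @measurable_fst _ _ line line; have m2 := @measurable_snd _ _ line line.
apply: measurable_funB; last exact: (@measurable_funX _ plane _ _ _ 2%N m2).
exact: measurable_funB (measurable_cst _) (@measurable_funX _ plane _ _ _ 2%N m1).
Qed.

Lemma measurable_denom : measurable_fun [set: plane] (denom : plane -> line).
Proof. exact: measurable_funD (measurable_sqr_dist a) (measurable_cst _). Qed.

Lemma measurable_denomV : measurable_fun [set: plane] (fun z => (denom z)^-1 : line).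
Proof.
rewrite (_ : (fun z => _) = (fun x : line => x `^ (-1) : line) \o denom).
  by apply: measurableT_comp measurable_denom; exact: measurable_powR.
by apply/funext => z /=; rewrite powR_inv1// ltW// denom_gt0.
Qed.

Lemma measurable_potential e : measurable_fun [set: plane] (potential e : plane -> line).
Proof.
apply: measurable_maxr (measurable_cst _); apply: measurable_funB (measurable_cst _).
exact: measurable_funM measurable_numer measurable_denomV.
Qed.

(* A quarter of the Laplacian of numer / denom. *)
Definition laplacian (z : plane) : R :=
  (1 - a.1 ^+ 2 - a.2 ^+ 2 - d ^+ 2) / denom z ^+ 2
  - 2 * numer z * d ^+ 2 / denom z ^+ 3.

(** The maximum is at least its first argument. On the circle that argument is, up to the expansion
    error, at least a trigonometric polynomial of degree 2, whose mean is explicit. *)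
Lemma potential_circle_mean e r z : 0 < r <= 1 -> z.1 ^+ 2 + z.2 ^+ 2 <= 1 ->
  ((2 * pi * (numer z / denom z - e + r ^+ 2 * laplacian z - 71 ^+ 2 * (r ^+ 3 / d ^+ 8)))%:E
   <= \int[leb]_(t in `[0%R, (2 * pi)%R]) (potential e (circle_point (- r) z t))%:E)%E.
Proof.
move=> r01 z1; have /andP[r0 r1] := r01.
set N := numer z; set Q := denom z.
have Q0 : 0 < Q := denom_gt0 z.
pose p := z.1 - a.1; pose q := z.2 - a.2.
pose al := z.1 * Q + N * p; pose be := z.2 * Q + N * q.
pose A := N / Q - e - r ^+ 2 * (Q + N) / Q ^+ 2 - 71 ^+ 2 * (r ^+ 3 / d ^+ 8).
pose k := 4 * r ^+ 2 / Q ^+ 3.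
have -> : 2 * pi * (N / Q - e + r ^+ 2 * laplacian z - 71 ^+ 2 * (r ^+ 3 / d ^+ 8)) =
   2 * pi * A + pi * (k * (al * p) + k * (be * q)).
  rewrite /A /k /laplacian -/N -/Q.
  have -> : 1 - a.1 ^+ 2 - a.2 ^+ 2 - d ^+ 2 =
     2 * (z.1 * p + z.2 * q) + N - Q by rewrite /N /Q /numer /denom /p /q; ring.
  have -> : d ^+ 2 = Q - p ^+ 2 - q ^+ 2 by rewrite /Q /denom /p /q; ring.
  have d0 : 0 < d by case/andP: d01.
  by rewrite /al /be; field; rewrite !gt_eqF.
apply: (@integral_ge_trig2 _ _ A (2 * r * al / Q ^+ 2) (2 * r * be / Q ^+ 2)
  (k * (al * p)) (k * (al * q + be * p)) (k * (be * q))).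
- have := measurableT_comp (measurable_potential e) (measurable_circle_point (- r)).
  exact: (measurable_fun_pair2 z).
- by move=> t; exact: potential_ge0.
- move=> t; rewrite /potential le_max; apply/orP; left.
  have zN0 : 0 <= N <= 1.
    have x0 := sqr_ge0 z.1; have y0 := sqr_ge0 z.2.
    by rewrite /N /numer -addrA -opprD subr_ge0 z1 gerBl addr_ge0.
  pose l1 := - 2 * r * (z.1 * cos t + z.2 * sin t).
  pose l2 := - 2 * r * (p * cos t + q * sin t).
  have cs := cos2Dsin2 t.
  have rE : r ^+ 2 = r ^+ 2 * (cos t ^+ 2 + sin t ^+ 2) by rewrite cs mulr1.
  have numE : numer (circle_point (- r) z t) = N - l1 - r ^+ 2.
    by rewrite [in RHS]rE /N /numer /circle_point /l1 /=; ring.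
  have denE : denom (circle_point (- r) z t) = Q + l2 + r ^+ 2.
    by rewrite [in RHS]rE /Q /denom /circle_point /l2 /p /q /=; ring.
  have [x1 y1] := sqr_le1 z1; have [a11 a21] := sqr_le1 a1.
  have [|c1 s1] := @sqr_le1 (cos t) (sin t); first by rewrite cs.
  have bnd (u v : R) : `|u| <= 2 -> `|v| <= 2 ->
      `|- 2 * r * (u * cos t + v * sin t)| <= 8 * r.
    move=> u2 v2; rewrite mulrAC normrM (ger0_norm (ltW r0)); apply: ler_wpM2r; first exact: ltW.
    rewrite mulrDr; apply: le_trans (ler_normD _ _) _; rewrite !normrM normrN normr_nat.
    have : `|u| * `|cos t| <= 2 * 1 by apply: ler_pM.
    have : `|v| * `|sin t| <= 2 * 1 by apply: ler_pM.
    lra.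
  have bnd1 (u v : R) : `|u| <= 1 -> `|v| <= 1 ->
      `|- 2 * r * (u * cos t + v * sin t)| <= 4 * r.
    move=> u2 v2; rewrite mulrAC normrM (ger0_norm (ltW r0)); apply: ler_wpM2r; first exact: ltW.
    rewrite mulrDr; apply: le_trans (ler_normD _ _) _; rewrite !normrM normrN normr_nat.
    have : `|u| * `|cos t| <= 1 * 1 by apply: ler_pM.
    have : `|v| * `|sin t| <= 1 * 1 by apply: ler_pM.
    lra.
  have p2 : `|p| <= 2 by apply: le_trans (ler_normB _ _) _; lra.
  have q2 : `|q| <= 2 by apply: le_trans (ler_normB _ _) _; lra.
  have dQ : d ^+ 2 <= Q <= 9 by rewrite denom_ge denom_le9.
  have := quotient_expansion d01 dQ zN0 r01 (bnd1 _ _ x1 y1) (bnd _ _ p2 q2).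
  rewrite -/l1 -/l2 -numE -denE => /(_ (denom_ge _)).
  rewrite lerBrDr; apply: le_trans; rewrite le_eqVlt; apply/orP; left; apply/eqP.
  rewrite /trig2 /A /k /al /be /l1 /l2.
  have d0 : 0 < d by case/andP: d01.
  by field; rewrite !gt_eqF.
Qed.

End potential.

(** * Size of the Laplacian of the potential *)

Section laplacian_bounds.
Context {R : realType}.
Notation plane := (measurableTypeR R * measurableTypeR R)%type.
Notation leb := (@lebesgue_measure R).

Definition modulus (z : plane) : R := cabs (plane_to_cplx z).

Lemma sqr_modulus z : modulus z ^+ 2 = z.1 ^+ 2 + z.2 ^+ 2.
Proof. exact: sqr_cabs_plane. Qed.

Lemma modulus_ge0 z : 0 <= modulus z. Proof. exact: cabs_ge0. Qed.

Definition circle_super (W : plane -> \bar R) := forall z r, 0 < r ->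
  modulus z + r < 1 ->
  (\int[leb]_(t in `[0%R, (2 * pi)%R]) W (circle_point r z t) <= (2 * pi)%:E * W z)%E.

Definition dist (a z : plane) : R := modulus (z.1 - a.1, z.2 - a.2).

(** The numerator of the positive term of [laplacian]; it is 0 for the Poisson kernel itself (|a| =
    1, d = 0). *)
Definition excess (a : plane) (d : R) : R := 1 - a.1 ^+ 2 - a.2 ^+ 2 - d ^+ 2.

(** With |a| = 1 - 16 d the excess is 32 d - 257 d^2, and d <= 1/16. *)
Lemma excess_bounds a d : 0 < d -> modulus a + 16 * d = 1 ->
  15 * d <= excess a d <= 32 * d.
Proof.
move=> d0 ad; have m0 := modulus_ge0 a.
have d1 : 16 * d <= 1 by lra.
have -> : excess a d = 1 - modulus a ^+ 2 - d ^+ 2 by rewrite sqr_modulus /excess; ring.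
have -> : modulus a = 1 - 16 * d by lra.
have h : 0 <= d * (1 - 16 * d) by rewrite mulr_ge0 ?subr_ge0// ltW.
have d2 := sqr_ge0 d.
by apply/andP; split; lra.
Qed.

Lemma denomE a d z : denom a d z = dist a z ^+ 2 + d ^+ 2.
Proof. by rewrite sqr_modulus /denom. Qed.

(** 1 - |z|^2 is at most 2 (1 - |z|), and 1 - |z| exceeds 1 - |a| = 16 d by at most the distance to
    a. *)
Lemma numer_le a d z : modulus a + 16 * d = 1 -> z.1 ^+ 2 + z.2 ^+ 2 <= 1 -> numer z <= 2 * (16 * d + dist a z).
Proof.
move=> ad z1; have h : modulus a - modulus z <= dist a z.
  rewrite /dist /modulus -[X in _ <= cabs X]/(plane_to_cplx (z - a)) plane_to_cplxB cabs_distC.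
  exact: cabs_sub.
have -> : numer z = (1 - modulus z) * (1 + modulus z).
  by rewrite /numer -subr_sqr expr1n sqr_modulus; ring.
have m0 := modulus_ge0 z.
have m1 : modulus z <= 1 by rewrite -(@expr_le1 _ 2)// sqr_modulus.
have mE : modulus a = 1 - 16 * d by lra.
apply: (@le_trans _ _ ((1 - modulus z) * 2)).
  by apply: ler_wpM2l; rewrite ?subr_ge0//; lra.
lra.
Qed.

(** From distance 4 d on, [numer] is at most 10 [dist], so 4 numer d^2 <= 10 d dist^2 <= excess
    denom: the negative term takes at most half of the positive one. *)
Lemma laplacian_far a d z : 0 < d -> modulus a + 16 * d = 1 -> z.1 ^+ 2 + z.2 ^+ 2 <= 1 -> 4 * d <= dist a z ->
  excess a d / (2 * denom a d z ^+ 2) <= laplacian a d z.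
Proof.
move=> d0 ad z1 sz; rewrite /laplacian -/(excess a d).
have Q0 : 0 < denom a d z by rewrite denomE ltr_wpDl ?sqr_ge0// exprn_gt0.
have : 4 * numer z * d ^+ 2 <= excess a d * denom a d z.
  have hN := numer_le ad z1; have /andP[hk _] := excess_bounds d0 ad.
  have : 4 * numer z * d ^+ 2 <= 40 * dist a z * d ^+ 2.
    by apply: ler_wpM2r; [exact: sqr_ge0|lra].
  have : 15 * d * dist a z ^+ 2 <= excess a d * denom a d z.
    apply: ler_pM; [by rewrite mulr_ge0// ltW|exact: sqr_ge0|exact: hk|].
    by rewrite denomE lerDl sqr_ge0.
  have : 40 * dist a z * d ^+ 2 <= 10 * d * dist a z ^+ 2.
    have -> : 40 * dist a z * d ^+ 2 = (10 * d * dist a z) * (4 * d) by ring.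
    have -> : 10 * d * dist a z ^+ 2 = (10 * d * dist a z) * dist a z by ring.
    by apply: ler_wpM2l => //; rewrite !mulr_ge0 ?modulus_ge0// ltW.
  have : 0 <= d * dist a z ^+ 2 by rewrite mulr_ge0 ?sqr_ge0// ltW.
  clear; lra.
set Q := denom a d z in Q0 *; set N := numer z => h.
rewrite -subr_ge0.
have -> : excess a d / Q ^+ 2 - 2 * N * d ^+ 2 / Q ^+ 3 - excess a d / (2 * Q ^+ 2) =
  (excess a d * Q - 4 * N * d ^+ 2) / (2 * Q ^+ 3) by field; rewrite gt_eqF.
by rewrite divr_ge0 ?subr_ge0// mulr_ge0// exprn_ge0// ltW.
Qed.

(** The positive term is dropped; in the other one [numer] is at most 40 d and [denom] at least
    d^2. *)
Lemma laplacian_near a d z : 0 < d -> modulus a + 16 * d = 1 -> z.1 ^+ 2 + z.2 ^+ 2 <= 1 -> dist a z <= 4 * d ->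
  - (80 * d / d ^+ 4) <= laplacian a d z.
Proof.
move=> d0 ad z1 sz; rewrite /laplacian -/(excess a d).
have dQ : d ^+ 2 <= denom a d z by rewrite denomE lerDr sqr_ge0.
have d20 : 0 < d ^+ 2 by rewrite exprn_gt0.
have Q0 : 0 < denom a d z by exact: lt_le_trans dQ.
have hN : numer z <= 40 * d by have := numer_le ad z1; lra.
have N0 : 0 <= numer z by rewrite /numer -addrA -opprD subr_ge0.
have k0 : 0 <= excess a d / denom a d z ^+ 2.
  rewrite divr_ge0 ?sqr_ge0//; have /andP[+ _] := excess_bounds d0 ad; apply: le_trans.
  by rewrite mulr_ge0// ltW.
apply: (@le_trans _ _ (- (2 * numer z * d ^+ 2 / denom a d z ^+ 3))); last by rewrite lerDr.
rewrite lerN2; set Q := denom a d z in dQ Q0 *.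
have -> : 80 * d / d ^+ 4 = (80 * d * d ^+ 2) / (d ^+ 2) ^+ 3 by field; rewrite gt_eqF.
apply: ler_pM; rewrite ?invr_ge0 ?mulr_ge0 ?exprn_ge0 ?(ltW Q0) ?(ltW d0)//.
  by apply: ler_wpM2r; [exact: sqr_ge0|lra].
rewrite lef_pV2 ?posrE ?exprn_gt0//; apply: lerXn2r => //; rewrite nnegrE ltW//.
Qed.

End laplacian_bounds.

(** * The potential as a test function *)

Section superharmonic_defect.
Context {R : realType}.
Notation line := (measurableTypeR R).
Notation plane := (measurableTypeR R * measurableTypeR R)%type.
Notation area := (@lebesgue_measure R \x @lebesgue_measure R)%E.
Notation leb := (@lebesgue_measure R).

Let twopi : 0 < 2 * pi :> R. Proof. by rewrite mulr_gt0// pi_gt0. Qed.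

Let integral_period_cst (c : \bar R) :
  (\int[leb]_(t in `[0%R, (2 * pi)%R]) c = (2 * pi)%:E * c)%E.
Proof.
have mI : measurable (`[0%R, (2 * pi)%R]%classic : set line) by exact: measurable_itv.
rewrite (integral_cst leb mI) [X in (c * X)%E]lebesgue_measure_itv /= lte_fin.
by rewrite twopi sube0 muleC.
Qed.

Lemma measurable_on_circle (W : plane -> \bar R) (r : R) z :
  measurable_fun [set: plane] W ->
  measurable_fun (`[0%R, (2 * pi)%R]%classic : set line) (fun t => W (circle_point r z t)).
Proof.
move=> mW; apply: measurable_funTS.
exact: (measurable_fun_pair2 z (measurableT_comp mW (measurable_circle_point r))).
Qed.

(** At the center the minimum is either W or the constant, and on the circle it is below both. *)
Lemma circle_super_mine (W : plane -> \bar R) (n : R) : 0 <= n ->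
  measurable_fun [set: plane] W -> (forall p, (0 <= W p)%E) ->
  circle_super W -> circle_super (fun p => mine (W p) n%:E).
Proof.
move=> n0 mW W0 superW z r r0 zr.
have mI : measurable (`[0%R, (2 * pi)%R]%classic : set line) by exact: measurable_itv.
have mWn : measurable_fun [set: plane] (fun p => mine (W p) n%:E).
  exact: measurable_mine mW (measurable_cst _).
have Wn0 p : (0 <= mine (W p) n%:E)%E by rewrite le_min W0 lee_fin.
have [Wzn|nWz] := leP (W z) n%:E.
  apply: le_trans (superW z r r0 zr); apply: ge0_le_integral => //.
  - exact: (measurable_on_circle r z mWn).
  - exact: (measurable_on_circle r z mW).
  - by move=> t _; rewrite ge_min lexx.
rewrite -integral_period_cst; apply: ge0_le_integral => //.
- exact: (measurable_on_circle r z mWn).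
- by move=> t _; rewrite ge_min lexx orbT.
Qed.

(** Since |a| = 1 - 16 d, every circle about [a] of radius below 4 d lies in the unit disk and obeys
    the mean inequality; 512 = 32 * 4^2. *)
Lemma near_bound (W : plane -> \bar R) (a : plane) (d : R) : 0 < d -> modulus a + 16 * d = 1 ->
  measurable_fun [set: plane] W -> (forall p, (0 <= W p)%E) -> circle_super W ->
  (\int[area]_(p in disk a (4 * d)) W p <= (512 * pi * d ^+ 2)%:E * W a)%E.
Proof.
move=> d0 ad mW W0 superW.
have -> : 512 * pi * d ^+ 2 = 32 * pi * (4 * d) ^+ 2 :> R by ring.
apply: disk_integral_le => //; first by rewrite mulr_gt0.
(* [circle_super] speaks of positive radii only; at radius 0 the integrand is the constant W a. *)
move=> x /andP[x0 x1]; move: x0; rewrite le_eqVlt => /predU1P[<-|x0].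
  rewrite -integral_period_cst le_eqVlt; apply/orP; left; apply/eqP.
  apply: eq_integral => t _; rewrite /polar_map /= mulr0 !mul0r !addr0.
  by case: (a).
apply: (superW a (4 * d * x)); first by rewrite !mulr_gt0.
have : 4 * d * x <= 4 * d * 1 by apply: ler_wpM2l; [rewrite mulr_ge0// ltW|exact: ltW].
lra.
Qed.

Lemma disk_dist (a z : plane) (s : R) : 0 <= s -> disk a s z = (dist a z < s) :> Prop.
Proof.
move=> s0; rewrite /disk /= -[X in X < _](sqr_modulus (z.1 - a.1, z.2 - a.2)).
by rewrite ltr_pXn2r// nnegrE ?modulus_ge0.
Qed.

Definition far_set (a : plane) (d e : R) : set plane :=
  ~` disk a (4 * d) `&` [set z | 0 < potential a d e z].

Lemma measurable_far_set a d e : 0 < d <= 1 -> measurable (far_set a d e).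
Proof.
move=> d01; apply: measurableI; first by apply: measurableC; exact: measurable_disk.
rewrite (_ : [set z | _] = [set: plane] `&` (potential a d e : plane -> line) @^-1` `]0, +oo[%classic).
  by apply: measurable_potential => //; exact: measurable_itv.
by apply/seteqP; split => z; rewrite /= in_itv /= andbT; [split|case].
Qed.

Lemma potential_gt0 (a : plane) (d e : R) (z : plane) : 0 < e -> 0 < d <= 1 -> 0 < potential a d e z ->
  z.1 ^+ 2 + z.2 ^+ 2 + e * d ^+ 2 < 1 /\ potential a d e z = numer z / denom a d z - e.
Proof.
move=> e0 d01; rewrite /potential lt_max ltxx orbF => h.
split; last by rewrite max_l// ltW.
have Q0 := denom_gt0 a d01 z.
move: h; rewrite subr_gt0 ltr_pdivlMr// => h.
have : e * d ^+ 2 <= e * denom a d z by apply: ler_wpM2l; [exact: ltW|exact: denom_ge].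
by rewrite /numer in h *; move: h; set Q := denom a d z; lra.
Qed.

(** This supplies [V_mean] for the sweep. The expansion error is at most excess / 18^2. Far from [a]
    it is absorbed by half of the gain excess / (2 denom^2), because denom <= 9 and 4 * 9^2 = 18^2;
    near [a] it turns the loss 80 d / d^4 into 81 d / d^4. *)
Lemma potential_superharmonic_defect (a : plane) (d e r : R) (z : plane) : 0 < e -> 0 < d -> modulus a + 16 * d = 1 ->
  0 < r <= 1 -> 71 ^+ 2 * (r / d ^+ 8) <= excess a d / 18 ^+ 2 ->
  ((2 * pi * (potential a d e z + \1_(far_set a d e) z * (r ^+ 2 * (excess a d / 4 * ((denom a d z)^-1) ^+ 2))))%:E
   <= \int[leb]_(t in `[0%R, (2 * pi)%R]) (potential a d e (circle_point (- r) z t))%:E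
      + (2 * pi * (r ^+ 2 * (81 * d / d ^+ 4) * \1_(disk a (4 * d)) z))%:E)%E.
Proof.
move=> e0 d0 ad r01 rC; have /andP[r0 r1] := r01.
have m0 := modulus_ge0 a.
have d01 : 0 < d <= 1 by rewrite d0 /=; lra.
have a1 : a.1 ^+ 2 + a.2 ^+ 2 <= 1 by rewrite -sqr_modulus expr_le1//; lra.
have /andP[k15 k32] := excess_bounds d0 ad.
have I0 : (0 <= \int[leb]_(t in `[0%R, (2 * pi)%R]) (potential a d e (circle_point (- r) z t))%:E)%E.
  by apply: integral_ge0 => t _; rewrite lee_fin potential_ge0.
have c0 : 0 <= 81 * d / d ^+ 4 by rewrite divr_ge0 ?mulr_ge0 ?exprn_ge0// ltW.
have k20 : 0 <= r ^+ 2 * (81 * d / d ^+ 4) * \1_(disk a (4 * d)) z.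
  by rewrite mulr_ge0// mulr_ge0// sqr_ge0.
have [V0|Vz] := eqVneq (potential a d e z) 0.
  rewrite V0 add0r indicE memNset ?mul0r ?mulr0.
    by rewrite adde_ge0// lee_fin mulr_ge0// ltW.
  by move=> [_ /=]; rewrite V0 ltxx.
have {}Vz : 0 < potential a d e z by rewrite lt_def Vz potential_ge0.
have [zd VE] := potential_gt0 e0 d01 Vz.
have ed0 : 0 <= e * d ^+ 2 by rewrite mulr_ge0 ?sqr_ge0// ltW.
have z1 : z.1 ^+ 2 + z.2 ^+ 2 <= 1 by clear -zd ed0; lra.
apply: le_trans (leeD2r _ (potential_circle_mean d01 a1 e r01 z1)).
rewrite -EFinD -mulrDr lee_fin; apply: ler_wpM2l; first exact: ltW.
rewrite VE -/(excess a d).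
have -> : 71 ^+ 2 * (r ^+ 3 / d ^+ 8) = r ^+ 2 * (71 ^+ 2 * (r / d ^+ 8)) by ring.
set E := 71 ^+ 2 * (r / d ^+ 8) in rC *.
rewrite -[X in _ <= X + _]addrA -[X in _ <= X]addrA lerD2l -mulrBr.
have r20 : 0 <= r ^+ 2 by exact: sqr_ge0.
have Q0 := denom_gt0 a d01 z; have Q9 := denom_le9 d01 a1 z1.
have [zB|zB] := pselect (disk a (4 * d) z).
  rewrite indicE memNset ?mul0r; last by case.
  rewrite indicE mem_set// mulr1 -mulrDr mulr_ge0//.
  have d40 : (0 : R) <= 4 * d by rewrite mulr_ge0// ltW.
  have near := laplacian_near d0 ad z1 (ltW (eq_ind _ id zB _ (disk_dist a z d40))).
  have : excess a d / 18 ^+ 2 <= d / d ^+ 4.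
    apply: (@le_trans _ _ d); first by move: k32 d0; clear; lra.
    rewrite ler_pdivlMr ?exprn_gt0//; apply: ler_piMr; first exact: ltW.
    by apply: exprn_ile1; [exact: ltW|case/andP: d01].
  move: near rC; rewrite -!(mulrA _ d); set q := d / d ^+ 4; set L := laplacian a d z.
  clear; lra.
have farz : far_set a d e z by split.
rewrite indicE mem_set// mul1r indicE memNset// mulr0 addr0; apply: ler_wpM2l => //.
have d40 : (0 : R) <= 4 * d by rewrite mulr_ge0// ltW.
have zdist : 4 * d <= dist a z.
  by rewrite leNgt; apply/negP; rewrite -disk_dist.
have far := laplacian_far d0 ad z1 zdist.
have : excess a d / 18 ^+ 2 <= excess a d / 4 * (denom a d z)^-1 ^+ 2.
  have -> : excess a d / 18 ^+ 2 = excess a d / 4 * (9^-1) ^+ 2 by field.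
  apply: ler_wpM2l; first by rewrite divr_ge0//; move: k15 d0; clear; lra.
  by apply: lerXn2r; rewrite ?nnegrE ?invr_ge0 ?(ltW Q0)// lef_pV2 ?posrE.
move: far; rewrite (_ : excess a d / (2 * _) = excess a d / 4 * (denom a d z)^-1 ^+ 2 * 2).
  set L := laplacian a d z; set q := excess a d / 4 * _; move: rC; clear; lra.
by field; rewrite gt_eqF.
Qed.

End superharmonic_defect.

(** * The kernel estimate away from the point *)

Section far_estimate.
Context {R : realType}.
Notation line := (measurableTypeR R).
Notation plane := (measurableTypeR R * measurableTypeR R)%type.
Notation area := (@lebesgue_measure R \x @lebesgue_measure R)%E.

Definition far_weight (a : plane) (d e : R) (z : plane) : R :=
  \1_(far_set a d e) z * ((denom a d z)^-1) ^+ 2.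

Lemma far_weight_ge0 a d e z : 0 <= far_weight a d e z.
Proof. by rewrite mulr_ge0// sqr_ge0. Qed.

Lemma measurable_far_weight a d e : 0 < d <= 1 ->
  measurable_fun [set: plane] (far_weight a d e : plane -> line).
Proof.
move=> d01; apply: measurable_funM.
  by apply: measurable_indic; exact: measurable_far_set.
exact: (@measurable_funX _ plane _ _ _ 2%N (measurable_denomV a d01)).
Qed.

Lemma small_d (a : plane) (d : R) : 0 < d -> modulus a + 16 * d = 1 -> 0 < d <= 1.
Proof. by move=> d0 ad; rewrite d0 /=; have := modulus_ge0 a; lra. Qed.

Lemma sufficiently_small_radius (a : plane) (d e : R) :
  0 < d -> modulus a + 16 * d = 1 -> 0 < e -> exists r : R,
  [/\ 0 < r <= 1, 71 ^+ 2 * (r / d ^+ 8) <= excess a d / 18 ^+ 2 &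
      forall z, 0 < potential a d e z -> modulus z + r < 1].
Proof.
move=> d0 ad e0; have d01 := small_d d0 ad; have /andP[k15 _] := excess_bounds d0 ad.
have k0 : 0 < excess a d by apply: lt_le_trans k15; rewrite mulr_gt0.
have d80 : 0 < d ^+ 8 by rewrite exprn_gt0.
(* [r1] keeps circles in the disk: a positive potential forces |z|^2 < 1 - 4 r1, hence |z| < 1 - 2
   r1. [r2] is the radius at which the expansion error reaches its allowance. *)
pose r1 := e * d ^+ 2 / 4; pose r2 := excess a d / 18 ^+ 2 / 71 ^+ 2 * d ^+ 8.
have r10 : 0 < r1 by rewrite divr_gt0// mulr_gt0// exprn_gt0.
have r20 : 0 < r2.
  apply: mulr_gt0 d80; apply: divr_gt0; last exact: exprn_gt0.
  by apply: divr_gt0 => //; exact: exprn_gt0.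
exists (Num.min 1 (Num.min r1 r2)); split.
- by rewrite !lt_min ltr01 r10 r20 /= ge_min lexx.
- have : Num.min 1 (Num.min r1 r2) <= r2 by rewrite !ge_min lexx !orbT.
  move: (Num.min _ _) => r rr2.
  have : r / d ^+ 8 <= excess a d / 18 ^+ 2 / 71 ^+ 2 by rewrite ler_pdivrMr.
  set x := r / _; set y := excess _ _ / 18 ^+ 2; clear; lra.
move=> z /(potential_gt0 e0 d01)[+ _]; rewrite -sqr_modulus => h.
have : Num.min 1 (Num.min r1 r2) <= r1 by rewrite !ge_min lexx !orbT.
suff : modulus z < 1 - 2 * r1 by move: r10; set r := Num.min _ _; clear; lra.
have r1e : e * d ^+ 2 = 4 * r1 by rewrite /r1; field.
have h2 : modulus z ^+ 2 < (1 - 2 * r1) ^+ 2.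
  rewrite r1e in h; apply: (@lt_le_trans _ _ (1 - 4 * r1)); first by move: h; clear; lra.
  by rewrite -subr_ge0 (_ : _ - _ = (2 * r1) ^+ 2) ?sqr_ge0//; ring.
rewrite -(@ltr_pXn2r _ 2)// ?nnegrE ?modulus_ge0//.
have m2 : 0 <= modulus z ^+ 2 by exact: sqr_ge0.
rewrite r1e in h; move: m2 h; set m := modulus z ^+ 2; clear; lra.
Qed.

(** The sweep for the truncated weight: the gain on the far set is paid by the loss on the disk of
    radius 4 d, which [near_bound] controls. The factor r^2 cancels, and 22 rounds up 4 * 81 / 15 =
    21.6, the 15 being that of [excess_bounds]. *)
Lemma far_bound (W : plane -> \bar R) (a : plane) (d e n : R) :
  measurable_fun [set: plane] W -> (forall p, (0 <= W p)%E) -> circle_super W ->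
  0 < d -> modulus a + 16 * d = 1 -> 0 < e -> 0 <= n ->
  (\int[area]_z (mine (W z) n%:E * (far_weight a d e z)%:E)
     <= (22 * 512 * pi / d ^+ 2)%:E * W a)%E.
Proof.
move=> mW W0 superW d0 ad e0 n0; have d01 := small_d d0 ad.
have [r [r01 rC Vr]] := sufficiently_small_radius d0 ad e0.
have /andP[r0 r1] := r01.
pose Wn : plane -> \bar R := fun z => mine (W z) n%:E.
have mWn : measurable_fun [set: plane] Wn by exact: measurable_mine mW (measurable_cst _).
have Wn0 p : (0 <= Wn p)%E by rewrite le_min W0 lee_fin.
have superWn := circle_super_mine n0 mW W0 superW.
pose c1 := r ^+ 2 * (excess a d / 4); pose c2 := r ^+ 2 * (81 * d / d ^+ 4).
pose k1 z : R := \1_(far_set a d e) z * (r ^+ 2 * (excess a d / 4 * (denom a d z)^-1 ^+ 2)).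
pose k2 z : R := c2 * \1_(disk a (4 * d)) z.
have /andP[k15 _] := excess_bounds d0 ad.
have k0 : 0 < excess a d by apply: lt_le_trans k15; rewrite mulr_gt0.
have c10 : 0 < c1 by rewrite mulr_gt0 ?exprn_gt0// divr_gt0.
have c20 : 0 <= c2 by rewrite mulr_ge0 ?sqr_ge0// divr_ge0 ?mulr_ge0 ?exprn_ge0// ltW.
have k1E z : k1 z = c1 * far_weight a d e z by rewrite /k1 /c1 /far_weight; ring.
have mk1 : measurable_fun [set: plane] (k1 : plane -> line).
  rewrite (_ : k1 = fun z => c1 * far_weight a d e z); last exact/funext.
  exact: measurable_funM (measurable_cst _) (measurable_far_weight a e d01).
have mB : measurable (disk a (4 * d)) by exact: measurable_disk.
have mk2 : measurable_fun [set: plane] (k2 : plane -> line).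
  by apply: measurable_funM => //; exact: measurable_indic.
have k10 z : 0 <= k1 z by rewrite k1E mulr_ge0 ?far_weight_ge0// ltW.
have k20 z : 0 <= k2 z by rewrite mulr_ge0.
have h := @sweep R Wn (potential a d e) k1 k2 r mWn Wn0 (measurable_potential a d01 e)
  (potential_ge0 a d e) mk1 k10 mk2 k20.
have {}h : (\int[area]_z (Wn z * (k1 z)%:E) <= \int[area]_z (Wn z * (k2 z)%:E))%E.
  apply: h.
  - by move=> z /Vr; exact: superWn.
  - by move=> z; exact: potential_superharmonic_defect.
  (* The finiteness that allows the cancellation: the integrand is at most n / d^2 and vanishes off
     a square containing the disk. *)
  - have mS := measurable_closed_square (0, 0) (1 : R).
    have M0 : 0 <= n / d ^+ 2 by rewrite divr_ge0 ?sqr_ge0.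
    pose S : set plane := closed_square (0, 0) 1.
    apply: (@le_lt_trans _ _ (\int[area]_(z in S) (n / d ^+ 2)%:E)%E).
      rewrite [leRHS]integral_mkcond; apply: ge0_le_integral => //.
      + by move=> z _; rewrite mule_ge0// lee_fin potential_ge0.
      + apply: emeasurable_funM => //; apply/measurable_EFinP.
        exact: measurable_potential.
      + exact/(measurable_restrictT _ mS).
      move=> z _; rewrite patchE; have [V0|Vz] := eqVneq (potential a d e z) 0.
        by rewrite V0 mule0; case: ifPn.
      have {}Vz : 0 < potential a d e z by rewrite lt_def Vz potential_ge0.
      have [z1 VE] := potential_gt0 e0 d01 Vz.
      have ed0 : 0 <= e * d ^+ 2 by rewrite mulr_ge0 ?sqr_ge0// ltW.
      have [x1 y1] : `|z.1| <= 1 /\ `|z.2| <= 1.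
        by apply: sqr_le1; move: z1 ed0; clear; lra.
      rewrite mem_set; last by apply: closed_squareP; rewrite subr0.
      rewrite EFinM; apply: lee_pmul => //; first by rewrite lee_fin potential_ge0.
        by rewrite ge_min lexx orbT.
      rewrite lee_fin VE; apply: (@le_trans _ _ (numer z / denom a d z)).
        by rewrite gerBl ltW.
      have Q0 := denom_gt0 a d01 z.
      rewrite ler_pdivrMr// mulrC ler_pdivlMr ?exprn_gt0//.
      apply: (@le_trans _ _ (1 * d ^+ 2)); last by rewrite mul1r denom_ge.
      apply: ler_wpM2r; first exact: sqr_ge0.
      by rewrite /numer -addrA -opprD gerBl addr_ge0// sqr_ge0.
    rewrite (integral_cst area mS); apply: lte_mul_pinfty => //.
    by rewrite [X in (X < _)%E](area_closed_square (0, 0) ler01) ltry.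
have mWnB : measurable_fun (disk a (4 * d)) Wn by exact: measurable_funTS.
have kint2 : (\int[area]_z (Wn z * (k2 z)%:E) <= c2%:E * ((512 * pi * d ^+ 2)%:E * W a))%E.
  rewrite (eq_integral (fun z => c2%:E * ((Wn \_ (disk a (4 * d))) z))%E); last first.
    move=> z _; rewrite /k2 indicE patchE; case: ifPn => _.
      by rewrite mulr1 muleC.
    by rewrite mulr0 !mule0.
  rewrite ge0_integralZl//; last 2 first.
  - exact/(measurable_restrictT _ mB).
  - by move=> z _; exact: erestrict_ge0.
  rewrite -integral_mkcond; apply: lee_wpmul2l => //.
  apply: le_trans (near_bound d0 ad mW W0 superW); apply: ge0_le_integral => //.
  - exact: measurable_funTS.
  - by move=> z _; rewrite ge_min lexx.
have kint1 : (\int[area]_z (Wn z * (k1 z)%:E) =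
    c1%:E * \int[area]_z (Wn z * (far_weight a d e z)%:E))%E.
  have mWf : measurable_fun [set: plane] (fun z => Wn z * (far_weight a d e z)%:E)%E.
    by apply: emeasurable_funM => //; apply/measurable_EFinP; exact: measurable_far_weight.
  have c1e : (0 <= c1%:E)%E by rewrite lee_fin ltW.
  rewrite -ge0_integralZl//; last first.
    by move=> z _; rewrite mule_ge0// lee_fin far_weight_ge0.
  by apply: eq_integral => z _; rewrite k1E EFinM muleCA.
have := le_trans h kint2; rewrite kint1 muleA -EFinM.
rewrite -lee_pdivlMl// muleA -EFinM => /le_trans; apply.
apply: lee_wpmul2r => //; rewrite lee_fin.
have -> : c1^-1 * (c2 * (512 * pi * d ^+ 2)) = (18 ^+ 2 * 512 * pi / d ^+ 2) * (d / excess a d).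
  by rewrite /c1 /c2; field; rewrite !gt_eqF.
have p0 := @pi_gt0 R.
have -> : 22 * 512 * pi / d ^+ 2 = (18 ^+ 2 * 512 * pi / d ^+ 2) * (22 / 18 ^+ 2) :> R.
  by field; rewrite gt_eqF.
apply: ler_wpM2l.
  apply: divr_ge0; last exact: sqr_ge0.
  apply: mulr_ge0; last exact: ltW.
  by apply: mulr_ge0; [exact: sqr_ge0|exact: ler0n].
rewrite ler_pdivrMr//; have := k15; have := d0; set k := excess a d; clear; lra.
Qed.

End far_estimate.

(** * The weighted kernel estimate *)

Section weighted_estimate.
Context {R : realType}.
Notation line := (measurableTypeR R).
Notation plane := (measurableTypeR R * measurableTypeR R)%type.
Notation area := (@lebesgue_measure R \x @lebesgue_measure R)%E.

(** In units of 512 pi W(a) / d^2, the disk of radius 4 d costs 1, because the kernel is at most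
    d^-4, and the rest costs 22, by monotone convergence in the truncation level n and the cut
    1/(n+1). *)
Lemma weighted_bound (W : plane -> \bar R) (a : plane) (d : R) :
  measurable_fun [set: plane] W -> (forall p, (0 <= W p)%E) -> circle_super W ->
  0 < d -> modulus a + 16 * d = 1 ->
  (\int[area]_(z in disk (0%R, 0%R) 1%R) (W z * (((denom a d z)^-1) ^+ 2)%:E)
     <= (23 * 512 * pi / d ^+ 2)%:E * W a)%E.
Proof.
move=> mW W0 superW d0 ad; have d01 := small_d d0 ad.
pose D : set plane := disk (0, 0) 1; pose B := disk a (4 * d).
pose k z := ((denom a d z)^-1) ^+ 2.
have k0 z : 0 <= k z by exact: sqr_ge0.
have mk : measurable_fun [set: plane] (k : plane -> line).
  exact: (@measurable_funX _ plane _ _ _ 2%N (measurable_denomV a d01)).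
pose f z := (W z * (k z)%:E)%E.
have mf : measurable_fun [set: plane] f.
  by apply: emeasurable_funM => //; exact/measurable_EFinP.
have f0 z : (0 <= f z)%E by rewrite mule_ge0// lee_fin.
have mD : measurable D by exact: measurable_disk.
have mB : measurable B by exact: measurable_disk.
have mDB : measurable (D `\` B) by exact: measurableD.
have d40 : 0 < d ^+ 4 by exact: exprn_gt0.
have near : (\int[area]_(z in B) f z <= (512 * pi / d ^+ 2)%:E * W a)%E.
  apply: (@le_trans _ _ (\int[area]_(z in B) ((d ^+ 4)^-1%:E * W z))%E).
    apply: ge0_le_integral => //; try exact: measurable_funTS.
    - by apply: measurable_funeM; exact: measurable_funTS.
    move=> z _; rewrite /f muleC; apply: lee_wpmul2r => //; rewrite lee_fin /k.
    have -> : (d ^+ 4)^-1 = ((d ^+ 2)^-1) ^+ 2 by field; rewrite gt_eqF.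
    have Q0 := denom_gt0 a d01 z.
    apply: lerXn2r; rewrite ?nnegrE ?invr_ge0 ?(ltW Q0) ?sqr_ge0//.
    by rewrite lef_pV2 ?posrE ?exprn_gt0// denom_ge.
  rewrite ge0_integralZl//; [|exact: measurable_funTS|by rewrite lee_fin invr_ge0 ltW].
  apply: (@le_trans _ _ ((d ^+ 4)^-1%:E * ((512 * pi * d ^+ 2)%:E * W a))%E).
    apply: lee_wpmul2l; first by rewrite lee_fin invr_ge0 ltW.
    exact: near_bound.
  rewrite muleA -EFinM (_ : (d ^+ 4)^-1 * (512 * pi * d ^+ 2) = 512 * pi / d ^+ 2)//.
  by field; rewrite gt_eqF.
pose e n : R := n.+1%:R^-1.
pose h n z := (mine (W z) n%:R%:E * (far_weight a d (e n) z)%:E : \bar R)%E.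
have h0 n z : (0 <= h n z)%E.
  apply: mule_ge0; last by rewrite lee_fin far_weight_ge0.
  by rewrite le_min W0 lee_fin ler0n.
have mh n : measurable_fun [set: plane] (h n).
  apply: emeasurable_funM; first exact: measurable_mine mW (measurable_cst _).
  by apply/measurable_EFinP; exact: measurable_far_weight.
have hb n : (\int[area]_z h n z <= (22 * 512 * pi / d ^+ 2)%:E * W a)%E.
  by apply: far_bound => //; rewrite /e invr_gt0.
have far_mono n m z : (n <= m)%N -> far_set a d (e n) z -> far_set a d (e m) z.
  move=> nm [nB /= V0]; split=> //=; move: V0; rewrite /potential !lt_max ltxx !orbF.
  move=> /lt_le_trans; apply; rewrite lerD2l lerN2 /e lef_pV2 ?posrE// ler_nat ltnS //.
have h_mono z : {homo h ^~ z : n m / (n <= m)%N >-> (n <= m)%E}.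
  move=> n m nm; apply: lee_pmul; rewrite ?lee_fin ?far_weight_ge0//.
  - by rewrite le_min W0 lee_fin ler0n.
  - rewrite le_min !ge_min lexx /=; apply/orP; right; by rewrite lee_fin ler_nat.
  - rewrite /far_weight; apply: ler_wpM2r; first exact: sqr_ge0.
    rewrite !indicE; case: (boolP (z \in far_set a d (e n))) => // /set_mem /(far_mono n m z nm).
    by move/mem_set => ->.
(* Such a z lies in the far set for all large n; then h n z reaches f z if W z is finite, and grows
   without bound otherwise. *)
have fh z : (D `\` B) z -> (f z <= limn (h ^~ z))%E.
  move=> [Dz nBz]; have Q0 := denom_gt0 a d01 z.
  have Nz : 0 < numer z / denom a d z.
    rewrite divr_gt0//; move: Dz; rewrite /D /disk /= !subr0 expr1n /numer; lra.
  have [N1 _ HN1] := near_infty_natSinv_lt (PosNum Nz).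
  have farz n : (N1 <= n)%N -> far_set a d (e n) z.
    by move=> /HN1 /= hn; split => //=; rewrite /potential lt_max subr_gt0 hn.
  have hz n : (N1 <= n)%N -> h n z = (mine (W z) n%:R%:E * (k z)%:E)%E.
    by move=> /farz zn; rewrite /h /far_weight indicE mem_set// mul1r.
  have kz : 0 < k z by rewrite exprn_gt0// invr_gt0.
  rewrite (cvg_lim (@ereal_hausdorff R) (ereal_nondecreasing_cvgn (h_mono z))).
  rewrite /f; case Wz : (W z) => [x| |]; last by have := W0 z; rewrite Wz.
    pose n := maxn N1 (Num.truncn `|x|).+1.
    have -> : (x%:E * (k z)%:E = h n z)%E.
      rewrite hz ?leq_maxl// Wz; congr (_ * _)%E; rewrite min_l// lee_fin.
      apply: le_trans (ler_norm x) _; apply/ltW; apply: lt_le_trans (truncnS_gt _) _.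
      by rewrite ler_nat leq_maxr.
    by apply: ereal_sup_ubound; exists n.
  rewrite gt0_mulye ?lte_fin// leye_eq; apply/eqP/eqyP => A A0.
  pose n := maxn N1 (Num.truncn (A / k z)).+1.
  apply: (@le_trans _ _ (h n z)); last by apply: ereal_sup_ubound; exists n.
  rewrite hz ?leq_maxl// Wz min_r ?leey// -EFinM lee_fin -ler_pdivrMr//.
  by apply/ltW; apply: lt_le_trans (truncnS_gt _) _; rewrite ler_nat leq_maxr.
have far : (\int[area]_(z in D `\` B) f z <= (22 * 512 * pi / d ^+ 2)%:E * W a)%E.
  apply: (@le_trans _ _ (\int[area]_(z in D `\` B) limn (h ^~ z))%E).
    apply: ge0_le_integral => //.
    - exact: measurable_funTS.
    - apply: (emeasurable_fun_cvg h) => [n|z _]; first exact: measurable_funTS.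
      by apply: ereal_nondecreasing_is_cvgn; exact: h_mono.
  rewrite monotone_convergence//; last first.
    by move=> n; exact: measurable_funTS.
  apply: lime_le.
    apply: ereal_nondecreasing_is_cvgn => n m nm; apply: ge0_le_integral => //;
      try exact: measurable_funTS.
    by move=> z _; exact: h_mono.
  apply: nearW => n; apply: le_trans (hb n).
  exact: ge0_subset_integral.
apply: (@le_trans _ _ (\int[area]_(z in B `|` (D `\` B)) f z)%E).
  apply: ge0_subset_integral; [by []|exact: measurableU|exact: measurable_funTS|by move=> z _; exact: f0|].
  by move=> z Dz; have [Bz|nBz] := pselect (B z); [left|right].
rewrite ge0_integral_setU//; last 2 first.
- exact: measurable_funTS.
- by rewrite disj_set2E setDE setICA setICr setI0.
apply: le_trans (leeD near far) _.
have c0 : 0 <= 512 * pi / d ^+ 2 :> R.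
  apply: divr_ge0; last exact: sqr_ge0.
  by apply: mulr_ge0; [exact: ler0n|exact: pi_ge0].
rewrite -2!(mulrA 22) -2!(mulrA 23); move: c0; move: (512 * pi / d ^+ 2) => X X0.
have X220 : 0 <= 22 * X by apply: mulr_ge0 => //; exact: ler0n.
rewrite -ge0_muleDl ?lee_fin// -EFinD (_ : X + 22 * X = 23 * X)//.
by ring.
Qed.

End weighted_estimate.

(** * Limits of complex sequences *)

Section complex_limits.
Context {R : realType}.
Implicit Types (u v : nat -> cplx R) (z L X : cplx R).

Lemma Re_sub (x y : cplx R) : complex.Re (x - y) = complex.Re x - complex.Re y.
Proof. by case: x; case: y. Qed.

Lemma Im_sub (x y : cplx R) : complex.Im (x - y) = complex.Im x - complex.Im y.
Proof. by case: x; case: y. Qed.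

Definition half_pow (n : nat) : R := 2^-1 ^+ n.

Lemma half_pow_gt0 n : 0 < half_pow n.
Proof. by rewrite exprn_gt0// invr_gt0. Qed.

Lemma half_powS n : half_pow n = 2 * half_pow n.+1.
Proof. by rewrite /half_pow exprS mulrA divff// mul1r. Qed.

Lemma half_pow_le1 n : half_pow n <= 1.
Proof. by rewrite exprn_ile1// ?invr_ge0// invf_le1// ler1n. Qed.

Lemma sum_half_pow n : \sum_(k < n) half_pow k = 2 - 2 * half_pow n.
Proof.
elim: n => [|n IH]; first by rewrite big_ord0 /half_pow expr0 mulr1 subrr.
by rewrite big_ord_recr /= IH (half_powS n); ring.
Qed.

Lemma half_pow_small (e : R) : 0 < e -> exists N, forall n, (N <= n)%N -> half_pow n < e.
Proof.
move=> e0.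
have : half_pow n @[n --> \oo] --> (0 : R).
  by apply: cvg_expr; rewrite ger0_norm ?invr_ge0// invf_lt1// ltr1n.
move=> /cvgrPdist_lt /(_ e e0)[N _ HN]; exists N => n /HN /=.
by rewrite sub0r normrN ger0_norm// ltW// half_pow_gt0.
Qed.

Lemma real_fast_cauchy (x : nat -> R) (C : R) : 0 <= C ->
  (forall n m, (n <= m)%N -> `|x m - x n| <= C * half_pow n) ->
  exists l, forall n, `|l - x n| <= C * half_pow n.
Proof.
move=> C0 Hx.
have cx : cvgn x.
  apply/cauchy_cvgP; apply: cauchy_exP => e e0.
  have [M HM] := @half_pow_small (e / (C + 1)) (divr_gt0 e0 (ltr_wpDl C0 ltr01)).
  exists (x M); exists M => // n /= Mn; rewrite -ball_normE /ball_ /= distrC.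
  apply: le_lt_trans (Hx _ _ Mn) _.
  have := HM M (leqnn M); rewrite ltr_pdivlMr ?ltr_wpDl//.
  by have := half_pow_gt0 M; set q := half_pow M; lra.
exists (limn x) => n.
have hc : `|x m - x n| @[m --> \oo] --> `|limn x - x n|.
  by apply: cvg_norm; apply: cvgB => //; exact: cvg_cst.
rewrite -(cvg_lim (@Rhausdorff R) hc).
apply: limr_le; first by apply/cvg_ex; exists `|limn x - x n|.
by exists n => // m /= nm; exact: Hx.
Qed.

Lemma fast_cauchy u (C : R) : 0 <= C ->
  (forall n m, (n <= m)%N -> cabs (u m - u n) <= C * half_pow n) ->
  exists L, forall n, cabs (L - u n) <= 2 * C * half_pow n.
Proof.
move=> C0 Hu.
have [|l lP] := @real_fast_cauchy (fun n => complex.Re (u n)) C C0.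
  by move=> n m nm; rewrite -Re_sub; apply: le_trans (Re_le_cabs _) (Hu _ _ nm).
have [|k kP] := @real_fast_cauchy (fun n => complex.Im (u n)) C C0.
  by move=> n m nm; rewrite -Im_sub; apply: le_trans (Im_le_cabs _) (Hu _ _ nm).
exists (plane_to_cplx (l, k)) => n; apply: le_trans (cabs_le_ReIm _) _.
rewrite Re_sub Im_sub /=; have := lP n; have := kP n; lra.
Qed.

Lemma partial_sum_dist u (C : R) n m : 0 <= C -> (n <= m)%N ->
  (forall k, (n <= k)%N -> cabs (u k) <= C * half_pow k) ->
  cabs (\sum_(k < m) u k - \sum_(k < n) u k) <= 2 * C * half_pow n.
Proof.
move=> C0 nm Hu.
suff : cabs (\sum_(k < m) u k - \sum_(k < n) u k) <= 2 * C * (half_pow n - half_pow m).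
  move/le_trans; apply; apply: ler_wpM2l; first by rewrite mulr_ge0.
  by rewrite gerBl ltW// half_pow_gt0.
elim: m nm => [|m IH]; first by rewrite leqn0 => /eqP ->; rewrite !subrr mulr0 cabs0.
rewrite leq_eqVlt => /predU1P[->|]; first by rewrite !subrr mulr0 cabs0.
rewrite ltnS => nm; rewrite big_ord_recr /= addrAC.
apply: le_trans (cabs_triangle _ _) _.
have := IH nm; have := Hu m nm; rewrite (half_powS m); lra.
Qed.

Lemma series_limit u (C : R) : 0 <= C -> (forall k, cabs (u k) <= C * half_pow k) ->
  exists L, forall n, cabs (L - \sum_(k < n) u k) <= 4 * C * half_pow n.
Proof.
move=> C0 Hu.
have [||L LP] := @fast_cauchy (fun n => \sum_(k < n) u k) (2 * C).
- by rewrite mulr_ge0.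
- by move=> n m nm; apply: partial_sum_dist.
exists L => n; have := LP n; rewrite mulrA.
by rewrite -natrM.
Qed.

(** An explicit geometric rate replaces topological convergence, so that limits of complex series
    are handled by inequalities between moduli. *)
Definition fast_limit u L (C : R) := forall n, cabs (L - u n) <= C * half_pow n.

Lemma fast_limit_le u L (C : R) X (B : R) : 0 <= C -> fast_limit u L C ->
  (exists N, forall n, (N <= n)%N -> cabs (u n - X) <= B) -> cabs (L - X) <= B.
Proof.
move=> C0 uL [N HN]; apply/ler_addgt0Pr => e e0.
have [M HM] := @half_pow_small (e / (C + 1)) (divr_gt0 e0 (ltr_wpDl C0 ltr01)).
pose n := maxn N M.
apply: le_trans (cabs_distD L (u n) X) _; rewrite addrC; apply: lerD.
  exact: HN (leq_maxl _ _).
apply: le_trans (uL n) _.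
have /ltW h := HM n (leq_maxr _ _).
apply: (@le_trans _ _ ((C + 1) * half_pow n)).
  by apply: ler_wpM2r; [exact: ltW (half_pow_gt0 _)|rewrite lerDl].
by rewrite mulrC -ler_pdivlMr// ltr_wpDl.
Qed.

(** Picard iteration from the center: with factor 1/2 the n-th step is at most r 2^-n, the bound
    that [series_limit] asks for. *)
Lemma contraction_fixpoint (T : cplx R -> cplx R) (c : cplx R) (r : R) : 0 <= r ->
  (forall x, cabs (x - c) <= r -> cabs (T x - c) <= r) ->
  (forall x y, cabs (x - c) <= r -> cabs (y - c) <= r ->
     cabs (T x - T y) <= cabs (x - y) / 2) ->
  exists2 x, cabs (x - c) <= r & T x = x.
Proof.
move=> r0 TB Tlip; pose x n := iter n T c.
have xB n : cabs (x n - c) <= r.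
  by elim: n => [|n IH]; [rewrite subrr cabs0|exact: TB].
have step n : cabs (x n.+1 - x n) <= r * half_pow n.
  elim: n => [|n IH].
    by rewrite /half_pow expr0 mulr1; apply: TB; rewrite subrr cabs0.
  change (cabs (T (x n.+1) - T (x n)) <= r * half_pow n.+1).
  apply: le_trans (Tlip _ _ (xB n.+1) (xB n)) _.
  by rewrite ler_pdivrMr// -mulrA (mulrC _ 2) -half_powS.
have sumx n : \sum_(k < n) (x k.+1 - x k) = x n - c.
  elim: n => [|n IH]; first by rewrite big_ord0 subrr.
  by rewrite big_ord_recr /= IH addrC subrKA.
have [L LP] := series_limit r0 step.
have xL : fast_limit x (L + c) (4 * r).
  by move=> n; have := LP n; rewrite sumx opprB addrA.
have r4 : 0 <= 4 * r by rewrite mulr_ge0.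
have LB : cabs (L + c - c) <= r.
  by apply: fast_limit_le r4 xL _; exists 0%N => n _.
exists (L + c) => //; apply/eqP; rewrite -subr_eq0 -cabs_eq0; apply/eqP.
have xT : fast_limit (fun n => x n.+1) (L + c) (4 * r).
  move=> n; apply: le_trans (xL n.+1) _; apply: ler_wpM2l => //.
  by rewrite (half_powS n) ler_peMl// ?ler1n// ltW// half_pow_gt0.
have h : cabs (L + c - T (L + c)) <= 0.
  apply/ler_addgt0Pr => e e0.
  have r6 : 0 <= 6 * r by rewrite mulr_ge0.
  have [M HM] := @half_pow_small (e / (6 * r + 1)) (divr_gt0 e0 (ltr_wpDl r6 ltr01)).
  apply: le_trans (cabs_distD _ (x M.+1) _) _.
  have h1 := xT M; have h2 := Tlip _ _ (xB M) LB; have h3 := xL M.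
  have := HM M (leqnn M); rewrite ltr_pdivlMr ?ltr_wpDl// => hM.
  rewrite (cabs_distC (x M)) in h2; rewrite add0r.
  have p0 := half_pow_gt0 M.
  move: h1 h2 h3 hM p0; rewrite -[x M.+1]/(T (x M)); set q := half_pow M.
  lra.
by rewrite cabs_distC; apply/eqP; rewrite eq_le h cabs_ge0.
Qed.

End complex_limits.

(** * The spike functions *)

Section small_points.
Context {R : realType}.
Notation plane := (measurableTypeR R * measurableTypeR R)%type.
Variable w : cplx R -> \bar R.
Hypothesis w_superharmonic : superharmonic_on (@unit_disk R) w.
Hypothesis w_positive : forall z, unit_disk z -> (0 < w z)%E.
Hypothesis w_inf : ereal_inf (w @` @unit_disk R) = 0%E.

Lemma compact_closed_disk (r : R) : r <= 1 ->
  compact ([set p | p.1 ^+ 2 + p.2 ^+ 2 <= r] : set (R * R)).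
Proof.
move=> r1.
have cS : compact (`[-1, 1]%classic `*` `[-1, 1]%classic : set (R * R)).
  by apply: compact_setX; exact: segment_compact.
apply: subclosed_compact _ cS _.
  rewrite (_ : [set p | _] = (fun p : R * R => p.1 ^+ 2 + p.2 ^+ 2) @^-1` `]-oo, r]%classic).
    apply: closed_comp; last exact: interval_closed.
    move=> p _; apply: cvgD; apply: (@cvg_comp _ _ _ _ (fun x : R => x ^+ 2)).
    - exact: cvg_fst.
    - exact: exprn_continuous.
    - exact: cvg_snd.
    - exact: exprn_continuous.
  by apply/seteqP; split => p /=; rewrite in_itv.
move=> p /= pr.
have p12 := sqr_ge0 p.1; have p22 := sqr_ge0 p.2.
by split; rewrite /= in_itv /= -ler_norml -(@ler_pXn2r _ 2)// ?nnegrE// expr1n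
  real_normK ?num_real//; lra.
Qed.

(** Lower semicontinuity and compactness: the sets where the weight exceeds 1/(n+1) are open,
    increase with n and cover the closed disk. *)
Lemma weight_lower_bound (r : R) : r < 1 ->
  exists2 m : R, 0 < m & forall p : plane, p.1 ^+ 2 + p.2 ^+ 2 <= r -> (m%:E < disk_weight w p)%E.
Proof.
move=> r1; have /compact_near_coveringP := compact_closed_disk (ltW r1).
move=> /(_ nat \oo (fun n p => (n.+1%:R^-1%:E < disk_weight w p)%E) _) [].
  move=> p /= pr.
  have : (0 < disk_weight w p)%E.
    rewrite /disk_weight ifT; last exact: le_lt_trans r1.
    by apply: w_positive; rewrite unit_disk_plane; exact: le_lt_trans r1.
  move=> W0; have [N HN] : exists N, (N.+1%:R^-1%:E < disk_weight w p)%E.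
    move: W0; case: (disk_weight w p) => [x| |] // x0; last by exists 0%N; rewrite ltry.
    rewrite lte_fin in x0; have [N _ HN] := near_infty_natSinv_lt (PosNum x0).
    by exists N; rewrite lte_fin; exact: HN (leqnn N).
  have Ninv : (0 : R) <= N.+1%:R^-1 by rewrite invr_ge0.
  have := open_disk_weight_gt w_superharmonic Ninv.
  rewrite openE => /(_ p HN) nb.
  exists ([set q | (N.+1%:R^-1%:E < disk_weight w q)%E], [set n | (N <= n)%N]).
    by split => //=; exists N.
  move=> [q n] /= [qN Nn]; apply: le_lt_trans qN.
  by rewrite lee_fin lef_pV2 ?posrE// ler_nat ltnS.
move=> N _ /(_ N (leqnn N)) HN; exists N.+1%:R^-1; first by rewrite invr_gt0.
by move=> p pr; exact: HN.
Qed.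

(** On the closed disk of radius 1 - eta the weight exceeds some m > 0, so a point of weight below
    min(e, m) lies outside it. *)
Lemma small_weight_point (e eta : R) : 0 < e -> 0 < eta < 1 ->
  exists z, [/\ unit_disk z, (w z < e%:E)%E & 1 - eta < cabs z].
Proof.
move=> e0 /andP[eta0 eta1].
have e1 : 0 < 1 - eta by rewrite subr_gt0.
have [|m m0 Hm] := @weight_lower_bound ((1 - eta) ^+ 2).
  by rewrite exprn_ilt1 ?ltW//; lra.
have : (ereal_inf (w @` @unit_disk R) < (Num.min e m)%:E)%E.
  by rewrite w_inf lte_fin lt_min e0.
move=> /ereal_inf_lt[_ [z Dz <-]] wz; exists z; split => //.
  by apply: lt_le_trans wz _; rewrite lee_fin ge_min lexx.
rewrite ltNge; apply/negP => zeta.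
have := Hm (to_plane z); rewrite -sqr_cabs.
have -> : disk_weight w (to_plane z) = w z.
  rewrite /disk_weight to_planeK ifT// -sqr_cabs.
  by rewrite expr_lt1 ?cabs_ge0// -unit_diskE.
have zle : cabs z ^+ 2 <= (1 - eta) ^+ 2.
  by apply: lerXn2r; rewrite ?nnegrE ?cabs_ge0// ltW.
move=> /(_ zle) mw; have := lt_trans mw wz.
by rewrite lte_fin lt_min ltxx andbF.
Qed.

End small_points.

(** * The Moebius kernel and a single spike *)

Section kernel.
Context {R : realType}.
Implicit Types (a z u v h : cplx R) (A : R).

Definition kap a : R := 1 - cabs a ^+ 2.

Definition kden a z : cplx R := 1 - conjc a * z.

Definition kern a z : cplx R := cplx_of (kap a) / kden a z.

Definition dkern a z : cplx R := cplx_of (kap a) * conjc a / kden a z ^+ 2.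

Definition spike_fun a A z : cplx R := cplx_of A * (kern a z * (kern a z - 1)).

Definition dspike_fun a A z : cplx R := cplx_of A * ((2 * kern a z - 1) * dkern a z).

Lemma cabs_conj a : cabs (conjc a) = cabs a.
Proof. by case: a => x y; rewrite !cabs_def /= sqrrN. Qed.

Lemma cabs_nat n : cabs (n%:R : cplx R) = n%:R.
Proof.
have <- : cplx_of n%:R = n%:R :> cplx R by exact: (rmorph_nat (real_complex R) n).
by rewrite cabs_of normr_nat.
Qed.

Lemma kap_gt0 a : cabs a < 1 -> 0 < kap a.
Proof. by move=> a1; rewrite subr_gt0 expr_lt1// cabs_ge0. Qed.

Lemma kap_le a : cabs a < 1 -> kap a <= 2 * (1 - cabs a).
Proof. by move=> a1; have := cabs_ge0 a; rewrite /kap; nra. Qed.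

Lemma cabs_kap a : cabs a < 1 -> cabs (cplx_of (kap a)) = kap a.
Proof. by move=> a1; rewrite cabs_of gtr0_norm// kap_gt0. Qed.

(** Of the two lower bounds, this one is uniform in [a] and serves for z away from the circle;
    [kden_ge'] is uniform in [z]. *)
Lemma kden_ge a z : cabs a < 1 -> 1 - cabs z <= cabs (kden a z).
Proof.
move=> a1; have := cabs_sub 1 (conjc a * z); rewrite cabs1 cabsM cabs_conj.
apply: le_trans; rewrite lerD2l lerN2.
by apply: ler_piMl; [exact: cabs_ge0|exact: ltW].
Qed.

Lemma kden_ge' a z : cabs z < 1 -> 1 - cabs a <= cabs (kden a z).
Proof.
move=> z1; have := cabs_sub 1 (conjc a * z); rewrite cabs1 cabsM cabs_conj.
apply: le_trans; rewrite lerD2l lerN2.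
by apply: ler_piMr; [exact: cabs_ge0|exact: ltW].
Qed.

(** The identity behind the pseudo-hyperbolic distance; it links the spikes to the denominators |z -
    a|^2 + d^2 of the weighted estimate. *)
Lemma sqr_kden a z : cabs (kden a z) ^+ 2 = cabs (z - a) ^+ 2 + kap a * (1 - cabs z ^+ 2).
Proof.
rewrite /kap !sqr_cabs /kden; case: a => x y; case: z => p q /=.
ring.
Qed.

Lemma kern_le a z s : cabs a < 1 -> 0 < s -> s <= cabs (kden a z) ->
  cabs (kern a z) <= kap a / s.
Proof.
move=> a1 s0 sd; rewrite /kern cabsM cabsV cabs_kap//.
by apply: ler_wpM2l; [exact: ltW (kap_gt0 a1)|rewrite lef_pV2 ?posrE//; exact: lt_le_trans sd].
Qed.

(** kap a / (1 - |a|) = 1 + |a|. *)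
Lemma kern_le2 a z : cabs a < 1 -> cabs z < 1 -> cabs (kern a z) <= 2.
Proof.
move=> a1 z1; have s0 : 0 < 1 - cabs a by lra.
apply: le_trans (kern_le a1 s0 (kden_ge' a z1)) _.
by rewrite ler_pdivrMr// kap_le.
Qed.

Lemma kern_diff a u v : kden a u != 0 -> kden a v != 0 ->
  kern a u - kern a v = cplx_of (kap a) * conjc a * (u - v) / (kden a u * kden a v).
Proof.
move=> u0 v0; rewrite /kern.
have -> : cplx_of (kap a) * conjc a * (u - v) = cplx_of (kap a) * (kden a v - kden a u).
  by rewrite /kden; ring.
by field; rewrite u0 v0.
Qed.

Lemma kern_diff2 a z h : kden a z != 0 -> kden a (z + h) != 0 ->
  kern a (z + h) - kern a z - dkern a z * h =
  cplx_of (kap a) * conjc a ^+ 2 * h ^+ 2 / (kden a z ^+ 2 * kden a (z + h)).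
Proof.
move=> u0 v0; rewrite kern_diff// /dkern.
have -> : z + h - z = h by ring.
have -> : cplx_of (kap a) * conjc a ^+ 2 * h ^+ 2 =
   cplx_of (kap a) * conjc a * h * (kden a z - kden a (z + h)) by rewrite /kden; ring.
by field; rewrite u0 v0.
Qed.

Lemma kern_lip a u v s t : cabs a < 1 -> 0 < s -> 0 < t ->
  s <= cabs (kden a u) -> t <= cabs (kden a v) ->
  cabs (kern a u - kern a v) <= kap a / (s * t) * cabs (u - v).
Proof.
move=> a1 s0 t0 su tv.
have u0 : 0 < cabs (kden a u) by exact: lt_le_trans su.
have v0 : 0 < cabs (kden a v) by exact: lt_le_trans tv.
rewrite kern_diff -?cabs_gt0// !cabsM cabsV cabsM cabs_kap// cabs_conj mulrAC.
apply: ler_wpM2r; first exact: cabs_ge0.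
have k0 := kap_gt0 a1.
apply: ler_pM; rewrite ?mulr_ge0 ?invr_ge0 ?cabs_ge0 ?(ltW k0)//.
- by rewrite mulr_ge0// ltW.
- by apply: ler_piMr; exact: ltW.
by rewrite lef_pV2 ?posrE ?mulr_gt0//; apply: ler_pM => //; exact: ltW.
Qed.

Lemma spike_fun_diff a A u v :
  spike_fun a A u - spike_fun a A v =
  cplx_of A * ((kern a u - kern a v) * (kern a u + kern a v - 1)).
Proof. by rewrite /spike_fun; ring. Qed.

Lemma spike_fun_lip a A u v (b L : R) : 0 <= A ->
  cabs (kern a u) <= b -> cabs (kern a v) <= b ->
  cabs (kern a u - kern a v) <= L * cabs (u - v) ->
  cabs (spike_fun a A u - spike_fun a A v) <= A * (L * (2 * b + 1)) * cabs (u - v).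
Proof.
move=> A0 ub vb uv; rewrite spike_fun_diff !cabsM cabs_of ger0_norm// -!mulrA.
apply: ler_wpM2l => //; rewrite (mulrC (2 * b + 1)) mulrA.
apply: ler_pM => //; try exact: cabs_ge0.
apply: le_trans (ler_cabs_sub _ _) _; rewrite cabs1 lerD2r.
by apply: le_trans (cabs_triangle _ _) _; lra.
Qed.

Lemma spike_fun_le a A z (b : R) : 0 <= A -> cabs (kern a z) <= b ->
  cabs (spike_fun a A z) <= A * (b * (b + 1)).
Proof.
move=> A0 zb; rewrite /spike_fun 2!cabsM cabs_of ger0_norm//; apply: ler_wpM2l => //.
apply: ler_pM => //; try exact: cabs_ge0.
by apply: le_trans (ler_cabs_sub _ _) _; rewrite cabs1 lerD2r.
Qed.

Lemma dspike_fun_le a A z s : cabs a < 1 -> cabs z < 1 -> 0 <= A -> 0 < s ->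
  s <= cabs (kden a z) -> cabs (dspike_fun a A z) <= 5 * (A * kap a / s ^+ 2).
Proof.
move=> a1 z1 A0 s0 sd; rewrite /dspike_fun 2!cabsM cabs_of ger0_norm//.
have k0 := kap_gt0 a1.
have -> : 5 * (A * kap a / s ^+ 2) = A * (5 * (kap a / s ^+ 2)) by ring.
apply: ler_wpM2l => //; apply: ler_pM; try exact: cabs_ge0.
  apply: le_trans (ler_cabs_sub _ _) _; rewrite cabs1 cabsM cabs_nat.
  by have := kern_le2 a1 z1; lra.
rewrite /dkern !cabsM cabsV cabsX cabs_kap// cabs_conj.
apply: ler_pM; rewrite ?invr_ge0 ?mulr_ge0 ?exprn_ge0 ?cabs_ge0 ?(ltW k0)//.
  by apply: ler_piMr; exact: ltW.
have d0 : 0 < cabs (kden a z) by exact: lt_le_trans sd.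
by rewrite lef_pV2 ?posrE ?exprn_gt0//; apply: lerXn2r; rewrite ?nnegrE// ltW.
Qed.

(** The remainder of g^2 - g is (2 g - 1) times the remainder of g plus the squared increment of g;
    the two parts give 10 + 4. The factor [A * kap a] is kept because it is what makes the bounds
    summable over the spikes. *)
Lemma spike_fun_remainder a A z h s : cabs a < 1 -> 0 <= A -> 0 < s <= 1 ->
  s <= 1 - cabs z -> cabs h <= s / 2 ->
  cabs (spike_fun a A (z + h) - spike_fun a A z - dspike_fun a A z * h)
    <= 14 / s ^+ 4 * (A * kap a) * cabs h ^+ 2.
Proof.
move=> a1 A0 /andP[s0 s1] sz hs.
have h0 := cabs_ge0 h.
have s20 : 0 < s / 2 by rewrite divr_gt0.
have z1 : cabs z < 1 by lra.
have zh1 : cabs (z + h) <= 1 - s / 2.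
  by apply: le_trans (cabs_triangle _ _) _; lra.
have sz' : s <= cabs (kden a z) by apply: le_trans sz (kden_ge z a1).
have szh : s / 2 <= cabs (kden a (z + h)) by apply: le_trans (kden_ge (z + h) a1); lra.
have u0 : 0 < cabs (kden a z) by exact: lt_le_trans sz'.
have v0 : 0 < cabs (kden a (z + h)) by exact: lt_le_trans szh.
have k0 := kap_gt0 a1.
have k1 : kap a <= 1 by rewrite gerBl sqr_ge0.
have e1 : cabs (kern a (z + h) - kern a z) <= kap a / (s / 2 * s) * cabs h.
  by have := kern_lip a1 s20 s0 szh sz'; rewrite (_ : z + h - z = h)//; ring.
have e2 : cabs (kern a (z + h) - kern a z - dkern a z * h) <= kap a / (s ^+ 2 * (s / 2)) * cabs h ^+ 2.
  rewrite kern_diff2 -?cabs_gt0// 3!cabsM cabsV (cabsM (kden a z ^+ 2)) !cabsX cabs_kap// cabs_conj mulrAC.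
  apply: ler_wpM2r; first exact: sqr_ge0.
  apply: ler_pM; rewrite ?invr_ge0 ?mulr_ge0 ?exprn_ge0 ?cabs_ge0 ?(ltW k0)//.
    by apply: ler_piMr; [exact: ltW|apply: exprn_ile1; [exact: cabs_ge0|exact: ltW]].
  rewrite lef_pV2 ?posrE ?mulr_gt0 ?exprn_gt0//.
  apply: ler_pM; rewrite ?exprn_ge0 ?(ltW s0) ?(ltW s20)//.
  by apply: lerXn2r; rewrite ?nnegrE ?cabs_ge0 ?(ltW s0).
have -> : spike_fun a A (z + h) - spike_fun a A z - dspike_fun a A z * h =
  cplx_of A * ((2 * kern a z - 1) * (kern a (z + h) - kern a z - dkern a z * h)
     + (kern a (z + h) - kern a z) ^+ 2).
  by rewrite /spike_fun /dspike_fun; ring.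
rewrite cabsM cabs_of ger0_norm// (_ : 14 / s ^+ 4 * _ * _ = A * (14 / s ^+ 4 * kap a * cabs h ^+ 2)); last by ring.
apply: ler_wpM2l => //; apply: le_trans (cabs_triangle _ _) _; rewrite cabsM cabsX.
have c5 : cabs (2 * kern a z - 1) <= 5.
  apply: le_trans (ler_cabs_sub _ _) _; rewrite cabs1 cabsM cabs_nat.
  by have := kern_le2 a1 z1; lra.
have p1 : cabs (2 * kern a z - 1) * cabs (kern a (z + h) - kern a z - dkern a z * h)
   <= 10 / s ^+ 4 * kap a * cabs h ^+ 2.
  apply: (@le_trans _ _ (5 * (kap a / (s ^+ 2 * (s / 2)) * cabs h ^+ 2))).
    by apply: ler_pM => //; exact: cabs_ge0.
  rewrite mulrA; apply: ler_wpM2r; first exact: sqr_ge0.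
  have -> : 5 * (kap a / (s ^+ 2 * (s / 2))) = 10 / s ^+ 4 * kap a * s by field; rewrite gt_eqF.
  by apply: ler_piMr => //; rewrite mulr_ge0 ?divr_ge0 ?exprn_ge0// ltW.
have p2 : cabs (kern a (z + h) - kern a z) ^+ 2 <= 4 / s ^+ 4 * kap a * cabs h ^+ 2.
  apply: (@le_trans _ _ ((kap a / (s / 2 * s) * cabs h) ^+ 2)).
    by apply: lerXn2r; rewrite ?nnegrE ?cabs_ge0//; apply: le_trans e1; exact: cabs_ge0.
  rewrite exprMn; apply: ler_wpM2r; first exact: sqr_ge0.
  have -> : (kap a / (s / 2 * s)) ^+ 2 = 4 / s ^+ 4 * kap a * kap a by field; rewrite gt_eqF.
  by apply: ler_piMr => //; rewrite mulr_ge0 ?divr_ge0 ?exprn_ge0// ltW.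
apply: le_trans (lerD p1 p2) _; rewrite -!mulrDl.
by rewrite le_eqVlt; apply/orP; left; apply/eqP; ring.
Qed.

End kernel.

(** * The series of spikes *)

Section series.
Context {R : realType}.

Lemma derive_of_remainder (f : cplx R -> cplx R) (z D : cplx R) (C r : R) :
  0 < r -> 0 <= C ->
  (forall h, cabs h <= r -> cabs (f (z + h) - f z - D * h) <= C * cabs h ^+ 2) ->
  derivable f z 1 /\ derive1 f z = D.
Proof.
move=> r0 C0 Hf.
have lim : h^-1 *: ((f \o shift z) (h *: (1 : cplx R)) - f z) @[h --> 0^'] --> D.
  move=> A /cplx_nbhsP[e e0 eA].
  have C1 : 0 < C + 1 by rewrite ltr_wpDl.
  rewrite /nbhs /= /dnbhs /within /=; apply/cplx_nbhsP.
  exists (Num.min r (e / (C + 1))); first by rewrite lt_min r0 divr_gt0.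
  move=> h; rewrite subr0 lt_min => /andP[hr he] h0; apply: eA.
  have -> : h^-1 *: ((f \o shift z) (h *: (1 : cplx R)) - f z) - D =
      h^-1 * (f (z + h) - f z - D * h).
    rewrite /GRing.scale /= mulr1 [h + z]addrC [RHS]mulrBr; congr (_ - _).
    by rewrite mulrCA mulVf// mulr1.
  have hp : 0 < cabs h by rewrite cabs_gt0.
  rewrite cabsM cabsV mulrC ltr_pdivrMr//.
  apply: le_lt_trans (Hf h (ltW hr)) _.
  rewrite expr2 mulrA ltr_pM2r//.
  move: he; rewrite ltr_pdivlMr// mulrDr mulr1 mulrC.
  by move: hp; set x := cabs h; set y := C * x; lra.
split; first by apply/cvg_ex; exists D.
by rewrite derive1E /derive; apply: cvg_lim.
Qed.

Section sequence.
Variable zs : nat -> cplx R.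

(** With base 128 the earlier amplitudes add up to less than amp n / 127, so even with the factor 6
    of [spike_before_le] they are small against spike n. *)
Definition amp (k : nat) : R := 128 ^+ k.

Definition kaps (k : nat) : R := kap (zs k).

(** The factor 10^3 accommodates the constant 96 of [spike_after] with a tenth of [half_pow k] as
    target. The bound 1/4 keeps all points of the sequence away from 0, as the inverse chart
    requires. *)
Definition lacunary : Prop := [/\ forall k, cabs (zs k) < 1, kaps 0 <= 4^-1 &
  forall k, 10 ^+ 3 * (amp k.+1 * kaps k.+1) <= half_pow k.+1 * kaps k].

Definition spike (k : nat) (z : cplx R) : cplx R := spike_fun (zs k) (amp k) z.

Definition dspike (k : nat) (z : cplx R) : cplx R := dspike_fun (zs k) (amp k) z.

Lemma amp_ge1 k : 1 <= amp k.
Proof. by rewrite exprn_ege1// ler1n. Qed.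

Lemma amp_gt0 k : 0 < amp k.
Proof. by apply: lt_le_trans (amp_ge1 k). Qed.

Lemma amp_mono n k : (n <= k)%N -> amp n <= amp k.
Proof. by move=> nk; rewrite ler_weXn2l// ler1n. Qed.

Hypothesis lac : lacunary.

Lemma zs1 k : cabs (zs k) < 1. Proof. by have [] := lac. Qed.

Lemma kaps_gt0 k : 0 < kaps k. Proof. exact: kap_gt0 (zs1 k). Qed.

Lemma kapsS k : 10 ^+ 3 * (amp k.+1 * kaps k.+1) <= half_pow k.+1 * kaps k.
Proof. by have [] := lac. Qed.

Lemma kaps_leS k : kaps k.+1 <= kaps k.
Proof.
have h := kapsS k; have k0 := kaps_gt0 k; have k1 := kaps_gt0 k.+1.
have a1 := amp_ge1 k.+1; have p1 := half_pow_le1 (R := R) k.+1.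
have h1 : kaps k.+1 <= amp k.+1 * kaps k.+1 by rewrite ler_peMl// ltW.
have h2 : half_pow k.+1 * kaps k <= kaps k by rewrite ler_piMl// ltW.
move: h h1 h2 k0 k1; set x := amp _ * _; set y := half_pow _ * _; lra.
Qed.

Lemma kaps_mono n k : (n <= k)%N -> kaps k <= kaps n.
Proof.
move=> nk; rewrite -(subnK nk); elim: (k - n)%N => [|m IH]; first by rewrite add0n.
by rewrite addSn; exact: le_trans (kaps_leS _) IH.
Qed.

Lemma kaps_le4 k : kaps k <= 4^-1.
Proof. by apply: le_trans (kaps_mono (leq0n k)) _; have [] := lac. Qed.

Lemma kaps_lt n k : (n < k)%N -> 10 ^+ 3 * (amp k * kaps k) <= half_pow k * kaps n.
Proof.
case: k => // k; rewrite ltnS => nk; apply: le_trans (kapsS k) _.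
by apply: ler_wpM2l; [exact: ltW (half_pow_gt0 _)|exact: kaps_mono].
Qed.

(** At a fixed z both spike k and its derivative are bounded by a multiple of [amp k * kaps k], so
    this makes the two series converge geometrically. *)
Lemma amp_kaps k : amp k * kaps k <= half_pow k.
Proof.
case: k => [|k]; first by rewrite /amp /half_pow !expr0 mul1r; apply: le_trans (kaps_le4 0) _; lra.
have h := kapsS k; have k0 := kaps_gt0 k; have k4 := kaps_le4 k.
have p := half_pow_gt0 (R := R) k.+1.
have h2 : half_pow k.+1 * kaps k <= half_pow k.+1 by rewrite ler_piMr// ?ltW//; lra.
have h3 : 0 <= amp k.+1 * kaps k.+1 by rewrite mulr_ge0// ltW// ?amp_gt0// kaps_gt0.
move: h h2 h3; set x := amp _ * _; set y := half_pow _ * _; set q := half_pow _; lra.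
Qed.

Lemma spike_le k z : cabs z < 1 -> cabs (spike k z) <= 3 / (1 - cabs z) * half_pow k.
Proof.
move=> z1; have s0 : 0 < 1 - cabs z by rewrite subr_gt0.
have g1 := kern_le (zs1 k) s0 (kden_ge z (zs1 k)).
have g2 := kern_le2 (zs1 k) z1.
rewrite /spike /spike_fun 2!cabsM cabs_of (gtr0_norm (amp_gt0 k)).
have h : cabs (kern (zs k) z - 1) <= 3.
  by apply: le_trans (ler_cabs_sub _ _) _; rewrite cabs1; lra.
apply: (@le_trans _ _ (amp k * (kaps k / (1 - cabs z) * 3))).
  apply: ler_wpM2l; first exact: ltW (amp_gt0 k).
  by apply: ler_pM => //; exact: cabs_ge0.
have -> : amp k * (kaps k / (1 - cabs z) * 3) = 3 / (1 - cabs z) * (amp k * kaps k) by ring.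
by apply: ler_wpM2l; [rewrite divr_ge0// ltW|exact: amp_kaps].
Qed.

Lemma dspike_le k z : cabs z < 1 -> cabs (dspike k z) <= 5 / (1 - cabs z) ^+ 2 * half_pow k.
Proof.
move=> z1; have s0 : 0 < 1 - cabs z by rewrite subr_gt0.
apply: le_trans (dspike_fun_le (zs1 k) z1 (ltW (amp_gt0 k)) s0 (kden_ge z (zs1 k))) _.
rewrite -/(kaps k).
have -> : 5 * (amp k * kaps k / (1 - cabs z) ^+ 2) = 5 / (1 - cabs z) ^+ 2 * (amp k * kaps k) by ring.
by apply: ler_wpM2l; [rewrite divr_ge0// exprn_ge0// ltW|exact: amp_kaps].
Qed.

(** The rates are those that [series_limit] returns for the bounds [spike_le] and [dspike_le]. *)
Definition is_spike_series (f df : cplx R -> cplx R) := forall z, cabs z < 1 ->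
  fast_limit (fun n => \sum_(k < n) spike k z) (f z) (4 * (3 / (1 - cabs z))) /\
  fast_limit (fun n => \sum_(k < n) dspike k z) (df z) (4 * (5 / (1 - cabs z) ^+ 2)).

Lemma spike_series_exists : exists f df, is_spike_series f df.
Proof.
have /choice[f fP] z : exists L, cabs z < 1 ->
    fast_limit (fun n => \sum_(k < n) spike k z) L (4 * (3 / (1 - cabs z))).
  have [z1|nz1] := pselect (cabs z < 1); last by exists 0.
  have s0 : 0 <= 3 / (1 - cabs z) by rewrite divr_ge0// subr_ge0 ltW.
  have [L LP] := series_limit s0 (fun k => spike_le k z1).
  by exists L.
have /choice[df dfP] z : exists L, cabs z < 1 ->
    fast_limit (fun n => \sum_(k < n) dspike k z) L (4 * (5 / (1 - cabs z) ^+ 2)).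
  have [z1|nz1] := pselect (cabs z < 1); last by exists 0.
  have s0 : 0 <= 5 / (1 - cabs z) ^+ 2 by rewrite divr_ge0// exprn_ge0// subr_ge0 ltW.
  have [L LP] := series_limit s0 (fun k => dspike_le k z1).
  by exists L.
by exists f, df => z z1; split; [exact: fP|exact: dfP].
Qed.

Lemma fast_limitB (u v : nat -> cplx R) (L M : cplx R) (C D : R) :
  fast_limit u L C -> fast_limit v M D -> fast_limit (fun n => u n - v n) (L - M) (C + D).
Proof.
move=> uL vM n; rewrite mulrDl.
have -> : L - M - (u n - v n) = (L - u n) - (M - v n) by ring.
by apply: le_trans (ler_cabs_sub _ _) _; apply: lerD.
Qed.

Lemma fast_limitMr (u : nat -> cplx R) (L c : cplx R) (C : R) :
  fast_limit u L C -> fast_limit (fun n => u n * c) (L * c) (C * cabs c).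
Proof.
move=> uL n; rewrite -mulrBl cabsM mulrAC.
by apply: ler_wpM2r; [exact: cabs_ge0|exact: uL].
Qed.

Lemma cabs_sum (I : Type) (s : seq I) (P : pred I) (u : I -> cplx R) :
  cabs (\sum_(i <- s | P i) u i) <= \sum_(i <- s | P i) cabs (u i).
Proof.
elim/big_ind2: _ => [|x a y b xa yb|//]; first by rewrite cabs0.
by apply: le_trans (cabs_triangle _ _) _; exact: lerD.
Qed.

Lemma sum_half_pow_le2 n : \sum_(k < n) half_pow k <= 2 :> R.
Proof. by rewrite sum_half_pow gerBl mulr_ge0// ltW// half_pow_gt0. Qed.

(** The quadratic remainder bounds of the spikes are summable, and a non-strict inequality between
    moduli passes to the limit of the partial sums. *)
Lemma spike_series_derive f df z : is_spike_series f df -> cabs z < 1 ->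
  derivable f z 1 /\ derive1 f z = df z.
Proof.
move=> fdf z1; pose s := 1 - cabs z.
have s0 : 0 < s by rewrite subr_gt0.
have s1 : s <= 1 by rewrite gerBl cabs_ge0.
have c0 : 0 <= 14 / s ^+ 4 by rewrite divr_ge0// exprn_ge0// ltW.
apply: (@derive_of_remainder f z (df z) (28 / s ^+ 4) (s / 2)).
- by rewrite divr_gt0.
- by rewrite divr_ge0// exprn_ge0// ltW.
move=> h hs; have h0 := cabs_ge0 h.
have zh1 : cabs (z + h) < 1.
  by apply: le_lt_trans (cabs_triangle _ _) _; rewrite /s in s0 hs *; lra.
have [fz dfz] := fdf z z1; have [fzh _] := fdf _ zh1.
have lim := fast_limitB (fast_limitB fzh fz) (fast_limitMr h dfz).
rewrite -[X in cabs X <= _]subr0.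
apply: (fast_limit_le _ lim).
  by rewrite !addr_ge0 ?mulr_ge0 ?invr_ge0 ?exprn_ge0 ?subr_ge0 ?cabs_ge0 ?(ltW z1) ?(ltW zh1).
exists 0%N => n _; rewrite subr0 mulr_suml -!sumrB.
apply: le_trans (cabs_sum _ _ _) _.
apply: (@le_trans _ _ (\sum_(k < n) (14 / s ^+ 4 * cabs h ^+ 2) * half_pow k)).
  apply: ler_sum => k _.
  have s01 : 0 < s <= 1 by rewrite s0.
  apply: le_trans (spike_fun_remainder (zs1 k) (ltW (amp_gt0 k)) s01 (lexx _) hs) _.
  rewrite -/(kaps k) [X in _ <= X]mulrAC; apply: ler_wpM2r; first exact: sqr_ge0.
  by apply: ler_wpM2l => //; exact: amp_kaps.
rewrite -mulr_sumr (_ : 28 / s ^+ 4 * cabs h ^+ 2 = 14 / s ^+ 4 * cabs h ^+ 2 * 2); last by ring.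
by apply: ler_wpM2l; [rewrite mulr_ge0// sqr_ge0|exact: sum_half_pow_le2].
Qed.

End sequence.
End series.

(** * Surjectivity *)

Section surjectivity.
Context {R : realType}.
Variable zs : nat -> cplx R.
Hypothesis lac : lacunary zs.

Section chart.
Variables (a : cplx R).
Hypothesis a1 : cabs a < 1.
Hypothesis ka4 : kap a <= 4^-1.

(* The inverse of [kern a]: the point of the disk where it takes the value g. *)
Definition chart (g : cplx R) : cplx R := (g - cplx_of (kap a)) / (g * conjc a).

Lemma sqr_cabs_a : cabs a ^+ 2 = 1 - kap a.
Proof. by rewrite /kap; ring. Qed.

Lemma cabs_a_ge : 3 / 4 <= cabs a.
Proof.
have h := sqr_cabs_a; have a0 := cabs_ge0 a; have ka := ka4.
rewrite -(@ler_pXn2r _ 2)// ?nnegrE//; last by lra.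
Qed.

Lemma conj_neq0 : conjc a != 0.
Proof. by rewrite -cabs_gt0 cabs_conj; apply: lt_le_trans cabs_a_ge; lra. Qed.

Lemma ball1_cabs (g : cplx R) : cabs (g - 1) <= 8^-1 -> 7 / 8 <= cabs g <= 9 / 8.
Proof.
move=> g1; have := cabs_sub 1 (1 - g); have := cabs_triangle 1 (g - 1).
rewrite subKr cabs1 (cabs_distC 1) [1 + _]addrC subrK.
by move: g1; set x := cabs (g - 1); set y := cabs g => ? ? ?; apply/andP; split; lra.
Qed.

Lemma ball1_neq0 (g : cplx R) : cabs (g - 1) <= 8^-1 -> g != 0.
Proof. by move=> /ball1_cabs/andP[h _]; rewrite -cabs_gt0; apply: lt_le_trans h; lra. Qed.

Lemma kern_chart g : cabs (g - 1) <= 8^-1 -> kern a (chart g) = g.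
Proof.
move=> /ball1_neq0 g0; have c0 := conj_neq0.
have k0 : cplx_of (kap a) != 0 by rewrite -cabs_gt0 cabs_kap// kap_gt0.
rewrite /kern /kden /chart.
have -> : 1 - conjc a * ((g - cplx_of (kap a)) / (g * conjc a)) = cplx_of (kap a) / g.
  by field; rewrite g0 c0.
by rewrite invf_div mulrCA divff// mulr1.
Qed.

(** The ball of radius 1/8 about 1 is well inside the image of the kernel, the disk of center 1 and
    radius |a| >= 3/4. *)
Lemma chart_in_disk g : cabs (g - 1) <= 8^-1 -> kap a / 4 <= 1 - cabs (chart g).
Proof.
move=> g1; have /andP[g78 g98] := ball1_cabs g1.
have g0 : 0 < cabs g by apply: lt_le_trans g78; lra.
have k0 := kap_gt0 a1; have k4 := ka4; have z0 := cabs_ge0 (chart g).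
suff h : cabs (chart g) ^+ 2 <= 1 - kap a / 2.
  suff : cabs (chart g) <= 1 - kap a / 4 by lra.
  rewrite -(@ler_pXn2r _ 2)// ?nnegrE//; last by lra.
  apply: (le_trans h); rewrite -subr_ge0 (_ : _ - _ = (kap a / 4) ^+ 2) ?sqr_ge0//.
  by field.
have a34 := cabs_a_ge; have a0 : 0 < cabs a by lra.
rewrite /chart cabsM cabsV cabsM cabs_conj exprMn exprVn ler_pdivrMr ?exprn_gt0 ?mulr_gt0//.
rewrite exprMn sqr_cabs_a.
have e1 : cabs (g - cplx_of (kap a)) ^+ 2 =
    cabs g ^+ 2 - kap a * (1 + cabs g ^+ 2 - cabs (g - 1) ^+ 2) + kap a ^+ 2.
  by rewrite !sqr_cabs; case: (g) => x y; rewrite /cplx_of /=; ring.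
rewrite e1.
have m64 : cabs (g - 1) ^+ 2 <= 64^-1.
  have -> : (64 : R)^-1 = 8^-1 ^+ 2 by field.
  by apply: lerXn2r; rewrite ?nnegrE ?cabs_ge0 ?invr_ge0.
have G81 : cabs g ^+ 2 <= 81 / 64.
  have -> : (81 / 64 : R) = (9 / 8) ^+ 2 by field.
  by apply: lerXn2r; rewrite ?nnegrE ?cabs_ge0 ?divr_ge0.
move: m64 G81 k0 k4; set m := cabs (g - 1) ^+ 2; set G := cabs g ^+ 2; set k := kap a.
move=> m64 G81 k0 k4.
have G0 : 0 <= G by exact: sqr_ge0.
have h1 : (1 - k) * G <= 81 / 64.
  by apply: le_trans G81; rewrite ler_piMl//; lra.
(* The subtracted terms are at most 1/64, 81/128 and 1/4, with sum 115/128. *)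
rewrite -subr_ge0 (_ : _ - _ = k * (1 - m - ((1 - k) * G / 2 + k))); last by field.
by apply: mulr_ge0; lra.
Qed.

(** The chart contracts by [kap a], the size of the region near [a] that it parametrizes; 2
    dominates 1 / ((7/8)^2 (3/4)). *)
Lemma chart_lip g h : cabs (g - 1) <= 8^-1 -> cabs (h - 1) <= 8^-1 ->
  cabs (chart g - chart h) <= 2 * kap a * cabs (g - h).
Proof.
move=> g1 h1; have g0 := ball1_neq0 g1; have h0 := ball1_neq0 h1.
have c0 := conj_neq0; have k0 := kap_gt0 a1.
have -> : chart g - chart h = cplx_of (kap a) * (g - h) / (g * h * conjc a).
  by rewrite /chart; field; rewrite g0 h0 c0.
rewrite 2!cabsM cabsV 2!cabsM cabs_conj cabs_kap//.
have /andP[g78 _] := ball1_cabs g1; have /andP[h78 _] := ball1_cabs h1.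
have a34 := cabs_a_ge.
have p : 2^-1 <= cabs g * cabs h * cabs a.
  apply: (@le_trans _ _ ((7 / 8) * (7 / 8) * (3 / 4))); first lra.
  apply: ler_pM; [lra|lra| |exact: a34].
  by apply: ler_pM; [lra|lra|exact: g78|exact: h78].
have p0 : 0 < cabs g * cabs h * cabs a by apply: lt_le_trans p; rewrite invr_gt0.
rewrite ler_pdivrMr//.
have q0 : 0 <= kap a * cabs (g - h) by rewrite mulr_ge0 ?cabs_ge0// ltW.
have -> : 2 * kap a * cabs (g - h) * (cabs g * cabs h * cabs a) =
  (kap a * cabs (g - h)) * (2 * (cabs g * cabs h * cabs a)) by ring.
by apply: ler_peMr => //; move: p; set x := _ * cabs a; lra.
Qed.

End chart.

(** * Solving f = c in the chart of one spike *)

Section other_spikes.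
Variable n : nat.
Let a := zs n.
Let ka4 : kap a <= 4^-1 := kaps_le4 lac n.
Let a1 : cabs a < 1 := zs1 lac n.
Let chart_lt1 g : cabs (g - 1) <= 8^-1 -> cabs (chart a g) < 1.
Proof.
by move=> g1; have := chart_in_disk a1 ka4 g1; have := kap_gt0 a1; lra.
Qed.

Lemma spike_before_le k g : cabs (g - 1) <= 8^-1 ->
  cabs (spike zs k (chart a g)) <= 6 * amp k.
Proof.
move=> g1; have := spike_fun_le (ltW (amp_gt0 (R := R) k)) (kern_le2 (zs1 lac k) (chart_lt1 g1)).
by rewrite -/(spike zs k _) mulrC (_ : 2 * (2 + 1) = 6)//; ring.
Qed.

(** An earlier spike varies at the scale [kaps k], while the chart moves points only at the much
    smaller scale [kaps n]. *)
Lemma spike_before_lip k g h : (k < n)%N -> cabs (g - 1) <= 8^-1 -> cabs (h - 1) <= 8^-1 ->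
  cabs (spike zs k (chart a g) - spike zs k (chart a h)) <= half_pow k / 10 * cabs (g - h).
Proof.
move=> kn g1 h1; have zk := zs1 lac k; have k0 := kaps_gt0 lac k.
have d0 : 0 < 1 - cabs (zs k) by rewrite subr_gt0.
have dk : kaps zs k / 2 <= 1 - cabs (zs k) by have := kap_le zk; rewrite /kaps; lra.
have k20 : 0 < kaps zs k / 2 by rewrite divr_gt0.
have sg := le_trans dk (kden_ge' (zs k) (chart_lt1 g1)).
have sh := le_trans dk (kden_ge' (zs k) (chart_lt1 h1)).
have := kern_lip zk k20 k20 sg sh.
rewrite -/(kaps zs k) (_ : kaps zs k / (kaps zs k / 2 * (kaps zs k / 2)) = 4 / kaps zs k); last first.
  by field; rewrite gt_eqF.
move=> hl; have A0 := amp_gt0 (R := R) k.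
apply: le_trans (spike_fun_lip (ltW A0) (kern_le2 zk (chart_lt1 g1)) (kern_le2 zk (chart_lt1 h1)) hl) _.
have c0 : 0 <= amp k * (4 / kaps zs k * (2 * 2 + 1)) by rewrite !mulr_ge0 ?invr_ge0 ?(ltW A0) ?(ltW k0)//; lra.
apply: le_trans (ler_wpM2l c0 (chart_lip a1 ka4 g1 h1)) _.
rewrite mulrA; apply: ler_wpM2r; first exact: cabs_ge0.
rewrite -/(kaps zs n).
have -> : amp k * (4 / kaps zs k * (2 * 2 + 1)) * (2 * kaps zs n) = 40 * (amp k * kaps zs n) / kaps zs k.
  by field; rewrite gt_eqF.
rewrite ler_pdivrMr//.
have h2 := kaps_lt lac kn; have kn0 := kaps_gt0 lac n.
have h3 : amp k * kaps zs n <= amp n * kaps zs n.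
  by apply: ler_wpM2r; [exact: ltW|exact: amp_mono (ltnW kn)].
have h4 : half_pow n * kaps zs k <= half_pow k * kaps zs k.
  apply: ler_wpM2r; first exact: ltW.
  by apply: ler_wiXn2l; rewrite ?invr_ge0 ?invf_le1 ?ler1n ?(ltnW kn).
rewrite mulrAC; have h5 : 0 <= amp n * kaps zs n by rewrite mulr_ge0// ltW// amp_gt0.
move: h2 h3 h4 h5; set x := amp k * _; set y := amp n * _; set u := half_pow n * _; set v := half_pow k * _.
lra.
Qed.

(** Chart points keep distance kaps n / 4 from the circle, so the kernel of a later spike is at most
    4 kaps k / kaps n there. With q = amp k kaps k / kaps n the value and the slope are at most 8 q
    and 96 q, and lacunarity gives 10^3 q <= half_pow k. *)
Lemma spike_after k g h : (n < k)%N -> cabs (g - 1) <= 8^-1 -> cabs (h - 1) <= 8^-1 ->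
  cabs (spike zs k (chart a g)) <= half_pow k /\
  cabs (spike zs k (chart a g) - spike zs k (chart a h)) <= half_pow k / 10 * cabs (g - h).
Proof.
move=> nk g1 h1; have zk := zs1 lac k; have k0 := kaps_gt0 lac k; have kn0 := kaps_gt0 lac n.
have A1 := amp_ge1 (R := R) k; have A0 := amp_gt0 (R := R) k.
have s0 : 0 < kaps zs n / 4 by rewrite divr_gt0.
have sg := le_trans (chart_in_disk a1 ka4 g1) (kden_ge (chart a g) zk).
have sh := le_trans (chart_in_disk a1 ka4 h1) (kden_ge (chart a h) zk).
rewrite -/(kaps zs n) in sg sh.
have hk := kaps_lt lac nk.
have p0 := half_pow_gt0 (R := R) k; have p1 := half_pow_le1 (R := R) k.
pose q := amp k * kaps zs k / kaps zs n.
have q0 : 0 <= q by rewrite divr_ge0 ?mulr_ge0// ltW.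
have qle : 10 ^+ 3 * q <= half_pow k by rewrite /q mulrA ler_pdivrMr.
pose b := 4 * (kaps zs k / kaps zs n).
have b0 : 0 <= b by rewrite mulr_ge0// divr_ge0// ltW.
have bq : b <= 4 * q.
  rewrite /b /q; apply: ler_wpM2l => //; apply: ler_wpM2r; first by rewrite invr_ge0 ltW.
  by apply: ler_peMl => //; exact: ltW.
have b1 : b <= 1 by lra.
have bE : kap (zs k) / (kaps zs n / 4) = b by rewrite /b /kaps; field; rewrite gt_eqF.
have hg := kern_le zk s0 sg; have hh := kern_le zk s0 sh; rewrite bE in hg hh.
split.
  apply: le_trans (spike_fun_le (ltW A0) hg) _.
  apply: (@le_trans _ _ (amp k * (b * 2))).
    by apply: ler_wpM2l; [exact: ltW|apply: ler_wpM2l => //; lra].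
  have -> : amp k * (b * 2) = 8 * q by rewrite /b /q; field; rewrite gt_eqF.
  by lra.
have := kern_lip zk s0 s0 sg sh.
have -> : kap (zs k) / (kaps zs n / 4 * (kaps zs n / 4)) = 16 * kaps zs k / kaps zs n ^+ 2.
  by rewrite /kaps; field; rewrite gt_eqF.
move=> hl.
apply: le_trans (spike_fun_lip (ltW A0) (le_trans hg b1) (le_trans hh b1) hl) _.
have c0 : 0 <= amp k * (16 * kaps zs k / kaps zs n ^+ 2 * (2 * 1 + 1)).
  by rewrite !mulr_ge0 ?invr_ge0 ?exprn_ge0 ?(ltW A0) ?(ltW k0) ?(ltW kn0)//; lra.
apply: le_trans (ler_wpM2l c0 (chart_lip a1 ka4 g1 h1)) _.
rewrite (mulrA _ (2 * _)); apply: ler_wpM2r; first exact: cabs_ge0.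
rewrite -/(kaps zs n).
have -> : amp k * (16 * kaps zs k / kaps zs n ^+ 2 * (2 * 1 + 1)) * (2 * kaps zs n) = 96 * q.
  by rewrite /q; field; rewrite gt_eqF.
by lra.
Qed.

Lemma sum_amp m : \sum_(k < m) amp k <= amp m / 127 :> R.
Proof.
suff -> : \sum_(k < m) amp k = (amp m - 1) / 127 :> R by lra.
elim: m => [|m IH]; first by rewrite big_ord0 /amp expr0; lra.
by rewrite big_ord_recr /= IH /amp exprS; lra.
Qed.

Lemma sum_ord_cond (m : nat) (u : nat -> R) : (forall k, 0 <= u k) ->
  \sum_(k < m | (k < n)%N) u k <= \sum_(k < n) u k.
Proof.
move=> u0; rewrite (big_ord_widen_cond (maxn m n) xpredT u (leq_maxr m n)) /=.
rewrite (big_ord_widen_cond (maxn m n) (fun k => (k < n)%N) u (leq_maxl m n)).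
rewrite (bigID (fun k : 'I__ => (k < m)%N) (fun k => (k < n)%N))/= lerDl.
by apply: sumr_ge0.
Qed.

Variables f df : cplx R -> cplx R.
Hypothesis fdf : is_spike_series zs f df.

(** The part of the series treated as a perturbation of spike n. *)
Definition chart_error (g : cplx R) := f (chart a g) - spike zs n (chart a g).

Lemma partial_error m z : (n < m)%N ->
  \sum_(k < m) spike zs k z - spike zs n z = \sum_(k < m | k != n :> nat) spike zs k z.
Proof.
move=> nm; rewrite (bigD1 (Ordinal nm))//= addrAC subrr add0r.
by apply: eq_bigl => k.
Qed.

Let C0 g : cabs (g - 1) <= 8^-1 -> 0 <= 4 * (3 / (1 - cabs (chart a g))).
Proof. by move=> /chart_lt1 h; rewrite mulr_ge0// divr_ge0// subr_ge0 ltW. Qed.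

(** Earlier spikes contribute at most 6 times the sum of their amplitudes, later ones at most the
    sum of [half_pow], which is 2. *)
Lemma chart_error_le g : cabs (g - 1) <= 8^-1 -> cabs (chart_error g) <= 6 / 127 * amp n + 2.
Proof.
move=> g1; have [fg _] := fdf (chart_lt1 g1).
apply: (fast_limit_le (C0 g1) fg); exists n.+1 => m nm; rewrite partial_error//.
apply: le_trans (cabs_sum _ _ _) _.
apply: (@le_trans _ _ (\sum_(k < m | (k < n)%N) 6 * amp k + \sum_(k < m) half_pow k)).
  rewrite big_mkcond /= [X in _ <= X + _]big_mkcond -big_split /=.
  apply: ler_sum => k _; have p0 := ltW (half_pow_gt0 (R := R) k).
  case: ltngtP => [kn|nk|_] /=; last by rewrite add0r.
    by rewrite -[leLHS]addr0; apply: lerD => //; exact: spike_before_le.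
  by rewrite add0r; have [] := spike_after nk g1 g1.
apply: lerD (sum_half_pow_le2 _).
have A0 k : 0 <= 6 * amp k :> R by rewrite mulr_ge0// ltW// amp_gt0.
apply: le_trans (sum_ord_cond m A0) _.
by rewrite -mulr_sumr; have := sum_amp n; set x := \sum_(_ < _) _; lra.
Qed.

Lemma chart_error_lip g h : cabs (g - 1) <= 8^-1 -> cabs (h - 1) <= 8^-1 ->
  cabs (chart_error g - chart_error h) <= 5^-1 * cabs (g - h).
Proof.
move=> g1 h1; have [fg _] := fdf (chart_lt1 g1); have [fh _] := fdf (chart_lt1 h1).
have -> : chart_error g - chart_error h = f (chart a g) - f (chart a h) -
  (spike zs n (chart a g) - spike zs n (chart a h)) by rewrite /chart_error; ring.
apply: (fast_limit_le (addr_ge0 (C0 g1) (C0 h1)) (fast_limitB fg fh)).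
exists n.+1 => m nm.
rewrite [X in cabs X](_ : _ = \sum_(k < m | k != n :> nat) (spike zs k (chart a g) - spike zs k (chart a h))); last first.
  by rewrite sumrB -!partial_error//; ring.
apply: le_trans (cabs_sum _ _ _) _.
apply: (@le_trans _ _ (\sum_(k < m) half_pow k / 10 * cabs (g - h))).
  rewrite big_mkcond /=; apply: ler_sum => k _; have p0 := half_pow_gt0 (R := R) k.
  case: ltngtP => [kn|nk|_] /=; first exact: spike_before_lip.
    by have [] := spike_after nk g1 h1.
  by rewrite mulr_ge0 ?cabs_ge0// divr_ge0// ltW.
rewrite -mulr_suml -mulr_suml; apply: ler_wpM2r; first exact: cabs_ge0.
by have := sum_half_pow_le2 (R := R) m; set x := \sum_(_ < _) _; lra.
Qed.

(** In the chart the equation reads A g (g - 1) + error(g) = c, solved as the fixed point g = 1 + (c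
    - error(g)) / (A g) in the ball of radius 1/8 about 1. A large A makes the map a contraction. *)
Lemma spike_series_hits c : 100 * (cabs c + 2) <= amp n -> exists2 z, cabs z < 1 & f z = c.
Proof.
move=> cA; have A0 := amp_gt0 (R := R) n; have c0 := cabs_ge0 c.
have Az : cplx_of (amp n) != 0 :> cplx R by rewrite -cabs_gt0 cabs_of gtr0_norm.
(* Relative to [amp n], c and the constant 2 cost 1/100 and the earlier spikes 6/127, together below
   3/50; and 3/50 <= (1/8) (7/8) keeps the iteration in the ball. *)
have num g : cabs (g - 1) <= 8^-1 -> cabs (c - chart_error g) <= amp n * (3 / 50).
  move=> g1; apply: le_trans (ler_cabs_sub _ _) _; have := chart_error_le g1.
  by move: cA; set x := cabs c; set y := amp n; lra.
pose T g := 1 + (c - chart_error g) / (cplx_of (amp n) * g).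
have cabsA : cabs (cplx_of (amp n)) = amp n :> R by rewrite cabs_of gtr0_norm.
have [|||g g1 Tg] := @contraction_fixpoint R T 1 8^-1.
- by rewrite invr_ge0.
- move=> g g1; have /andP[g78 _] := ball1_cabs g1.
  rewrite /T addrAC subrr add0r cabsM cabsV cabsM cabsA.
  rewrite ler_pdivrMr; last by rewrite mulr_gt0//; lra.
  apply: le_trans (num _ g1) _.
  rewrite [leRHS]mulrCA; apply: ler_wpM2l; [exact: ltW|lra].
- move=> g h g1 h1; have /andP[g78 g98] := ball1_cabs g1; have /andP[h78 h98] := ball1_cabs h1.
  have g0 := ball1_neq0 g1; have h0 := ball1_neq0 h1.
  have -> : T g - T h = ((c - chart_error g) * (h - g) - (chart_error g - chart_error h) * g) /
      (cplx_of (amp n) * (g * h)).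
    by rewrite /T; field; rewrite Az g0 h0.
  rewrite cabsM cabsV cabsM cabsM cabsA ler_pdivrMr; last by rewrite !mulr_gt0//; lra.
  apply: le_trans (ler_cabs_sub _ _) _; rewrite 2!cabsM (cabs_distC h g).
  have d0 := cabs_ge0 (g - h).
  apply: (@le_trans _ _ (amp n * (3 / 50) * cabs (g - h) + 5^-1 * cabs (g - h) * (9 / 8))).
    apply: lerD; first by apply: ler_wpM2r => //; exact: num.
    by apply: ler_pM => //; rewrite ?cabs_ge0//; exact: chart_error_lip.
  have -> : cabs (g - h) / 2 * (amp n * (cabs g * cabs h)) =
    cabs (g - h) * (amp n * (cabs g * cabs h / 2)) by field.
  have -> : amp n * (3 / 50) * cabs (g - h) + 5^-1 * cabs (g - h) * (9 / 8) =
    cabs (g - h) * (amp n * (3 / 50) + 5^-1 * (9 / 8)) by ring.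
  have gh : 49 / 64 <= cabs g * cabs h.
    by rewrite (_ : 49 / 64 = (7 / 8) * (7 / 8)); [apply: ler_pM; lra|field].
  apply: ler_wpM2l => //.
  apply: (@le_trans _ _ (amp n * (49 / 64 / 2))); first by lra.
  by apply: ler_wpM2l; [exact: ltW|lra].
exists (chart a g); first exact: chart_lt1.
have g0 := ball1_neq0 g1.
have sp : spike zs n (chart a g) = c - chart_error g.
  rewrite /spike /spike_fun (kern_chart a1)//.
  rewrite -{2}Tg /T addrAC subrr add0r; field; by rewrite Az g0.
by rewrite -[LHS](subrK (spike zs n (chart a g))) -/(chart_error g) sp addrC subrK.
Qed.

End other_spikes.

Lemma spike_series_surjective f df c : is_spike_series zs f df -> exists2 z, cabs z < 1 & f z = c.
Proof.
move=> fdf; have h : 0 <= 100 * (cabs c + 2) by rewrite mulr_ge0// addr_ge0// cabs_ge0.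
pose n := (Num.truncn (100 * (cabs c + 2))).+1.
apply: (spike_series_hits (n := n) fdf).
apply: (@le_trans _ _ n%:R); first exact: ltW (truncnS_gt _).
rewrite /amp -natrX ler_nat ltnW//; exact: ltn_expl.
Qed.

End surjectivity.

(** The integral of a nonnegative function is a supremum over simple functions below it, hence
    monotone without measurability. This is applied to |f'|^2 w, whose measurability is not
    established. *)
Lemma ge0_le_integral_nonmeasurable d (T : measurableType d) (R : realType)
    (mu : {measure set T -> \bar R}) (D : set T) (f g : T -> \bar R) :
  (forall x, D x -> (0 <= f x)%E) -> (forall x, D x -> (f x <= g x)%E) ->
  (\int[mu]_(x in D) f x <= \int[mu]_(x in D) g x)%E.
Proof.
move=> f0 fg; rewrite !ge0_integralE//; last first.
  by move=> x Dx; exact: le_trans (f0 x Dx) (fg x Dx).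
apply: le_ereal_sup => _ [h hf <-]; exists h => // x.
apply: le_trans (hf x) _; rewrite /patch; case: ifPn => // /set_mem; exact: fg.
Qed.

(** Cauchy-Schwarz with weights 2^-(k+1), whose sum is below 1; the induction rests on (x + s)^2 <=
    2 x^2 + 2 s^2. *)
Lemma sqr_sum_le (R : realType) n (x : nat -> R) :
  (\sum_(k < n) x k) ^+ 2 <= \sum_(k < n) 2 ^+ k.+1 * x k ^+ 2.
Proof.
elim: n x => [|n IH] x; first by rewrite !big_ord0 expr0n.
rewrite !big_ord_recl /= expr1.
have := IH (fun k => x k.+1); set s := \sum_(_ < n) _; set t := \sum_(_ < n) _ => st.
set t' := \sum_(_ < n) _; have -> : t' = 2 * t.
  by rewrite /t' /t mulr_sumr; apply: eq_bigr => i _; rewrite (exprS _ i.+1) mulrA.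
have -> : s = \sum_(i < n) x (lift ord0 i) by [].
rewrite -/s; have := sqr_ge0 (x 0%N - s); nra.
Qed.

(** * Finite weighted integral *)

Section membership.
Context {R : realType}.
Notation plane := (measurableTypeR R * measurableTypeR R)%type.
Notation area := (@lebesgue_measure R \x @lebesgue_measure R)%E.
Variable w : cplx R -> \bar R.
Hypothesis w_superharmonic : superharmonic_on (@unit_disk R) w.
Hypothesis w_positive : forall z, unit_disk z -> (0 < w z)%E.

Lemma spike_points : ereal_inf (w @` @unit_disk R) = 0%E ->
  exists2 zs, lacunary zs & forall k, (w (zs k) <= (half_pow k ^+ 2 / amp k ^+ 2)%:E)%E.
Proof.
move=> w_inf.
(* The condition 0 < b stands under the existential so that choice yields a function of every real
   b, and the recursion defining [zs] can run before its bounds are known to be positive. *)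
have ex k b : exists z, 0 < b ->
    [/\ cabs z < 1, (w z <= (half_pow k ^+ 2 / amp k ^+ 2)%:E)%E & kap z <= b].
  have [b0|] := ltP 0 b; last by exists 0.
  pose eta := Num.min (b / 2) 2^-1.
  have e0 : 0 < half_pow k ^+ 2 / amp k ^+ 2 :> R.
    by rewrite divr_gt0// exprn_gt0// ?half_pow_gt0 ?amp_gt0.
  have [|z [Dz wz zeta]] := @small_weight_point R w w_superharmonic w_positive w_inf _ eta e0.
    have h : 2^-1 < 1 :> R by lra.
    by rewrite lt_min gt_min h orbT andbT; apply/andP; split; lra.
  exists z => _; split; [by rewrite -unit_diskE|exact: ltW|].
  have z1 : cabs z < 1 by rewrite -unit_diskE.
  have eb : eta <= b / 2 by rewrite ge_min lexx.
  by have := kap_le z1; lra.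
have /choice[F FP] k : exists g : R -> cplx R, forall b, 0 < b ->
    [/\ cabs (g b) < 1, (w (g b) <= (half_pow k ^+ 2 / amp k ^+ 2)%:E)%E & kap (g b) <= b].
  by have [g gP] := choice (ex k); exists g.
pose zs := fix zs k := match k with
  | 0 => F 0%N 4^-1
  | k'.+1 => F k'.+1 (half_pow k'.+1 * kap (zs k') / (10 ^+ 3 * amp k'.+1)) end.
have A0 k : 0 < 10 ^+ 3 * amp k :> R by rewrite mulr_gt0 ?exprn_gt0 ?amp_gt0.
have zsP k : 0 < half_pow k.+1 * kap (zs k) / (10 ^+ 3 * amp k.+1).
  have z1 : cabs (zs k) < 1.
    elim: k => [|k IH]; first by have [] := FP 0%N 4^-1 ltac:(rewrite invr_gt0//).
    by have [] := FP k.+1 _ (divr_gt0 (mulr_gt0 (half_pow_gt0 k.+1) (kap_gt0 IH)) (A0 k.+1)).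
  by rewrite divr_gt0// mulr_gt0 ?half_pow_gt0 ?kap_gt0.
have z0 : 0 < 4^-1 :> R by rewrite invr_gt0.
exists zs; last by case=> [|k]; [have [] := FP 0%N _ z0|have [] := FP k.+1 _ (zsP k)].
split; first by case=> [|k]; [have [] := FP 0%N _ z0|have [] := FP k.+1 _ (zsP k)].
  by have [] := FP 0%N _ z0.
move=> k; have [_ _] := FP k.+1 _ (zsP k).
by rewrite ler_pdivlMr// mulrC mulrA.
Qed.

Variable zs : nat -> cplx R.
Hypothesis lac : lacunary zs.

Let scale k : R := (1 - cabs (zs k)) / 16.
Let scale_gt0 k : 0 < scale k.
Proof. by rewrite divr_gt0// subr_gt0 zs1. Qed.
Let scaleP k : modulus (to_plane (zs k)) + 16 * scale k = 1.
Proof. by rewrite /modulus to_planeK /scale; field. Qed.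
Let quot k (p : plane) : R := (denom (to_plane (zs k)) (scale k) p)^-1.

(** The squared denominator of the kernel dominates both |z - a|^2, by [sqr_kden], and
    [scale k ^+ 2], hence half of [denom]; this doubles the 5 of [dspike_fun_le]. *)
Lemma dspike_quot k p : cabs (plane_to_cplx p) < 1 ->
  cabs (dspike zs k (plane_to_cplx p)) <= 10 * (amp k * kaps zs k) * quot k p.
Proof.
move=> p1; have s0 := scale_gt0 k; have z1 := zs1 lac k.
set z := plane_to_cplx p in p1 *.
have h1 := kden_ge' (zs k) p1; have h2 := sqr_kden (zs k) z.
have k0 := kaps_gt0 lac k.
have d0 : 0 < 1 - cabs (zs k) by rewrite subr_gt0.
have q0 : 0 < cabs (kden (zs k) z) by exact: lt_le_trans h1.
have h3 : cabs (z - zs k) ^+ 2 <= cabs (kden (zs k) z) ^+ 2.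
  rewrite h2 lerDl mulr_ge0 ?(ltW k0)// subr_ge0.
  by rewrite expr_le1 ?cabs_ge0// ltW.
have h4 : scale k ^+ 2 <= cabs (kden (zs k) z) ^+ 2.
  apply: lerXn2r; rewrite ?nnegrE ?(ltW s0) ?cabs_ge0//.
  by apply: le_trans h1; rewrite /scale; lra.
have h5 : denom (to_plane (zs k)) (scale k) p <= 2 * cabs (kden (zs k) z) ^+ 2.
  suff -> : denom (to_plane (zs k)) (scale k) p = cabs (z - zs k) ^+ 2 + scale k ^+ 2 by lra.
  by rewrite denomE /dist sqr_modulus sqr_cabs /z /=; case: (zs k).
have h6 : 0 < denom (to_plane (zs k)) (scale k) p.
  rewrite denomE; apply: ltr_wpDl; [exact: sqr_ge0|exact: exprn_gt0].
apply: le_trans (dspike_fun_le z1 p1 (ltW (amp_gt0 k)) q0 (lexx _)) _.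
rewrite -/(kaps zs k).
have -> : 10 * (amp k * kaps zs k) * quot k p = 5 * (amp k * kaps zs k * (2 * quot k p)) by ring.
apply: ler_wpM2l => //; apply: ler_wpM2l; first by rewrite mulr_ge0 ?ltW ?amp_gt0.
rewrite /quot -[2]invrK -invfM lef_pV2 ?posrE ?exprn_gt0 ?mulr_gt0 ?invr_gt0//.
by rewrite mulrC ler_pdivrMr// mulrC.
Qed.

Hypothesis zs_weight : forall k, (w (zs k) <= (half_pow k ^+ 2 / amp k ^+ 2)%:E)%E.

Let W := disk_weight w.
Let D : set plane := disk (0, 0) 1.
(** The power of 2 is the weight of [sqr_sum_le], the rest is the squared constant of
    [dspike_quot]. *)
Let coef k : R := 2 ^+ k.+1 * (10 * (amp k * kaps zs k)) ^+ 2.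
Let U k p := ((coef k)%:E * (W p * (quot k p ^+ 2)%:E))%E.

Let coef_gt0 k : 0 < coef k.
Proof.
by rewrite mulr_gt0 ?exprn_gt0// !mulr_gt0 ?amp_gt0 ?kaps_gt0.
Qed.

Let scale_le1 k : 0 < scale k <= 1.
Proof. by rewrite scale_gt0/= /scale; have := cabs_ge0 (zs k); lra. Qed.

Let quot_gt0 k p : 0 < quot k p.
Proof. by rewrite invr_gt0 denom_gt0. Qed.

Let term_ge0 k p : (0 <= W p * (quot k p ^+ 2)%:E)%E.
Proof. by rewrite mule_ge0 ?lee_fin ?sqr_ge0// disk_weight_ge0. Qed.

Let U_ge0 k p : (0 <= U k p)%E.
Proof. by rewrite mule_ge0// lee_fin ltW. Qed.

Let measurable_term k : measurable_fun [set: plane] (fun p => W p * (quot k p ^+ 2)%:E)%E.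
Proof.
apply: emeasurable_funM; first exact: measurable_disk_weight.
by apply/measurable_EFinP; exact: (@measurable_funX _ plane _ _ _ 2%N (measurable_denomV _ (scale_le1 k))).
Qed.

Let K : R := 200 * (32 ^+ 2 * (23 * 512 * pi)).
Let bound_ge0 : 0 <= 23 * 512 * pi :> R.
Proof. by apply: mulr_ge0; [exact: mulr_ge0 (ler0n _ _) (ler0n _ _)|exact: pi_ge0]. Qed.
Let K_ge0 : 0 <= K.
Proof.
by apply: mulr_ge0; [exact: ler0n|apply: mulr_ge0; [exact: sqr_ge0|exact: bound_ge0]].
Qed.

Let integral_U k : (\int[area]_(p in D) U k p <= (K * half_pow k)%:E)%E.
Proof.
have mD : measurable D by exact: measurable_disk.
rewrite ge0_integralZl//; last 2 first.
- exact: measurable_funTS.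
- by rewrite lee_fin ltW.
have wb := weighted_bound (measurable_disk_weight w_superharmonic w_positive)
  (disk_weight_ge0 w_positive) (disk_weight_circle w_superharmonic) (scale_gt0 k) (scaleP k).
have c0 : (0 <= (coef k)%:E)%E by rewrite lee_fin ltW.
apply: le_trans (lee_wpmul2l c0 wb) _.
rewrite muleA -EFinM.
have zk := zs1 lac k.
have -> : disk_weight w (to_plane (zs k)) = w (zs k).
  by rewrite /disk_weight to_planeK ifT// -unit_disk_plane to_planeK unit_diskE.
have C0 := bound_ge0.
have s0 := scale_gt0 k; have A0 := amp_gt0 (R := R) k; have k0 := kaps_gt0 lac k.
apply: le_trans (lee_wpmul2l _ (zs_weight k)) _.
  rewrite lee_fin; apply: mulr_ge0; first exact: ltW (coef_gt0 k).
  by apply: divr_ge0; [exact: bound_ge0|exact: sqr_ge0].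
rewrite -EFinM lee_fin /coef /K; move: C0; move: (23 * 512 * pi) => C C0.
(* The amplitudes cancel against the bound on w (zs k), kaps / scale is at most 32, and one of the
   two factors [half_pow k] compensates 2^k; the other makes the series summable. *)
have -> : 2 ^+ k.+1 * (10 * (amp k * kaps zs k)) ^+ 2 * (C / scale k ^+ 2) *
   (half_pow k ^+ 2 / amp k ^+ 2) = (200 * C * half_pow k) * (kaps zs k / scale k) ^+ 2 *
     (2 ^+ k * half_pow k).
  by rewrite exprS; field; rewrite !gt_eqF.
have -> : 2 ^+ k * half_pow k = 1 :> R by rewrite -exprMn mulfV// expr1n.
have -> : 200 * (32 ^+ 2 * C) * half_pow k = (200 * C * half_pow k) * 32 ^+ 2 by ring.
rewrite mulr1; apply: ler_wpM2l.
  apply: mulr_ge0; last exact: ltW (half_pow_gt0 k).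
  by apply: mulr_ge0; [exact: ler0n|exact: C0].
apply: lerXn2r; rewrite ?nnegrE//; first by rewrite divr_ge0 ?ltW.
by rewrite ler_pdivrMr// /scale; have := kap_le zk; rewrite /kaps; lra.
Qed.

Variables f df : cplx R -> cplx R.
Hypothesis fdf : is_spike_series zs f df.

Let df_sqr_le n p : cabs (plane_to_cplx p) < 1 ->
  cabs (\sum_(k < n) dspike zs k (plane_to_cplx p)) ^+ 2 <= \sum_(k < n) coef k * quot k p ^+ 2.
Proof.
move=> p1; set z := plane_to_cplx p in p1 *.
apply: le_trans (_ : (\sum_(k < n) cabs (dspike zs k z)) ^+ 2 <= _).
  by apply: lerXn2r; rewrite ?nnegrE ?cabs_ge0 ?sumr_ge0//; [move=> *; exact: cabs_ge0|exact: cabs_sum].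
apply: le_trans (sqr_sum_le _ (fun k => cabs (dspike zs k z))) _.
apply: ler_sum => k _; rewrite /coef -mulrA -exprMn; apply: ler_wpM2l; first exact: exprn_ge0.
apply: lerXn2r; rewrite ?nnegrE ?cabs_ge0//; last exact: dspike_quot.
by apply: le_trans (dspike_quot k p1); exact: cabs_ge0.
Qed.

Let pointwise p : D p ->
  ((cabs (df (plane_to_cplx p)) ^+ 2)%:E * W p <= \sum_(k <oo) U k p)%E.
Proof.
move=> Dp.
have p1 : cabs (plane_to_cplx p) < 1.
  by rewrite -unit_diskE unit_disk_plane; move: Dp; rewrite /D /disk /= !subr0 expr1n.
have wp : (0 < W p)%E.
  have h : p.1 ^+ 2 + p.2 ^+ 2 < 1 by rewrite -unit_disk_plane unit_diskE.
  by rewrite /W /disk_weight h; apply: w_positive; rewrite unit_diskE.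
pose c k : R := coef k * quot k p ^+ 2.
have c0 k : 0 < c k by rewrite mulr_gt0// exprn_gt0.
have cE k : (0 <= (c k)%:E)%E by rewrite lee_fin ltW.
have UE k : U k p = ((c k)%:E * W p)%E by rewrite /U muleCA -EFinM muleC.
have partial n : ((\sum_(k < n) c k)%:E <= \sum_(k <oo) (c k)%:E)%E.
  rewrite -sumEFin -(big_mkord xpredT (fun k => (c k)%:E)).
  exact: nneseries_lim_ge.
under eq_eseriesr do rewrite UE.
(* Where the weight is infinite, the first term of the series is already infinite. *)
have [Winf|Wfin] := eqVneq (W p) +oo%E.
  rewrite Winf; under eq_eseriesr do rewrite gt0_muley ?lte_fin//.
  apply: le_trans (leey _) _.
  apply: le_trans (nneseries_lim_ge 1%N _); last by move=> *; exact: leey.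
  by rewrite big_nat1.
have /EFin_fin_numP[x Wx] : W p \is a fin_num.
  by rewrite fin_numE Wfin andbT; apply/eqP => h; move: wp; rewrite h.
rewrite Wx; under eq_eseriesr do rewrite muleC.
rewrite nneseriesZl// muleC; apply: lee_wpmul2l; first by rewrite -Wx ltW.
have : (0 <= \sum_(k <oo) (c k)%:E)%E by exact: nneseries_ge0.
case E : (\sum_(k <oo) (c k)%:E)%E => [B| |//]; last by move=> _; exact: leey.
rewrite !lee_fin => B0.
have [_ dfl] := fdf p1.
have l0 : 0 <= 4 * (5 / (1 - cabs (plane_to_cplx p)) ^+ 2).
  by rewrite mulr_ge0// divr_ge0// sqr_ge0.
rewrite -[leRHS]sqr_sqrtr//; apply: lerXn2r; rewrite ?nnegrE ?cabs_ge0 ?sqrtr_ge0//.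
rewrite -[df _]subr0; apply: (fast_limit_le l0 dfl).
exists 0%N => n _; rewrite subr0 -(@ler_pXn2r _ 2)// ?nnegrE ?cabs_ge0 ?sqrtr_ge0// sqr_sqrtr//.
apply: le_trans (df_sqr_le n p1) _.
by have := partial n; rewrite E lee_fin.
Qed.

Lemma spike_series_in_space : weighted_dirichlet_space w f.
Proof.
split=> [z|]; first by rewrite unit_diskE => /(spike_series_derive lac fdf)[].
have DE : @plane_to_cplx R @^-1` @unit_disk R = D.
  by apply/seteqP; split => p; rewrite /D /disk /= unit_disk_plane !subr0 expr1n.
rewrite /weighted_dirichlet_integral DE.
have pi0 : (0 <= (pi^-1)%:E :> \bar R)%E by rewrite lee_fin invr_ge0 pi_ge0.
have mD : measurable D by exact: measurable_disk.
apply: (@le_lt_trans _ _ ((pi^-1)%:E * (K * 2)%:E)%E); last by rewrite -EFinM ltry.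
apply: lee_wpmul2l => //.
apply: (@le_trans _ _ (\int[area]_(p in D) \sum_(k <oo) U k p)%E).
  have DP p : D p -> cabs (plane_to_cplx p) < 1 /\ w (plane_to_cplx p) = W p.
    rewrite -unit_diskE /D /disk /= !subr0 expr1n => h; rewrite unit_disk_plane.
    by rewrite /W /disk_weight h.
  apply: ge0_le_integral_nonmeasurable => p Dp; have [p1 wp] := DP p Dp.
    by rewrite wp mule_ge0 ?lee_fin ?sqr_ge0// disk_weight_ge0.
  have [_ ->] := spike_series_derive lac fdf p1.
  by rewrite wp; exact: pointwise.
rewrite integral_nneseries//; last first.
  by move=> k; apply: measurable_funeM; exact: measurable_funTS.
apply: lime_le.
  by apply: is_cvg_nneseries => k _ _; apply: integral_ge0.
apply: nearW => n; rewrite big_mkord.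
apply: (@le_trans _ _ (\sum_(k < n) (K * half_pow k)%:E)%E); first by apply: lee_sum => k _; exact: integral_U.
rewrite sumEFin lee_fin -mulr_sumr; apply: ler_wpM2l => //.
exact: sum_half_pow_le2.
Qed.

End membership.

(** * Area of the range *)

Section slopes.
Context {R : realType}.
Notation plane := (measurableTypeR R * measurableTypeR R)%type.
Notation area := (@lebesgue_measure R \x @lebesgue_measure R)%E.

Lemma derivable_lipschitz_at (f : cplx R -> cplx R) (z : cplx R) (L : R) :
  derivable f z 1 -> cabs (derive1 f z) < L ->
  exists2 r : R, 0 < r & forall u, cabs (u - z) < r -> cabs (f u - f z) <= L * cabs (u - z).
Proof.
move=> fz; rewrite derive1E => fL; set D := 'D_1 f z in fL.
have nD : nbhs D [set u : cplx R | cabs u < L].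
  apply/cplx_nbhsP; exists (L - cabs D); first by rewrite subr_gt0.
  by move=> u /= uD; have := cabs_sub u D; lra.
have := fz _ nD; rewrite /nbhs /= /dnbhs /within /= => /cplx_nbhsP[r r0 rP].
exists r => // u ur; have [->|uz] := eqVneq u z.
  by rewrite !subrr cabs0 mulr0.
have uz0 : u - z != 0 by rewrite subr_eq0.
have := rP (u - z); rewrite subr0 => /(_ ur uz0) /=.
rewrite /GRing.scale /= mulr1 subrK cabsM cabsV => h.
have p : 0 < cabs (u - z) by rewrite cabs_gt0.
by apply: ltW; rewrite -ltr_pdivrMr// mulrC.
Qed.

Variable f : cplx R -> cplx R.
Hypothesis f_holomorphic : holomorphic_on (@unit_disk R) f.

Let Q (p : plane) : cplx R := plane_to_cplx p.
Let D : set plane := disk (0, 0) 1.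
Let DE p : D p <-> unit_disk (Q p).
Proof. by rewrite /D /disk /Q /= unit_disk_plane !subr0 expr1n. Qed.

(** The slope is controlled at a definite scale 1/(k+1), as the covering lemma requires, and in
    terms of f rather than f', which makes measurability accessible. *)
Definition slope_le (L : R) (k : nat) : set plane := [set p | D p /\
  forall u, unit_disk u -> cabs (u - Q p) < k.+1%:R^-1 ->
    cabs (f u - f (Q p)) <= L * cabs (u - Q p)].

(** A point u violating the slope bound at z still violates it when z moves slightly, since f has
    finite slope M at z: a move below gap / (L + M) cannot close the gap. Measurability of the slope
    sets follows. *)
Lemma open_slope_gt (L : R) (k : nat) : 0 <= L -> open [set z : cplx R | unit_disk z /\
  exists u, [/\ unit_disk u, cabs (u - z) < k.+1%:R^-1 & L * cabs (u - z) < cabs (f u - f z)]].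
Proof.
move=> L0; rewrite openE => z [Dz [u [Du uz Lu]]].
pose M := cabs (derive1 f z) + 1; have M0 : 0 < M by rewrite ltr_wpDl ?cabs_ge0.
have [r r0 rP] := @derivable_lipschitz_at f z M (f_holomorphic Dz) (ltac:(rewrite ltrDl; lra)).
pose gap := cabs (f u - f z) - L * cabs (u - z).
have gap0 : 0 < gap by rewrite subr_gt0.
have LM0 : 0 < L + M by rewrite ltr_wpDl.
apply/cplx_nbhsP; exists (Num.min (Num.min r (1 - cabs z))
   (Num.min (k.+1%:R^-1 - cabs (u - z)) (gap / (L + M)))).
  have z1 : cabs z < 1 by rewrite -unit_diskE.
  by rewrite !lt_min r0 !subr_gt0 uz z1 divr_gt0.
move=> v; rewrite !lt_min => /andP[/andP[vr v1] /andP[vk vgap]].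
split.
  by rewrite unit_diskE; have := cabs_triangle (v - z) z; rewrite subrK; lra.
exists u; split => //.
  have := cabs_distD u z v; rewrite (cabs_distC z v); move: vk; set x := k.+1%:R^-1; lra.
have h1 := rP v vr; move: vgap; rewrite ltr_pdivlMr// => vgap.
have h2 := cabs_distD (f u) (f v) (f z).
have h3 : L * cabs (u - v) <= L * cabs (u - z) + L * cabs (v - z).
  by rewrite -mulrDr; apply: ler_wpM2l => //; have := cabs_distD u z v; rewrite (cabs_distC z v).
move: h1 h2 h3 vgap; rewrite /gap mulrDr (mulrC _ L) (mulrC _ M).
by set x := L * cabs (v - z); set y := M * _; set s := L * cabs (u - v); set t := L * cabs (u - z); lra.
Qed.

Lemma measurable_slope_le (L : R) (k : nat) : 0 <= L -> measurable (slope_le L k).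
Proof.
move=> L0; pose bad : set plane := Q @^-1` [set z : cplx R | unit_disk z /\
  exists u, [/\ unit_disk u, cabs (u - z) < k.+1%:R^-1 & L * cabs (u - z) < cabs (f u - f z)]].
have -> : slope_le L k = D `\` bad.
  apply/seteqP; split => p.
    move=> [Dp pL]; split => // -[_ [u [Du up]]].
    by rewrite ltNge pL.
  move=> [Dp nb]; split => // u Du up; rewrite leNgt; apply/negP => h.
  by apply: nb; split; [exact/DE|exists u].
apply: measurableD; first exact: measurable_disk.
apply: measurable_open_plane; apply: open_comp; last exact: open_slope_gt.
by move=> x _; exact: continuous_plane_to_cplx.
Qed.

Definition slope_lt (L : R) : set plane := \bigcup_k slope_le L k.

Lemma measurable_slope_lt L : 0 <= L -> measurable (slope_lt L).
Proof. by move=> L0; apply: bigcup_measurable => k _; exact: measurable_slope_le. Qed.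

Lemma slope_lt_derive L p : D p -> cabs (derive1 f (Q p)) < L -> slope_lt L p.
Proof.
move=> Dp pL; have Dz : unit_disk (Q p) by exact/DE.
have [r r0 rP] := derivable_lipschitz_at (f_holomorphic Dz) pL.
have [k _ kr] := near_infty_natSinv_lt (PosNum r0).
exists k => //; split => // u Du uk; apply: rP; apply: lt_trans uk _.
exact: (kr k (leqnn k)).
Qed.

Definition plane_map (p : plane) : plane := to_plane (f (Q p)).

Lemma slope_le_image L k (A : set plane) : 0 <= L -> measurable A -> A `<=` slope_le L k ->
  exists O : set plane, [/\ measurable O, plane_map @` A `<=` O &
    (area O <= (16 * L ^+ 2)%:E * area A)%E].
Proof.
move=> L0 mA AL.
have [|||p q s Ap Aq|O [mO AO aO]] := @lipschitz_image R A plane_map 1 (2 * L) (2 * k.+1%:R)^-1 mA.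
- move=> p Ap; have [/DE Dp _] := AL p Ap; rewrite unit_diskE in Dp.
  by split; apply: le_lt_trans Dp; [exact: (Re_le_cabs (Q p))|exact: (Im_le_cabs (Q p))].
- by rewrite mulr_ge0.
- by rewrite invr_gt0 mulr_gt0.
- move=> sk h1 h2.
  have [_ qL] := AL q Aq; have [/DE Dp _] := AL p Ap.
  have d : cabs (Q p - Q q) <= 2 * s.
    by apply: le_trans (cabs_le_ReIm _) _; rewrite -plane_to_cplxB/=; lra.
  have dk : cabs (Q p - Q q) < k.+1%:R^-1.
    apply: le_lt_trans d _; move: sk; rewrite invfM; set x := k.+1%:R^-1; lra.
  have e := qL _ Dp dk.
  have e2 : cabs (f (Q p) - f (Q q)) <= 2 * L * s.
    by apply: le_trans e _; rewrite (mulrC 2) -mulrA; exact: ler_wpM2l.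
  have pm : plane_map p - plane_map q = to_plane (f (Q p) - f (Q q)).
    by rewrite /plane_map; case: (f (Q p)) => a b; case: (f (Q q)).
  split; apply: le_trans e2.
    by have := Re_le_cabs (f (Q p) - f (Q q)); rewrite /plane_map /to_plane; case: (f (Q p)) => a b; case: (f (Q q)).
  by have := Im_le_cabs (f (Q p) - f (Q q)); rewrite /plane_map /to_plane; case: (f (Q p)) => a b; case: (f (Q q)).
exists O; split => //; apply: le_trans aO _.
by rewrite (_ : 4 * (2 * L) ^+ 2 = 16 * L ^+ 2)//; ring.
Qed.

(** The scale depends on the point, so [A] is cut into disjoint pieces of fixed scale; the constant
    in the area bound does not involve the scale, and the areas add up. *)
Lemma slope_lt_image L (A : set plane) : 0 <= L -> measurable A -> A `<=` slope_lt L ->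
  exists O : set plane, [/\ measurable O, plane_map @` A `<=` O &
    (area O <= (16 * L ^+ 2)%:E * area A)%E].
Proof.
move=> L0 mA AL.
pose B k := A `&` seqDU (slope_le L) k.
have mB k : measurable (B k).
  by apply: measurableI => //; apply: seqDU_measurable => j; exact: measurable_slope_le.
have AB : A = \bigcup_k B k.
  rewrite -setI_bigcupr -seqDU_bigcup_eq; apply/seteqP; split => [p Ap|p []//].
  by split => //; exact: AL.
have tB : trivIset setT B.
  by apply: trivIset_setIl; exact: trivIset_seqDU.
have Bk k : B k `<=` slope_le L k by move=> p [_ []].
have /choice[V VP] := fun k => slope_le_image L0 (mB k) (Bk k).
exists (\bigcup_k V k); split.
- by apply: bigcup_measurable => k _; have [] := VP k.
- move=> _ [p Ap <-]; move: Ap; rewrite AB => -[k _ Bp]; exists k => //.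
  by have [_ h _] := VP k; apply: h; exists p.
have mO k : measurable (V k) by have [] := VP k.
apply: (@le_trans _ _ (\sum_(k <oo) area (V k))%E).
  apply: measure_sigma_subadditive => //; exact: bigcupT_measurable.
have -> : area A = (\sum_(k <oo) area (B k))%E.
  by rewrite {1}AB measure_semi_bigcup// -AB.
rewrite -nneseriesZl//; apply: lee_nneseries => // k _.
by have [] := VP k.
Qed.

End slopes.

(** The powers of 4 that are present form a geometric sum, at most 4/3 of its last term, which is at
    most x^2. *)
Lemma sum_dyadic_le (R : realType) n (x : R) : 0 <= x ->
  \sum_(j < n) 4 ^+ j * (2 ^+ j <= x)%R%:R <= 2 * x ^+ 2.
Proof.
move=> x0; elim: n => [|n IH]; first by rewrite big_ord0 mulr_ge0// sqr_ge0.
have [h|h] := boolP (2 ^+ n <= x); last by rewrite big_ord_recr /= (negbTE h) mulr0 addr0.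
have geom m : \sum_(j < m) 4 ^+ j = (4 ^+ m - 1) / 3 :> R.
  elim: m => [|m IHm]; first by rewrite big_ord0 expr0 subrr mul0r.
  by rewrite big_ord_recr /= IHm exprS; field.
apply: (@le_trans _ _ (\sum_(j < n.+1) 4 ^+ j)).
  by apply: ler_sum => j _; case: (_ <= x); rewrite ?mulr1// mulr0 exprn_ge0.
have : 4 ^+ n <= x ^+ 2.
  have -> : 4 ^+ n = (2 ^+ n) ^+ 2 :> R by rewrite -exprM mulnC exprM; congr (_ ^+ n); ring.
  by apply: lerXn2r; rewrite ?nnegrE ?exprn_ge0.
rewrite geom (exprS 4); have : 0 <= 4 ^+ n :> R by rewrite exprn_ge0.
set q := 4 ^+ n; lra.
Qed.

(** * Finite area of the range *)

Section no_surjection.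
Context {R : realType}.
Notation plane := (measurableTypeR R * measurableTypeR R)%type.
Notation area := (@lebesgue_measure R \x @lebesgue_measure R)%E.
Variables (w : cplx R -> \bar R) (f : cplx R -> cplx R) (c : R).
Hypothesis c0 : 0 < c.
Hypothesis wc : forall z, unit_disk z -> (c%:E <= w z)%E.
Hypothesis f_space : weighted_dirichlet_space w f.

Let f_hol : holomorphic_on (@unit_disk R) f := f_space.1.
Let D : set plane := disk (0, 0) 1.
Let mD : measurable D. Proof. exact: measurable_disk. Qed.
Let DE (p : plane) : D p <-> unit_disk (plane_to_cplx p).
Proof. by rewrite /D /disk /= unit_disk_plane !subr0 expr1n. Qed.
Let g (p : plane) := ((cabs (derive1 f (plane_to_cplx p)) ^+ 2)%:E * w (plane_to_cplx p))%E.
Let I := (\int[area]_(p in D) g p)%E.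

Let g_ge0 p : D p -> (0 <= g p)%E.
Proof.
move=> /DE Dp; rewrite mule_ge0 ?lee_fin ?sqr_ge0//.
by apply: le_trans (wc Dp); rewrite lee_fin ltW.
Qed.

Let I_lt : (I < +oo)%E.
Proof.
have [_] := f_space; rewrite /weighted_dirichlet_integral.
rewrite (_ : @plane_to_cplx R @^-1` @unit_disk R = D); last first.
  by apply/seteqP; split => p /DE.
rewrite -[integral _ _ _]/I; have : (0 <= I)%E by apply: integral_ge0; exact: g_ge0.
case: I => [r _ _|_|//]; first exact: ltry.
by rewrite gt0_muley// lte_fin invr_gt0 pi_gt0.
Qed.

Let A j : set plane := slope_lt f (2 ^+ j.+1) `\` slope_lt f (2 ^+ j).
Let two_ge0 j : 0 <= 2 ^+ j :> R. Proof. exact: exprn_ge0. Qed.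
Let mS j : measurable (slope_lt f (2 ^+ j)).
Proof. exact: measurable_slope_lt. Qed.
Let mA j : measurable (A j). Proof. exact: measurableD. Qed.
Let SD L : slope_lt f L `<=` D. Proof. by move=> p [k _ []]. Qed.

(** The factor c / 2 makes [sum_dyadic_le] bound the sum over the layers by c |f'|^2. *)
Let k j : R := c / 2 * 4 ^+ j.
Let k_ge0 j : 0 <= k j.
Proof. by rewrite mulr_ge0 ?exprn_ge0// divr_ge0// ltW. Qed.

(** On [A j] one has |f'| >= 2^j, since a smaller derivative would put the point in
    [slope_lt f (2 ^+ j)]. *)
Let sum_area_le : (\sum_(j <oo) (k j)%:E * area (A j) <= I)%E.
Proof.
pose u j (p : plane) := ((k j)%:E * (\1_(A j) p)%:E)%E.
have u0 j p : (0 <= u j p)%E by rewrite mule_ge0// lee_fin.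
have mu j : measurable_fun [set: plane] (u j).
  by apply: measurable_funeM; apply/measurable_EFinP; exact: measurable_indic.
apply: (@le_trans _ _ (\int[area]_(p in D) \sum_(j <oo) u j p)%E).
  rewrite integral_nneseries//; last by move=> j; exact: measurable_funTS.
  apply: lee_nneseries => [j _|j _]; first by rewrite mule_ge0// lee_fin.
  rewrite ge0_integralZl//.
  - rewrite integral_indic// setIidl// => p [Sp _]; exact: SD Sp.
  - by apply: measurable_funTS; apply/measurable_EFinP; exact: measurable_indic.
  - by rewrite lee_fin.
apply: ge0_le_integral_nonmeasurable => p Dp; first exact: nneseries_ge0.
apply: lime_le; first exact: is_cvg_nneseries.
apply: nearW => n; rewrite big_mkord.
have Dz : unit_disk (plane_to_cplx p) by exact/DE.
set x := cabs (derive1 f (plane_to_cplx p)).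
apply: (@le_trans _ _ ((x ^+ 2)%:E * c%:E)%E); last first.
  by apply: lee_wpmul2l; [rewrite lee_fin sqr_ge0|exact: wc].
rewrite (eq_bigr (fun j : 'I_n => (k j * \1_(A j) p)%:E))//.
rewrite sumEFin -EFinM lee_fin.
apply: (@le_trans _ _ (c / 2 * \sum_(j < n) 4 ^+ j * (2 ^+ j <= x)%R%:R)).
  rewrite mulr_sumr; apply: ler_sum => j _; rewrite /k -mulrA.
  apply: ler_wpM2l; first by rewrite divr_ge0// ltW.
  apply: ler_wpM2l; first by rewrite exprn_ge0.
  rewrite indicE; have [/set_mem[_ nS]|] := boolP (p \in A j); last by rewrite ler0n.
  rewrite ler_nat; case: leP => // h; exfalso; apply: nS.
  exact: slope_lt_derive.
have h := sum_dyadic_le n (cabs_ge0 (derive1 f (plane_to_cplx p))).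
apply: le_trans (ler_wpM2l _ h) _; first by rewrite divr_ge0// ltW.
by rewrite -/x le_eqVlt; apply/orP; left; apply/eqP; field.
Qed.

Lemma range_covered : exists2 T : set plane, measurable T &
  plane_map f @` D `<=` T /\ (area T < +oo)%E.
Proof.
have one_ge0 : 0 <= 1 :> R by [].
have [V0 [mV0 SV0 aV0]] := slope_lt_image f_hol one_ge0 (measurable_slope_lt f_hol one_ge0) (@subset_refl _ _).
have AS j : A j `<=` slope_lt f (2 ^+ j.+1) by move=> p [].
have /choice[V VP] := fun j => slope_lt_image f_hol (two_ge0 j.+1) (mA j) (AS j).
have mV j : measurable (V j) by have [] := VP j.
exists (V0 `|` \bigcup_j V j); first by apply: measurableU => //; exact: bigcupT_measurable.
split.
  move=> _ [p Dp <-].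
  (* Some power of 2 exceeds |f'|; descending from it ends either in a layer [A n] or in the set of
     slope at most 1, covered by [V0]. *)
  have [n pn] : exists n, slope_lt f (2 ^+ n) p.
    pose x := cabs (derive1 f (plane_to_cplx p)).
    exists (Num.truncn x).+1; apply: slope_lt_derive => //.
    apply: lt_le_trans (truncnS_gt _) _.
    by rewrite -natrX ler_nat ltnW// ltn_expl.
  elim: n pn => [|n IH] pn; first by left; apply: SV0; exists p.
  have [Sp|nSp] := pselect (slope_lt f (2 ^+ n) p); first exact: IH.
  by right; exists n => //; have [_ h _] := VP n; apply: h; exists p.
apply: le_lt_trans (measureU2 _ _ _) _ => //; first exact: bigcupT_measurable.
apply: lte_add_pinfty.
  apply: le_lt_trans aV0 _; rewrite expr1n.
  have h : (area (slope_lt f 1) <= 4%:E)%E.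
    have -> : 4%:E = area (closed_square (0, 0) 1).
      by rewrite area_closed_square// expr1n mulr1.
    apply: le_measure; rewrite ?inE//; [exact: measurable_slope_lt|exact: measurable_closed_square|].
    move=> p /SD/DE; rewrite unit_diskE => p1; apply: closed_squareP; rewrite subr0; apply: ltW.
      exact: le_lt_trans (Re_le_cabs (plane_to_cplx p)) p1.
    exact: le_lt_trans (Im_le_cabs (plane_to_cplx p)) p1.
  apply: le_lt_trans (lee_wpmul2l _ h) _; first by rewrite lee_fin.
  by rewrite -EFinM ltry.
(* The constant: 16 (2^(j+1))^2 = 64 * 4^j is 128 / c times [k j]. *)
apply: (@le_lt_trans _ _ ((128 / c)%:E * I)%E); last first.
  move: I_lt (integral_ge0 _ g_ge0 : 0 <= I)%E; case: I => [r _ _||]//.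
  by rewrite -EFinM ltry.
apply: (@le_trans _ _ (\sum_(j <oo) area (V j))%E).
  apply: measure_sigma_subadditive => //; exact: bigcupT_measurable.
have c1 : 0 <= 128 / c by rewrite divr_ge0// ltW.
apply: (@le_trans _ _ ((128 / c)%:E * \sum_(j <oo) (k j)%:E * area (A j))%E); last first.
  by apply: lee_wpmul2l; [rewrite lee_fin|exact: sum_area_le].
rewrite -nneseriesZl; last by move=> j _; rewrite mule_ge0// lee_fin.
apply: lee_nneseries => // j _; have [_ _ h] := VP j; apply: le_trans h _.
rewrite muleA -EFinM.
rewrite (_ : 16 * (2 ^+ j.+1) ^+ 2 = 128 / c * k j)//.
rewrite /k -exprM mulnC exprM exprS -natrX; field; by rewrite gt_eqF.
Qed.

Lemma not_surjective : f @` @unit_disk R <> setT.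
Proof.
move=> fT; have [T mT [DT aT]] := range_covered.
have [M [M0 TM]] : exists M, 0 <= M /\ area T = M%:E.
  have T0 : (0 <= area T)%E by exact: measure_ge0.
  by move: aT T0; case: (area T) => // M _ M0; exists M.
(* A surjective f would put this square, of area 4 (M + 1)^2 > M, inside a set of area M. *)
have : (area (closed_square (0, 0)%R (M + 1)%R) <= area T)%E.
  apply: le_measure; rewrite ?inE//; first exact: measurable_closed_square.
  move=> q _; have : setT (plane_to_cplx q) by [].
  rewrite -fT => -[z Dz fz]; apply: DT; exists (to_plane z).
    by apply/DE; rewrite to_planeK.
  by rewrite /plane_map to_planeK fz plane_to_cplxK.
rewrite area_closed_square ?addr_ge0// TM lee_fin; nra.
Qed.

End no_surjection.

Theorem theorem1p4 (R : realType) (w : cplx R -> \bar R)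
    (w_superharmonic : superharmonic_on (@unit_disk R) w)
    (w_positive : forall z, unit_disk z -> (0 < w z)%E) :
  (exists2 f, weighted_dirichlet_space w f & f @` @unit_disk R = setT)
  <-> ereal_inf (w @` @unit_disk R) = 0%E.
Proof.
split=> [[f f_space fT]|w_inf].
  have inf_ge0 : (0 <= ereal_inf (w @` @unit_disk R))%E.
    by apply: le_ereal_inf_tmp => _ [z Dz <-]; exact/ltW/w_positive.
  apply/eqP; rewrite eq_le inf_ge0 andbT leNgt; apply/negP => inf_gt0.
  have [c c0 wc] : exists2 c : R, 0 < c & forall z, unit_disk z -> (c%:E <= w z)%E.
    move: inf_gt0 (@ereal_inf_lbound _ (w @` @unit_disk R)).
    case: ereal_inf => [c|_ h|//].
      by rewrite lte_fin => c0 h; exists c => // z Dz; apply: h; exists z.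
    (* If the infimum is [+oo], any positive constant bounds w from below. *)
    exists 1 => // z Dz; apply: le_trans (h (w z) _); first exact: leey.
    by exists z.
  exact: not_surjective c0 wc f_space fT.
have [zs lac zsw] := spike_points w_superharmonic w_positive w_inf.
have [f [df fdf]] := spike_series_exists lac.
exists f; first exact: (spike_series_in_space w_superharmonic w_positive lac zsw fdf).
apply/seteqP; split => // c _; have [z z1 fz] := spike_series_surjective lac c fdf.
by exists z => //; rewrite unit_diskE.
Qed.
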